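(* Consider the linear regression setting and the hierarchical Bayesian model with hyper-pMOM priors and a complexity prior on the model space described in the context. Assume: (1) There exist $\epsilon_n<1$ such that $0<\epsilon_n\le\lambda_k^m\le\lambda_k^M\le\epsilon_n^{-1}$ for every nonempty model $\mathbf k$, where $\epsilon_n^{-1}=O((\log n)^{1/8})$. (2) $\pi(\mathbf k)=0$ for all models with $|\mathbf k|>q_n$, where $q_n=O(n^{\xi})$ and $\xi<1$ (and $|\mathbf t|\le q_n$). (3) There are constants $a_1,a_2$ not depending on $n$ such that, for every $n\ge1$, all eigenvalues of $A_p$ lie strictly between $a_1$ and $a_2$, where $0<a_1<a_2<\infty$. (4) There exists a constant $0<\kappa<1$ such that $\log p=O(n^{\kappa})$. Then $$\max_{\mathbf k\neq\mathbf t}\frac{\pi(\mathbf k\mid\mathbf y_n)}{\pi(\mathbf t\mid\mathbf y_n)}\to0\quad\text{in probability as }n\to\infty .$$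
   Context: **Data.** The number of coefficients $p=p_n$ increases with the sample size $n$. $X_n$ is an $n\times p$ design matrix. The data are truly generated by $\mathbf y_n=X_n\boldsymbol\beta_0+\boldsymbol\epsilon_n$, where the entries of $\boldsymbol\epsilon_n$ are i.i.d. $N(0,\sigma_0^2)$ and $\boldsymbol\beta_0\in\mathbb R^{p_n}$. The nonzero entries of $\boldsymbol\beta_0$ are exactly those with index in $\mathbf t\subseteq\{1,\dots,p_n\}$. The set $\mathbf t$, the vector $\boldsymbol\beta_{0,t}$ of nonzero entries, and $\sigma_0^2>0$ do not vary with $n$. Convergence in probability is with respect to this true law of $\mathbf y_n$. **Models.** A model is a subset $\mathbf k=\{k_1,\dots,k_m\}\subseteq\{1,\dots,p\}$, the set of indices of nonzero coefficients. Its cardinality is also denoted $k=|\mathbf k|$, and $t=|\mathbf t|$. $X_k$ is the submatrix of $X_n$ formed by the columns in $\mathbf k$; $\boldsymbol\beta_k=(\beta_{k_1},\dots,\beta_{k_k})^T$; $A_k$ is the $k\times k$ principal submatrix of the symmetric $p\times p$ matrix $A_p$ indexed by $\mathbf k$. **Hierarchical model.** Fix a positive integer $r$ and constants $\alpha_1,\alpha_2,c_1,c_2>0$. Set - $\mathbf y_n\mid\boldsymbol\beta_k,\sigma^2,\mathbf k\sim N(X_k\boldsymbol\beta_k,\sigma^2I_n)$; - $\pi(\boldsymbol\beta_k\mid\tau,\sigma^2,\mathbf k)=d_k(2\pi)^{-k/2}(\tau\sigma^2)^{-rk-k/2}|A_k|^{1/2}\exp\{-\boldsymbol\beta_k^TA_k\boldsymbol\beta_k/(2\tau\sigma^2)\}\prod_{i=1}^k\beta_{k_i}^{2r}$,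 where $d_k$ is the normalizing constant (independent of $\tau,\sigma^2$); - complexity prior: $\pi(\mathbf k)\propto c_1^{-k}p^{-c_2k}$, $k=|\mathbf k|$, over the models with $|\mathbf k|\le q_n$ (and $\pi(\mathbf k)=0$ for the other models); - $\pi(\tau)=\frac{(n/2)^{1/2}}{\Gamma(1/2)}\tau^{-3/2}e^{-n/(2\tau)}$, $\tau>0$; - $\pi(\sigma^2)=\frac{\alpha_2^{\alpha_1}}{\Gamma(\alpha_1)}(\sigma^2)^{-(\alpha_1+1)}e^{-\alpha_2/\sigma^2}$, $\sigma^2>0$. The marginal density is $m_{\mathbf k}(\mathbf y_n)=\int_0^\infty\int_0^\infty\int_{\mathbb R^k}\pi(\mathbf y_n\mid\boldsymbol\beta_k,\sigma^2,\mathbf k)\,\pi(\boldsymbol\beta_k\mid\tau,\sigma^2,\mathbf k)\,\pi(\tau)\,\pi(\sigma^2)\,d\boldsymbol\beta_k\,d\sigma^2\,d\tau$, and the posterior probability of model $\mathbf k$ is $\pi(\mathbf k\mid\mathbf y_n)=\pi(\mathbf k)m_{\mathbf k}(\mathbf y_n)/\sum_{\mathbf j}\pi(\mathbf j)m_{\mathbf j}(\mathbf y_n)$. **Eigenvalues.** $\nu_j(A)$ is the $j$-th largest nonzero eigenvalue of a symmetric matrix $A$; $\lambda_k^m=\min_{1\le j\le\min(n,k)}\nu_j(X_k^TX_k/n)$ and $\lambda_k^M=\max_{1\le j\le\min(n,k)}\nu_j(X_k^TX_k/n)$. *)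

(* Defs.v *)
From HB Require Import structures.
From mathcomp Require Import all_boot all_order all_algebra.
From mathcomp Require Import all_classical all_reals all_analysis.
From mathcomp Require polyrcf.
Set Implicit Arguments.
Unset Strict Implicit.
Unset Printing Implicit Defensive.
Import Order.TTheory GRing.Theory Num.Theory.
Import numFieldNormedType.Exports.
Local Open Scope classical_set_scope.
Local Open Scope ring_scope.

(* Indices start at 0, so a model is a subset of {0, ..., p-1}; the columns and
   the coefficients of a model k are numbered by 'I_#|k| in increasing order. *)

Definition model_cols (R : Type) (n p : nat) (X : 'M[R]_(n, p))
    (k : {set 'I_p}) : 'M[R]_(n, #|k|) :=
  colsub (fun i : 'I_#|k| => enum_val i) X.

Definition model_principal (R : Type) (p : nat) (A : 'M[R]_p)
    (k : {set 'I_p}) : 'M[R]_#|k| :=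
  mxsub (fun i : 'I_#|k| => enum_val i) (fun i : 'I_#|k| => enum_val i) A.

(* The true coefficients are the first p entries of a sequence b0 which does not
   depend on the sample size; its support is the true model. *)
Definition true_coef (R : Type) (b0 : nat -> R) (p : nat) : 'cV[R]_p :=
  \col_i b0 i.

Definition true_model (R : realType) (b0 : nat -> R) (p : nat) : {set 'I_p} :=
  [set i : 'I_p | b0 i != 0]%SET.

Section Eigenvalues.
Context {R : realType}.

(* real eigenvalues counted with multiplicity, in nonincreasing order;
   rootsR lists the distinct real roots *)
Definition eigenvalue_seq (k : nat) (G : 'M[R]_k) : seq R :=
  sort >=%R (flatten [seq nseq (mup x (char_poly G)) x
                     | x <- polyrcf.rootsR (char_poly G)]).

(* j starts at 1. When G has fewer than j nonzero eigenvalues the value is 0, so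
   that a positive lower bound on nu G j entails that the j-th one exists. *)
Definition nu (k : nat) (G : 'M[R]_k) (j : nat) : R :=
  nth 0 [seq x <- eigenvalue_seq G | x != 0] j.-1.

Definition scaled_gram (n p : nat) (X : 'M[R]_(n, p)) (k : {set 'I_p}) :
    'M[R]_#|k| :=
  n%:R^-1 *: ((model_cols X k)^T *m model_cols X k).

(* For n > 0 and a nonempty k the default value nu _ 1 is one of the values over
   which the minimum or the maximum is taken. *)
Definition lambda_min (n p : nat) (X : 'M[R]_(n, p)) (k : {set 'I_p}) : R :=
  \big[Num.min/nu (scaled_gram X k) 1]_(1 <= j < (minn n #|k|).+1)
    nu (scaled_gram X k) j.

Definition lambda_max (n p : nat) (X : 'M[R]_(n, p)) (k : {set 'I_p}) : R :=
  \big[Num.max/nu (scaled_gram X k) 1]_(1 <= j < (minn n #|k|).+1)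
    nu (scaled_gram X k) j.

End Eigenvalues.

Section HierarchicalModel.
Context {R : realType}.

(* Lebesgue integral over R^k as an iterated integral, one coordinate at a time;
   it is only applied to nonnegative Borel functions, for which the two agree
   by Tonelli's theorem. *)
Fixpoint integral_cV (k : nat) : ('cV[R]_k -> \bar R) -> \bar R :=
  match k with
  | 0 => fun f => f 0
  | k'.+1 => fun f => (\int[lebesgue_measure]_(x in [set: R])
                integral_cV (fun b : 'cV[R]_k' => f (col_mx (x%:M : 'cV_1) b)))%E
  end.

Definition Gamma (a : R) : R :=
  \int[lebesgue_measure]_(x in `]0, +oo[) (x `^ (a - 1) * expR (- x)).

(* density at y of N(m, s2 I_n) *)
Definition gaussian_pdf (n : nat) (m : 'cV[R]_n) (s2 : R) (y : 'cV[R]_n) : R :=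
  (2 * pi * s2) `^ (- (n%:R / 2)) *
  expR (- (\sum_i (y i 0 - m i 0) ^+ 2) / (2 * s2)).

(* the prior of the coefficients without its normalizing constant,
   with s = tau * s2 *)
Definition pmom_shape (r k : nat) (A : 'M[R]_k) (s : R) (b : 'cV[R]_k) : R :=
  (2 * pi) `^ (- (k%:R / 2)) * s `^ (- (r * k)%:R - k%:R / 2) *
  Num.sqrt (\det A) * expR (- (b^T *m A *m b) 0 0 / (2 * s)) *
  \prod_i b i 0 ^+ (2 * r).

(* The substitution b -> sqrt s * b shows that the integral of pmom_shape does
   not depend on s > 0, hence the choice s = 1. *)
Definition pmom_cst (r k : nat) (A : 'M[R]_k) : R :=
  (fine (integral_cV (fun b => (pmom_shape r A 1 b)%:E)))^-1.

Definition pmom_pdf (r k : nat) (A : 'M[R]_k) (tau s2 : R) (b : 'cV[R]_k) : R :=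
  pmom_cst r A * pmom_shape r A (tau * s2) b.

Definition tau_pdf (n : nat) (tau : R) : R :=
  (n%:R / 2) `^ (1 / 2) / Gamma (1 / 2) * tau `^ (- (3 / 2)) *
  expR (- n%:R / (2 * tau)).

Definition invgamma_pdf (alpha1 alpha2 s2 : R) : R :=
  alpha2 `^ alpha1 / Gamma alpha1 * s2 `^ (- (alpha1 + 1)) *
  expR (- alpha2 / s2).

(* Xk and Ak are the matrices of the model *)
Definition marginal (r : nat) (alpha1 alpha2 : R) (n k : nat)
    (Xk : 'M[R]_(n, k)) (Ak : 'M[R]_k) (y : 'cV[R]_n) : \bar R :=
  (\int[lebesgue_measure]_(tau in `]0%R, +oo[)
   \int[lebesgue_measure]_(s2 in `]0%R, +oo[)
     integral_cV (fun b : 'cV[R]_k =>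
       (gaussian_pdf (Xk *m b) s2 y * pmom_pdf r Ak tau s2 b *
        tau_pdf n tau * invgamma_pdf alpha1 alpha2 s2)%:E))%E.

Definition complexity_weight (c1 c2 : R) (q p : nat) (k : {set 'I_p}) : R :=
  if (#|k| <= q)%N then c1 ^- #|k| * p%:R `^ (- (c2 * #|k|%:R)) else 0.

Definition complexity_prior (c1 c2 : R) (q p : nat) (k : {set 'I_p}) : R :=
  complexity_weight c1 c2 q k /
  \sum_(j : {set 'I_p}) complexity_weight c1 c2 q j.

Definition joint_mass (r : nat) (alpha1 alpha2 c1 c2 : R) (q n p : nat)
    (X : 'M[R]_(n, p)) (A : 'M[R]_p) (y : 'cV[R]_n) (k : {set 'I_p}) : R :=
  complexity_prior c1 c2 q k *
  fine (marginal r alpha1 alpha2 (model_cols X k) (model_principal A k) y).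

Definition posterior (r : nat) (alpha1 alpha2 c1 c2 : R) (q n p : nat)
    (X : 'M[R]_(n, p)) (A : 'M[R]_p) (y : 'cV[R]_n) (k : {set 'I_p}) : R :=
  joint_mass r alpha1 alpha2 c1 c2 q X A y k /
  \sum_(j : {set 'I_p}) joint_mass r alpha1 alpha2 c1 c2 q X A y j.

(* the largest ratio of the posterior probability of a model k <> t to that of t;
   the ratios are nonnegative, so the default value 0 is harmless *)
Definition max_posterior_ratio (r : nat) (alpha1 alpha2 c1 c2 : R) (q n p : nat)
    (X : 'M[R]_(n, p)) (A : 'M[R]_p) (t : {set 'I_p}) (y : 'cV[R]_n) : R :=
  \big[Num.max/0]_(k : {set 'I_p} | k != t)
    (posterior r alpha1 alpha2 c1 c2 q X A y k /
     posterior r alpha1 alpha2 c1 c2 q X A y t).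

End HierarchicalModel.

(* the variables e i are mutually independent, each with law N(0, s ^ 2) *)
Definition iid_centered_normal (R : realType) (d : measure_display)
    (T : measurableType d) (P : probability T R) (n : nat)
    (e : 'I_n -> {RV P >-> R}) (s : R) : Prop :=
  (forall (i : 'I_n) (B : set R), measurable B ->
     distribution P (e i) B = normal_prob 0 s B) /\
  (forall (J : {set 'I_n}) (B : 'I_n -> set R),
     (forall i, i \in J -> measurable (B i)) ->
     P (\bigcap_(i in [set` J]) (e i @^-1` B i)) =
     (\prod_(i in J) P (e i @^-1` B i))%E).

(* Only the laws matter, so the probability space may vary with n. *)
Definition cvg_in_probability (R : realType) (d : nat -> measure_display)
    (T : forall n, measurableType (d n)) (P : forall n, probability (T n) R)
    (Z : forall n, T n -> R) (l : R) : Prop :=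
  (forall n, (0 < n)%N -> measurable_fun [set: T n] (Z n)) /\
  (forall delta : R, 0 < delta ->
     P n [set w | delta <= `|Z n w - l|] @[n --> \oo] --> 0%E).

(* Main.v *)
(* With probability tending to one, |e|^2 is comparable with n * sigma0^2 and, for
   all sets S of indices at once, the projection of the noise e on the span of the
   columns in t :|: S has squared norm at most
   2 * sigma0^2 * 17/16 * (|S| + 1/16) * ln p =: Q (chi-square tails and a union bound).
   On that event the eigenvalue assumption gives, for 0 < th < 1,
   |y - X b|^2 >= |e|^2 - Q / (1 - th) + th * n * eps * |b - beta0|^2; dropping the
   exponential factor of the prior, the integral over b becomes a product of
   one-dimensional Gaussian moments, which bounds the marginal of k from above.  The
   marginal of t is bounded from below by restricting b to a box of side n^(-1/2) at
   beta0, in the orthant where the cross term with e has the right sign, and tau to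
   [n, 2n].  In the logarithm of the ratio a superfluous index contributes at most
   -(r + 1/2) * ln n from moments and normalizing constants against 1.31 * ln n from
   the noise, and ln p <= (1 + o(1)) * ln n because comparing traces in the eigenvalue
   assumption for the full model yields p * eps^2 <= n.  A missing index costs a
   multiple of n * eps, which dominates every other term. *)

From mathcomp Require Import all_boot all_order all_algebra.
From mathcomp Require Import all_classical all_reals all_analysis.
From mathcomp Require Import measurable_realfun.
From mathcomp Require polyrcf complex spectral.
Require Import Defs.
From mathcomp Require Import ring lra.
Set Implicit Arguments.
Unset Strict Implicit.
Unset Printing Implicit Defensive.
Import Order.TTheory GRing.Theory Num.Theory.
Import numFieldNormedType.Exports.
Local Open Scope classical_set_scope.
Local Open Scope ring_scope.

(** The constants in front of [ln n] decide the proof. Write [h = r + 1/2]. What remains is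
    [h >= 3/2], because [r >= 1]. Against it stands the noise: choosing one index among p costs
    about [2 sigma0^2 ln p] in the residual sum of squares, which becomes one [ln p] in the log
    ratio. The exact balance is thus 1 against 3/2, and the losses 17/16, 1/16, 32/31 and 65/64 are
    chosen to fit in the gap. The residuals enter through powers of exponent about [n/2], so the
    term [|e|^2], of order n, has to cancel exactly. Both marginals are therefore bounded by
    multiples of the same inverse-gamma integral, and only the quotient of two scales, whose
    difference is free of [|e|^2], is expanded. Gamma values are never estimated: integrals are
    compared with one another. On the good event everything is deterministic, with explicit
    thresholds on n, so that a single event serves all models at once. *)

Definition sqnorm (R : pzRingType) n (v : 'cV[R]_n) : R := \sum_i v i 0 ^+ 2.

Definition dotv (R : pzRingType) n (u v : 'cV[R]_n) : R := \sum_i u i 0 * v i 0.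

(** * Spectral bounds *)

Module RealSpectral.
Import complex spectral.
Local Open Scope complex_scope.
Local Open Scope sesquilinear_scope.

(** Over the complex numbers [G] is Hermitian, hence unitarily diagonalizable with real diagonal.
    Each diagonal entry is an eigenvalue of [G] itself, its eigenvector being a row of [U], and with
    [w = U v] the form is the sum of [a i * |w i|^2], while [|v|^2] is the sum of [|w i|^2]. *)
Lemma sym_qform_bounds (R : rcfType) (k : nat) (G : 'M[R]_k) (lo hi : R) :
  G^T = G -> (forall a, eigenvalue G a -> lo <= a <= hi) ->
  forall v : 'cV[R]_k,
    lo * sqnorm v <= (v^T *m G *m v) 0 0 <= hi * sqnorm v.
Proof.
move=> Gsym Geig v.
pose toC := real_complex R.
pose GC := map_mx toC G.
have toC_real x : toC x \is Num.real by rewrite complex_real.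
have toC_conj x : (toC x)^*%R = toC x by apply/CrealP.
have GCh : GC \is hermsymmx.
  apply: realsym_hermsym; last by apply/mxOverP => i j; rewrite mxE.
  apply/is_hermitianmxP; rewrite expr0 scale1r.
  by rewrite map_mx_id // /GC map_trmx Gsym.
have Dreal := hermitian_spectral_diag_real GCh.
have /orthomx_spectralP GCE := hermitian_normalmx GCh.
set U := spectralmx GC in GCE *; set D := spectral_diag GC in GCE Dreal *.
have Uun : U \is unitarymx by exact: spectral_unitarymx.
have Uunit : U \in unitmx by exact: spectral_unit.
pose a i := Re (D 0 i).
have DE i : D 0 i = toC (a i) by rewrite /toC RRe_real //; apply/mxOverP.
have aeig i : eigenvalue G (a i).
  suff : eigenvalue GC (toC (a i)).
    by rewrite !eigenvalue_root_char -map_char_poly fmorph_root.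
  apply/eigenvalueP; exists (row i U).
    rewrite GCE -row_mul !mulmxA mulmxV // mul1mx.
    by rewrite row_mul row_diag_mx -scalemxAl -rowE DE.
  apply/eqP => U0; have := unitarymxP Uun => /matrixP/(_ i i).
  rewrite !mxE eqxx big1 => [/eqP|j _]; first by rewrite eq_sym oner_eq0.
  by have /rowP/(_ j) := U0; rewrite !mxE => ->; rewrite mul0r.
pose w := U *m map_mx toC v.
have vw : map_mx toC v = U^t* *m w.
  by rewrite /w mulmxA -(invmx_unitary Uun) mulVmx // mul1mx.
have vT : map_mx toC v^T = (map_mx toC v)^t*.
  by apply/matrixP => i j; rewrite !mxE toC_conj.
have wT : (map_mx toC v)^t* = w^t* *m U.
  by rewrite vw trmx_mul map_mxM trmxCK.
have q1 : toC ((v^T *m G *m v) 0 0) = \sum_i toC (a i) * `|w i 0| ^+ 2.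
  transitivity ((map_mx toC (v^T *m G *m v)) 0 0); first by rewrite [RHS]mxE.
  rewrite !map_mxM vT wT -/GC GCE (invmx_unitary Uun) vw.
  rewrite -!mulmxA (mulmxA U) (unitarymxP Uun) mul1mx.
  rewrite (mulmxA U (U^t*)) (unitarymxP Uun) mul1mx.
  rewrite mxE; apply: eq_bigr => i _.
  rewrite mul_diag_mx !mxE DE normCK; ring.
have q2 : toC (sqnorm v) = \sum_i `|w i 0| ^+ 2.
  transitivity ((map_mx toC (v^T *m v)) 0 0).
    rewrite [RHS]mxE; congr toC; rewrite mxE; apply: eq_bigr => i _.
    by rewrite mxE expr2.
  rewrite map_mxM vT wT vw.
  rewrite -!mulmxA (mulmxA U) (unitarymxP Uun) mul1mx.
  rewrite mxE; apply: eq_bigr => i _.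
  rewrite !mxE normCK; ring.
have toCM x y : toC (x * y) = toC x * toC y by exact: (rmorphM (real_complex R)).
apply/andP; split; rewrite -lecR -!/(toC _) toCM q1 q2 mulr_sumr;
  apply: ler_sum => i _; apply: ler_wpM2r; rewrite ?exprn_ge0 //;
  by rewrite lecR; case/andP: (Geig _ (aeig i)).
Qed.

End RealSpectral.

(** * Eigenvalues counted with multiplicity *)

Section Multiplicities.
Context {F : fieldType}.

(** For distinct points the factors are coprime, and each of them divides [q]. Comparing degrees
    then shows that [eigenvalue_seq] is no longer than the dimension. *)
Lemma prod_mup_dvd (s : seq F) (q : {poly F}) : q != 0 -> uniq s ->
  (\prod_(x <- s) ('X - x%:P) ^+ mup x q) %| q.
Proof.
move=> q0; elim: s => [|x s IH]; first by rewrite big_nil dvd1p.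
rewrite cons_uniq => /andP[xs us]; rewrite big_cons Gauss_dvdp; last first.
  apply: coprimep_expl; rewrite coprimep_sym coprimep_XsubC.
  rewrite /root horner_prod prodf_seq_neq0; apply/allP => y ys /=.
  rewrite horner_exp hornerXsubC expf_neq0 // subr_eq0.
  by apply: contraNneq xs => ->.
by rewrite IH // -mup_geq // leqnn.
Qed.

Lemma sum_mup_le (s : seq F) (q : {poly F}) : q != 0 -> uniq s ->
  (\sum_(x <- s) mup x q < size q)%N.
Proof.
move=> q0 us; have /dvdp_leq := prod_mup_dvd q0 us; move=> /(_ q0).
have -> : \prod_(x <- s) ('X - x%:P) ^+ mup x q =
   \prod_(y <- flatten [seq nseq (mup x q) x | x <- s]) ('X - y%:P) :> {poly F}.
  elim: s {us} => [|x s IH] /=; first by rewrite !big_nil.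
  by rewrite big_cons big_cat /= IH big_nseq iter_mulr_1.
rewrite size_prod_XsubC size_flatten /shape -map_comp sumnE big_map.
by under eq_bigr do rewrite /= size_nseq.
Qed.

End Multiplicities.

Section EigenvalueSeq.
Context {R : realType}.
Implicit Types k : nat.

Lemma char_poly_neq0 k (G : 'M[R]_k) : char_poly G != 0.
Proof. exact/monic_neq0/char_poly_monic. Qed.

Lemma eigenvalue_seq_mem k (G : 'M[R]_k) a :
  eigenvalue G a -> a \in eigenvalue_seq G.
Proof.
rewrite eigenvalue_root_char => ra; rewrite mem_sort.
apply/flattenP; exists (nseq (mup a (char_poly G)) a).
  apply/mapP; exists a => //; have := polyrcf.roots_on_rootsR (char_poly_neq0 G) a.
  by rewrite ra in_itv /= => <-.
by rewrite mem_nseq eqxx andbT -XsubC_dvd ?char_poly_neq0 // dvdp_XsubCl.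
Qed.

Lemma size_eigenvalue_seq k (G : 'M[R]_k) : (size (eigenvalue_seq G) <= k)%N.
Proof.
rewrite size_sort size_flatten /shape -map_comp sumnE big_map.
under eq_bigr do rewrite /= size_nseq.
rewrite -ltnS -(size_char_poly G) sum_mup_le ?char_poly_neq0 //.
exact/lt_sorted_uniq/polyrcf.sorted_roots.
Qed.

Lemma nu_mem k (G : 'M[R]_k) a : eigenvalue G a -> a != 0 ->
  exists2 j, (1 <= j <= size [seq x <- eigenvalue_seq G | x != 0%R])%N &
             nu G j = a.
Proof.
move=> /eigenvalue_seq_mem aG a0.
have as_ : a \in [seq x <- eigenvalue_seq G | x != 0] by rewrite mem_filter a0.
exists (index a [seq x <- eigenvalue_seq G | x != 0]).+1.
  by rewrite /= index_mem.
by rewrite /nu nth_index.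
Qed.

Lemma nu_le1 k (G : 'M[R]_k) a : eigenvalue G a -> a != 0 -> a <= nu G 1.
Proof.
move=> aG a0; have [j /andP[j1 js] <-] := nu_mem aG a0.
rewrite /nu /=; apply: (@sorted_leq_nth _ >=%R) => //.
- by move=> x y z xy yz; apply: le_trans yz xy.
- by move=> x /=; apply: lexx.
- apply: (@sorted_filter _ >=%R); first by move=> x y z xy yz; apply: le_trans yz xy.
  by apply: (@sort_sorted _ >=%R) => x y; apply: le_total.
- by rewrite inE (leq_trans _ js).
- by rewrite inE prednK.
Qed.

(** [lambda_max] sees the nonzero eigenvalues only; the eigenvalue 0 is covered by [0 <= hi]. *)
Lemma eigenvalue_le_lambda_max n p (X : 'M[R]_(n, p)) (k : {set 'I_p}) a hi :
  0 <= hi -> lambda_max X k <= hi -> eigenvalue (scaled_gram X k) a -> a <= hi.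
Proof.
move=> hi0 Xhi aG; have [-> //|a0] := eqVneq a 0.
apply: le_trans (nu_le1 aG a0) (le_trans _ Xhi).
by rewrite /lambda_max bigmax_ge_id.
Qed.

(** The minimum runs over [j] up to [#|k|] because [#|k| <= n]. A positive value of [nu G #|k|]
    excludes the default 0, so there are [#|k|] nonzero eigenvalues with multiplicity, which is all
    of them. This turns a bound on the nonzero eigenvalues into positive definiteness. *)
Lemma lambda_min_le_eigenvalue n p (X : 'M[R]_(n, p)) (k : {set 'I_p}) a lo :
  (#|k| <= n)%N -> 0 < lo -> lo <= lambda_min X k ->
  eigenvalue (scaled_gram X k) a -> lo <= a.
Proof.
move=> kn lo0 Xlo aG.
set G := scaled_gram X k in aG *.
set s := [seq x <- eigenvalue_seq G | x != 0].
have nulo j : (1 <= j <= #|k|)%N -> lo <= nu G j.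
  move=> jk; apply: le_trans Xlo _.
  rewrite /lambda_min (minn_idPr kn) -/G.
  by apply: bigmin_inf_seq (lexx _); rewrite // mem_index_iota ltnS.
(* The characteristic polynomial of a 0 x 0 matrix is a nonzero constant, so there is no
   eigenvalue. *)
have k0 : (0 < #|k|)%N.
  case: (posnP #|k|) => // k0; move: aG; rewrite eigenvalue_root_char.
  have /size1_polyC/= -> : (size (char_poly G) <= 1)%N.
    by rewrite size_char_poly k0.
  rewrite rootC => /eqP c0.
  by have := char_poly_neq0 G; rewrite (size1_polyC (p := char_poly G)) ?c0 ?polyC0 ?eqxx // size_char_poly k0.
have ks : (#|k| <= size s)%N.
  rewrite leqNgt; apply/negP => sk.
  have := nulo #|k|; rewrite k0 leqnn => /(_ isT).
  by rewrite /nu nth_default -/s ?leNgt ?lo0 // -ltnS prednK.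
have a0 : a != 0.
  have : all (fun x => x != 0) (eigenvalue_seq G).
    rewrite all_count -size_filter eqn_leq (leq_trans (size_eigenvalue_seq G) ks).
    by rewrite size_filter count_size.
  by move=> /allP; apply; apply: eigenvalue_seq_mem.
have [j /andP[j1 js] <-] := nu_mem aG a0.
apply: nulo; rewrite j1 (leq_trans js) // (leq_trans _ (size_eigenvalue_seq G)) //.
by rewrite size_filter count_size.
Qed.

End EigenvalueSeq.

(** * Submodels and projections *)

Section LinearAlgebra.
Context {R : realType}.

Lemma sqnorm_ge0 n (v : 'cV[R]_n) : 0 <= sqnorm v.
Proof. by apply: sumr_ge0 => i _; apply: sqr_ge0. Qed.

Lemma sqnormE n (v : 'cV[R]_n) : sqnorm v = (v^T *m v) 0 0.
Proof. by rewrite mxE; apply: eq_bigr => i _; rewrite mxE expr2. Qed.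

Lemma dotvC n (u v : 'cV[R]_n) : dotv u v = dotv v u.
Proof. by apply: eq_bigr => i _; rewrite mulrC. Qed.

Lemma dotvDl n (u v w : 'cV[R]_n) : dotv (u + v) w = dotv u w + dotv v w.
Proof. by rewrite -big_split /=; apply: eq_bigr => i _; rewrite mxE mulrDl. Qed.

Lemma dotvZl n a (u v : 'cV[R]_n) : dotv (a *: u) v = a * dotv u v.
Proof. by rewrite mulr_sumr; apply: eq_bigr => i _; rewrite mxE mulrA. Qed.

Lemma dotvDr n (u v w : 'cV[R]_n) : dotv w (u + v) = dotv w u + dotv w v.
Proof. by rewrite !(dotvC w) dotvDl. Qed.

Lemma dotvZr n a (u v : 'cV[R]_n) : dotv v (a *: u) = a * dotv v u.
Proof. by rewrite !(dotvC v) dotvZl. Qed.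

Lemma dotvv n (u : 'cV[R]_n) : dotv u u = sqnorm u.
Proof. by apply: eq_bigr => i _; rewrite expr2. Qed.

Lemma sqnorm_eq0 n (v : 'cV[R]_n) : sqnorm v = 0 -> v = 0.
Proof.
move=> v0; apply/colP => i; rewrite mxE; apply/eqP; rewrite -sqrf_eq0.
have := v0 => /eqP; rewrite /sqnorm psumr_eq0 => [|j _]; last exact: sqr_ge0.
by move=> /allP/(_ i); rewrite mem_index_enum; apply.
Qed.

Lemma sqnormZ n a (v : 'cV[R]_n) : sqnorm (a *: v) = a ^+ 2 * sqnorm v.
Proof. by rewrite -!dotvv dotvZl dotvZr mulrA expr2. Qed.

Lemma sqnormD n (u v : 'cV[R]_n) :
  sqnorm (u + v) = sqnorm u + 2 * dotv u v + sqnorm v.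
Proof. by rewrite -!dotvv dotvDl !dotvDr (dotvC v u); ring. Qed.

Lemma dotv_cauchy n (u v : 'cV[R]_n) : dotv u v ^+ 2 <= sqnorm u * sqnorm v.
Proof.
have [/sqnorm_eq0 ->|v0] := eqVneq (sqnorm v) 0.
  have -> : dotv u 0 = 0 by rewrite /dotv big1 // => i _; rewrite mxE mulr0.
  by rewrite expr0n /= mulr_ge0 ?sqnorm_ge0.
have vp : 0 < sqnorm v by rewrite lt_neqAle eq_sym v0 sqnorm_ge0.
have := sqnorm_ge0 (u + (- (dotv u v / sqnorm v)) *: v).
rewrite sqnormD sqnormZ dotvZr -(pmulr_lge0 _ vp) => h.
suff -> : sqnorm u * sqnorm v = dotv u v ^+ 2 + sqnorm v *
  (sqnorm u + 2 * (- (dotv u v / sqnorm v) * dotv u v) +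
      (- (dotv u v / sqnorm v)) ^+ 2 * sqnorm v) by rewrite lerDl mulrC.
by field.
Qed.

Section Models.
Context {n p : nat}.
Implicit Types (X : 'M[R]_(n, p)) (k s : {set 'I_p}).

Definition restr k (d : 'cV[R]_p) : 'cV[R]_#|k| := \col_j d (enum_val j) 0.

(** The indicator sum avoids inverting [enum_val], which would require a proof of membership in
    [k]. *)
Definition extend k (b : 'cV[R]_#|k|) : 'cV[R]_p :=
  \col_i \sum_(j < #|k|) (enum_val j == i)%:R * b j 0.

Definition supported k (d : 'cV[R]_p) := forall i, i \notin k -> d i 0 = 0.

Lemma extend_in k (b : 'cV[R]_#|k|) (j : 'I_#|k|) :
  extend b (enum_val j) 0 = b j 0.
Proof.
rewrite mxE (bigD1 j) //= eqxx mul1r big1 ?addr0 // => i ij.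
by rewrite (inj_eq enum_val_inj) (negbTE ij) mul0r.
Qed.

Lemma extend_notin k (b : 'cV[R]_#|k|) i : i \notin k -> extend b i 0 = 0.
Proof.
move=> ik; rewrite mxE big1 // => j _; case: eqP => [ji|_]; last by rewrite mul0r.
by move: ik; rewrite -ji enum_valP.
Qed.

Lemma sqnorm_restr k d : supported k d -> sqnorm (restr k d) = sqnorm d.
Proof.
move=> dk; rewrite /sqnorm [RHS](bigID (mem k)) /= [X in _ = _ + X]big1 ?addr0.
  by rewrite [RHS]big_enum_val; apply: eq_bigr => i _; rewrite mxE.
by move=> i /dk ->; rewrite expr0n.
Qed.

Lemma mulmx_restr X k d : supported k d ->
  model_cols X k *m restr k d = X *m d.
Proof.
move=> dk; apply/colP => i; rewrite !mxE.
rewrite [RHS](bigID (mem k)) /= [X in _ = _ + X]big1 ?addr0.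
  by rewrite [RHS]big_enum_val; apply: eq_bigr => j _; rewrite !mxE.
by move=> j /dk ->; rewrite mulr0.
Qed.

Lemma mulmx_extend X k b : model_cols X k *m b = X *m extend b.
Proof.
rewrite -(@mulmx_restr X k); last by move=> i; apply: extend_notin.
by congr (_ *m _); apply/colP => j; rewrite mxE extend_in.
Qed.

Lemma sqnorm_extend k (b : 'cV[R]_#|k|) : sqnorm (extend b) = sqnorm b.
Proof.
rewrite -(@sqnorm_restr k); last by move=> i; apply: extend_notin.
by congr sqnorm; apply/colP => j; rewrite mxE extend_in.
Qed.

Lemma scaled_gram_sym X k : (scaled_gram X k)^T = scaled_gram X k.
Proof. by rewrite /scaled_gram linearZ /= trmx_mul trmxK. Qed.

Lemma qform_scaled_gram X k b :
  (b^T *m scaled_gram X k *m b) 0 0 = n%:R^-1 * sqnorm (model_cols X k *m b).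
Proof.
rewrite sqnormE trmx_mul /scaled_gram -scalemxAr -scalemxAl mxE.
by rewrite -!mulmxA.
Qed.

Lemma gram_lower X k lo d : (0 < n)%N -> (#|k| <= n)%N -> 0 < lo ->
  (k != finset.set0 -> lo <= lambda_min X k) -> supported k d ->
  n%:R * lo * sqnorm d <= sqnorm (X *m d).
Proof.
move=> n0 kn lo0 Xlo dk.
have [k0|k0] := eqVneq k finset.set0.
  have -> : d = 0 by apply/colP => i; rewrite dk ?mxE // k0 inE.
  by rewrite /sqnorm big1 ?mulr0 ?sqnorm_ge0 // => i _; rewrite mxE expr0n.
rewrite -(mulmx_restr X dk) -(sqnorm_restr dk).
set b := restr k d.
have lob : lo * sqnorm b <= (b^T *m scaled_gram X k *m b) 0 0.
  (* [sym_qform_bounds] is two-sided; any upper bound on the eigenvalues serves here. *)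
  have [hi hiG] : exists hi, forall a, eigenvalue (scaled_gram X k) a -> a <= hi.
    exists (Num.max 0 (lambda_max X k)) => a.
    by apply: eigenvalue_le_lambda_max; rewrite le_max lexx ?orbT.
  have Geig a : eigenvalue (scaled_gram X k) a -> lo <= a <= hi.
    move=> aG; rewrite hiG // andbT.
    exact: lambda_min_le_eigenvalue kn lo0 (Xlo k0) aG.
  by case/andP: (RealSpectral.sym_qform_bounds (scaled_gram_sym X k) Geig b).
rewrite qform_scaled_gram ler_pdivlMl ?ltr0n // in lob.
by rewrite -mulrA.
Qed.

Lemma qform_gram_nonneg_eigenvalue X k a :
  eigenvalue (scaled_gram X k) a -> 0 <= a.
Proof.
move=> /eigenvalueP[v vG v0].
have vTG : v *m scaled_gram X k *m v^T = a *: (v *m v^T).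
  by rewrite vG -scalemxAl.
have := qform_scaled_gram X v^T; rewrite trmxK vTG mxE => h.
have vv : 0 < (v *m v^T) 0 0.
  have := sqnormE v^T; rewrite trmxK => <-; rewrite lt_neqAle sqnorm_ge0 andbT.
  by apply: contraNneq v0 => /esym/sqnorm_eq0/(congr1 trmx); rewrite trmxK trmx0 => ->.
by rewrite -(pmulr_lge0 _ vv) h mulr_ge0 ?sqnorm_ge0.
Qed.

Lemma gram_upper X k hi d : (0 < n)%N -> 0 <= hi ->
  (k != finset.set0 -> lambda_max X k <= hi) -> supported k d ->
  sqnorm (X *m d) <= n%:R * hi * sqnorm d.
Proof.
move=> n0 hi0 Xhi dk.
have [k0|k0] := eqVneq k finset.set0.
  have -> : d = 0 by apply/colP => i; rewrite dk ?mxE // k0 inE.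
  rewrite mulmx0; set z := sqnorm _; have -> : z = 0.
    by rewrite /z /sqnorm big1 // => i _; rewrite mxE expr0n.
  by rewrite !mulr_ge0 ?sqnorm_ge0.
rewrite -(mulmx_restr X dk) -(sqnorm_restr dk).
set b := restr k d.
have hib : (b^T *m scaled_gram X k *m b) 0 0 <= hi * sqnorm b.
  have Geig a : eigenvalue (scaled_gram X k) a -> 0 <= a <= hi.
    move=> aG; rewrite (qform_gram_nonneg_eigenvalue aG) /=.
    exact: eigenvalue_le_lambda_max hi0 (Xhi k0) aG.
  by case/andP: (RealSpectral.sym_qform_bounds (scaled_gram_sym X k) Geig b).
rewrite qform_scaled_gram ler_pdivrMl ?ltr0n // in hib.
by rewrite -mulrA.
Qed.

(* The columns have squared norm at least [n * eps] while all the eigenvalues of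
   the n x n matrix X X^T are at most [n / eps]; compare with the trace. *)
Lemma dim_le X eps : (0 < n)%N -> 0 < eps ->
  (forall k, k != finset.set0 -> eps <= lambda_min X k) ->
  (forall k, k != finset.set0 -> lambda_max X k <= eps^-1) ->
  p%:R * eps ^+ 2 <= n%:R.
Proof.
move=> n0 e0 Xlo Xhi.
have col (j : 'I_p) : n%:R * eps <= \sum_i X i j ^+ 2.
  have dk : supported [set j]%SET (delta_mx j 0 : 'cV[R]_p).
    by move=> i; rewrite inE mxE => /negbTE ->.
  have := gram_lower (X := X) n0 _ e0 (Xlo _) dk; rewrite cards1 => /(_ n0).
  suff -> : sqnorm (delta_mx j 0 : 'cV[R]_p) = 1.
    rewrite mulr1 => h; apply: le_trans h _; rewrite /sqnorm -colE.
    by apply: ler_sum => i _; rewrite mxE.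
  rewrite /sqnorm (bigD1 j) //= mxE !eqxx expr1n big1 ?addr0 // => i ij.
  by rewrite mxE (negbTE ij) expr0n.
have row i : \sum_j X i j ^+ 2 <= n%:R * eps^-1.
  set w := (row i X)^T; have wE : \sum_j X i j ^+ 2 = sqnorm w.
    by apply: eq_bigr => j _; rewrite !mxE.
  have wT : supported finset.setT w by move=> j; rewrite inE.
  have h := gram_upper (X := X) n0 (ltW _) (Xhi _) wT.
  rewrite invr_gt0 in h; move: (h e0) => {}h.
  (* For [w] the i-th row, entry i of [X w] is [|w|^2], so [|w|^4 <= |X w|^2 <= (n / eps) |w|^2].
     This bounds the diagonal entry [|w|^2] of [X X^T]. *)
  have h2 : sqnorm w ^+ 2 <= sqnorm (X *m w).
    rewrite {2}/sqnorm (bigD1 i) //= -[leLHS]addr0 lerD //.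
      suff -> : (X *m w) i 0 = sqnorm w by [].
      by rewrite mxE -wE; apply: eq_bigr => j _; rewrite !mxE expr2.
    by apply: sumr_ge0 => j _; apply: sqr_ge0.
  rewrite wE; have [->|w0] := eqVneq (sqnorm w) 0.
    by rewrite mulr_ge0 // invr_ge0 ltW.
  have wp : 0 < sqnorm w by rewrite lt_neqAle eq_sym w0 sqnorm_ge0.
  by rewrite -(ler_pM2r wp) -expr2; apply: le_trans h2 h.
have : p%:R * (n%:R * eps) <= n%:R * (n%:R * eps^-1).
  have -> : p%:R * (n%:R * eps) = \sum_(j < p) n%:R * eps.
    by rewrite sumr_const card_ord mulr_natl.
  have -> : n%:R * (n%:R * eps^-1) = \sum_(j < n) n%:R * eps^-1.
    by rewrite sumr_const card_ord mulr_natl.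
  apply: (@le_trans _ _ (\sum_(j < p) \sum_i X i j ^+ 2)).
    by apply: ler_sum => j _.
  by rewrite exchange_big; apply: ler_sum => i _.
rewrite -[X in _ <= X](_ : (n%:R / eps) * n%:R = _); last by ring.
rewrite (_ : p%:R * (n%:R * eps) = (n%:R / eps) * (p%:R * eps ^+ 2)); last first.
  by field; rewrite gt_eqF.
by rewrite ler_pM2l // divr_gt0 ?ltr0n.
Qed.

End Models.

Lemma qform_principal p (A : 'M[R]_p) (k : {set 'I_p}) (b : 'cV[R]_#|k|) :
  (b^T *m model_principal A k *m b) 0 0 =
  ((extend b)^T *m A *m extend b) 0 0.
Proof.
have bE : b = restr k (extend b).
  by apply/colP => j; rewrite mxE extend_in.
rewrite {1 2}bE -!mulmxA !mxE.
rewrite [RHS](bigID (mem k)) /= [X in _ = _ + X]big1 ?addr0; last first.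
  by move=> i ik; rewrite mxE extend_notin // mul0r.
rewrite [RHS]big_enum_val; apply: eq_bigr => i _; rewrite !mxE; congr (_ * _).
rewrite [RHS](bigID (mem k)) /= [X in _ = _ + X]big1 ?addr0; last first.
  by move=> j jk; rewrite extend_notin // mulr0.
by rewrite [RHS]big_enum_val; apply: eq_bigr => j _; rewrite !mxE.
Qed.

(** Padding [b] with zeros turns the form of the principal submatrix into the form of [A], so the
    bounds are inherited. *)
Lemma principal_bounds p (A : 'M[R]_p) lo hi (k : {set 'I_p}) (b : 'cV[R]_#|k|) :
  A^T = A -> (forall a, eigenvalue A a -> lo <= a <= hi) ->
  lo * sqnorm b <= (b^T *m model_principal A k *m b) 0 0 <= hi * sqnorm b.
Proof.
move=> As Ae; rewrite qform_principal -sqnorm_extend.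
exact: RealSpectral.sym_qform_bounds.
Qed.

End LinearAlgebra.

(** * Determinants, Gram-Schmidt and projections *)

Section Orthonormal.
Context {R : realType}.

(** The characteristic polynomial of [- G] takes the value [det G] at 0 and tends to +oo. If
    [det G <= 0], it has a root [z >= 0], and an eigenvector for it makes the form of [G]
    nonpositive. *)
Lemma det_gt0 k (G : 'M[R]_k) :
  (forall b : 'cV[R]_k, b != 0 -> 0 < (b^T *m G *m b) 0 0) -> 0 < \det G.
Proof.
move=> Gpos; pose q := char_poly (- G).
have q0 : q.[0] = \det G.
  by rewrite horner_coef0 char_poly_det -(scaleN1r G) detZ mulrA -expr2 sqrr_sign mul1r.
rewrite ltNge; apply/negP => detG.
have lq : lead_coef q = 1 by apply/monicP/char_poly_monic.
have [|M HM] := @polyrcf.poly_pinfty_gt_lc _ q; first by rewrite lq.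
pose x := Num.max 0 M.
have qx : 1 <= q.[x] by rewrite -lq; apply: HM; rewrite le_max lexx orbT.
have [||z] := @polyrcf.poly_ivt _ q 0 x; first by rewrite le_max lexx.
  by rewrite mulr_le0_ge0 ?q0 // (le_trans _ qx).
rewrite in_itv /= => /andP[z0 _]; rewrite -eigenvalue_root_char.
move=> /eigenvalueP[v vG v0].
have vN : v^T != 0 by apply: contraNneq v0 => /(congr1 trmx); rewrite trmxK trmx0 => ->.
have := Gpos _ vN; rewrite trmxK.
have -> : v *m G = - z *: v by rewrite scaleNr -vG mulmxN opprK.
rewrite -scalemxAl mxE pmulr_lgt0 => [|].
  by rewrite oppr_gt0 ltNge z0.
have := sqnormE v^T; rewrite trmxK => <-; rewrite lt_neqAle sqnorm_ge0 andbT.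
by apply: contraNneq vN => /esym/sqnorm_eq0 ->.
Qed.

Section Basis.
Context {n : nat}.
Implicit Types (u v w b : 'cV[R]_n) (bs us : seq 'cV[R]_n).

(** Recursive, so that Gram-Schmidt and the chi-square computation can peel off one vector at a
    time. *)
Fixpoint orthonormal bs : Prop :=
  if bs is b :: bs' then
    [/\ sqnorm b = 1, forall c, c \in bs' -> dotv b c = 0 & orthonormal bs']
  else True.

Definition proj bs w : 'cV[R]_n := \sum_(b <- bs) dotv w b *: b.

Lemma dotv_suml (I : Type) (s : seq I) (F : I -> 'cV[R]_n) w :
  dotv (\sum_(i <- s) F i) w = \sum_(i <- s) dotv (F i) w.
Proof.
elim: s => [|x s IH]; last by rewrite !big_cons dotvDl IH.
by rewrite !big_nil /dotv big1 // => i _; rewrite mxE mul0r.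
Qed.

Lemma dotv_proj bs u w : dotv (proj bs u) w = \sum_(b <- bs) dotv u b * dotv w b.
Proof.
by rewrite dotv_suml; apply: eq_bigr => b _; rewrite dotvZl (dotvC w).
Qed.

Lemma dotv_proj_orth bs u w : (forall b, b \in bs -> dotv w b = 0) ->
  dotv (proj bs u) w = 0.
Proof.
by move=> H; rewrite dotv_proj big_seq big1 // => b /H ->; rewrite mulr0.
Qed.

Lemma dotv_proj_in bs u b : orthonormal bs -> b \in bs ->
  dotv (proj bs u) b = dotv u b.
Proof.
elim: bs => [//|c bs IH] /= [c1 cbs bso]; rewrite inE /proj big_cons dotvDl dotvZl.
rewrite -/(proj bs u) => /predU1P[->|bbs].
  by rewrite dotvv c1 mulr1 dotv_proj_orth ?addr0.
by rewrite IH // cbs // mulr0 add0r.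
Qed.

(** The vectors may be dependent: when the residual of a new vector vanishes, the family is kept as
    it is, whence only an inequality between the sizes. *)
Lemma gram_schmidt us : exists bs, [/\ (size bs <= size us)%N, orthonormal bs &
  forall u, u \in us -> proj bs u = u].
Proof.
elim: us => [|x us [bs [sz bso bsP]]]; first by exists [::].
pose r := x - proj bs x.
have rx : x = r + proj bs x by rewrite subrK.
have rb b : b \in bs -> dotv r b = 0.
  move=> bbs; rewrite /r -scaleN1r dotvDl dotvZl dotv_proj_in //; ring.
have [r0|r0] := eqVneq (sqnorm r) 0.
  exists bs; split=> //=; first exact: leqW.
  move=> u; rewrite inE => /predU1P[->|/bsP //].
  by rewrite [RHS]rx (sqnorm_eq0 r0) add0r.
have rp : 0 < sqnorm r by rewrite lt_neqAle eq_sym r0 sqnorm_ge0.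
pose c := (Num.sqrt (sqnorm r))^-1.
have c2 : c ^+ 2 * sqnorm r = 1.
  by rewrite exprVn sqr_sqrtr ?ltW // mulVf.
exists (c *: r :: bs); split => //=.
- split=> //; first by rewrite sqnormZ.
  by move=> b bbs; rewrite dotvZl rb ?mulr0.
- move=> u; rewrite /proj big_cons -/(proj bs u) inE dotvZr scalerA.
  move=> /predU1P[->|uus].
    rewrite [in X in dotv X]rx dotvDl dotvv dotv_proj_orth // addr0.
    rewrite mulrAC -expr2 c2 scale1r.
    by rewrite -rx.
  rewrite -{1}(bsP _ uus) dotv_proj_orth // mulr0 mul0r scale0r add0r.
  exact: bsP.
Qed.

Lemma proj_lin bs (I : finType) (F : I -> 'cV[R]_n) :
  (forall i, proj bs (F i) = F i) -> proj bs (\sum_i F i) = \sum_i F i.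
Proof.
move=> HF; rewrite /proj; under eq_bigr do rewrite dotv_suml scaler_suml.
by rewrite exchange_big; apply: eq_bigr => i _; apply: HF.
Qed.

Lemma projZ bs a u : proj bs (a *: u) = a *: proj bs u.
Proof.
by rewrite /proj scaler_sumr; apply: eq_bigr => b _; rewrite dotvZl scalerA.
Qed.

(** Since [w] is its own projection, [u] may be replaced by its projection; then Cauchy-Schwarz
    applies. *)
Lemma dotv_sqr_le_proj bs u w : orthonormal bs -> proj bs w = w ->
  dotv u w ^+ 2 <= (\sum_(b <- bs) dotv u b ^+ 2) * sqnorm w.
Proof.
move=> bso wE.
have -> : dotv u w = dotv (proj bs u) w.
  by rewrite -{1}wE dotvC !dotv_proj; apply: eq_bigr => b _; rewrite mulrC.
have -> : \sum_(b <- bs) dotv u b ^+ 2 = sqnorm (proj bs u).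
  rewrite -dotvv dotv_proj !big_seq; apply: eq_bigr => b bbs.
  by rewrite dotv_proj_in // expr2.
exact: dotv_cauchy.
Qed.

End Basis.

(** One sum of at most [#|s|] squares controls the noise against all coefficient vectors supported
    in [s]. For Gaussian noise its tail is a chi-square tail. *)
Lemma model_basis n p (X : 'M[R]_(n, p)) (s : {set 'I_p}) :
  exists bs : seq 'cV[R]_n, [/\ (size bs <= #|s|)%N, orthonormal bs &
    forall u d, supported s d ->
      dotv u (X *m d) ^+ 2 <= (\sum_(b <- bs) dotv u b ^+ 2) * sqnorm (X *m d)].
Proof.
have [bs [sz bso bsP]] := gram_schmidt [seq col i X | i <- enum s].
exists bs; split => //; first by rewrite cardE -(size_map (fun i => col i X)).
move=> u d ds; apply: dotv_sqr_le_proj => //.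
have -> : X *m d = \sum_i d i 0 *: col i X.
  by apply/colP => i; rewrite mxE summxE; apply: eq_bigr => j _; rewrite !mxE mulrC.
apply: proj_lin => i; rewrite projZ.
have [is_|/ds ->] := boolP (i \in s); last by rewrite !scale0r.
by rewrite bsP //; apply/mapP; exists i; rewrite ?mem_enum.
Qed.

End Orthonormal.

(** * Integrals *)

Section MonotoneIntegral.
Local Open Scope ereal_scope.
Context d (T : measurableType d) (R : realType).
Variable mu : {measure set T -> \bar R}.

(* The integral of a nonnegative function is a supremum over the simple functions
   below it. *)
Lemma le_integral_nonneg (D D' : set T) (f g : T -> \bar R) : D `<=` D' ->
  (forall x, D x -> 0 <= f x) -> (forall x, D' x -> 0 <= g x) ->
  (forall x, D x -> f x <= g x) ->
  \int[mu]_(x in D) f x <= \int[mu]_(x in D') g x.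
Proof.
move=> DD' f0 g0 fg; rewrite !ge0_integralE //.
apply: ge_ereal_sup => _ [h hf <-]; apply: ereal_sup_ubound; exists h => // x.
apply: le_trans (hf x) _; rewrite /patch.
case: ifPn => [xD|_]; case: ifPn => // xD'.
- by apply: fg; rewrite inE in xD.
- by move: xD'; rewrite notin_setE; case; apply: DD'; rewrite inE in xD.
- by apply: g0; rewrite inE in xD'.
Qed.

Lemma integralZl_EFin_nonneg (D : set T) (f : T -> R) (c : R) : (0 <= c)%R ->
  measurable D -> measurable_fun D f -> (forall x, D x -> (0 <= f x)%R) ->
  \int[mu]_(x in D) (c * f x)%:E = c%:E * \int[mu]_(x in D) (f x)%:E.
Proof.
move=> c0 mD mf f0; under eq_integral do rewrite EFinM.
apply: ge0_integralZl_EFin; [exact: mD| |exact/measurable_EFinP|exact: c0].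
by move=> x Dx; rewrite lee_fin f0.
Qed.

End MonotoneIntegral.

Section Affine.
Context {R : realType}.
Notation mu := (@lebesgue_measure R).

(** The image of Lebesgue measure under the affine map, multiplied by [c], agrees with Lebesgue
    measure on half-open intervals, hence everywhere. *)
Lemma integral_affine (c d : R) (D : set R) (f : R -> \bar R) : 0 < c ->
  measurable D -> measurable_fun D f -> (forall x, 0 <= f x)%E ->
  (\int[mu]_(x in D) f x =
   c%:E * \int[mu]_(x in (fun x => (c * x + d)%R) @^-1` D)
             f (c * x + d)%R)%E.
Proof.
move=> c0 mD mf f0.
pose phi : measurableTypeR R -> measurableTypeR R := fun x => c * x + d.
have mphi : measurable_fun setT phi.
  by apply: measurable_funD => //; apply: measurable_funM.
have c0' : 0 <= c by exact: ltW.
pose nu0 : {measure set (measurableTypeR R) -> \bar R} :=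
  mscale (NngNum c0') (pushforward mu phi).
pose nu := nu0 mphi.
have muE A : measurable A -> mu A = nu A.
  apply: lebesgue_measure_unique => _ [[a b]] _ <-.
  rewrite /nu /nu0 /= /mscale /= /pushforward.
  have -> : phi @^-1` `]a, b] = `](a - d) / c, (b - d) / c]%classic.
    apply/seteqP; split => x; rewrite /= !in_itv /= /phi.
      by rewrite ltr_pdivrMr // ler_pdivlMr // ltrBlDr lerBrDr mulrC.
    by rewrite ltr_pdivrMr // ler_pdivlMr // ltrBlDr lerBrDr mulrC.
  rewrite !lebesgue_measure_itv /= !lte_fin ltr_pM2r ?invr_gt0 // ltrD2r.
  case: ifP => _; last by rewrite mule0.
  rewrite -EFinM; congr EFin; field; by rewrite gt_eqF.
rewrite (eq_measure_integral nu); last by move=> A mA _; apply: muE.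
rewrite ge0_integral_mscale //; congr (_ * _)%E.
rewrite ge0_integral_pushforward //.
Qed.

End Affine.

Section PowExp.
Context {R : realType}.
Implicit Types a c x : R.

(** Rewriting as [x * (x^2)^(-1)] reduces the claim to [powR]; at 0 both sides vanish by
    convention. *)
Lemma measurable_invr : measurable_fun [set: R] (fun x : R => x^-1).
Proof.
rewrite (_ : (fun x : R => x^-1) = (fun x => x * (x ^+ 2) `^ (-1))).
  apply: measurable_funM => //.
  by apply: (@measurableT_comp _ _ _ _ _ _ (@powR R ^~ (-1))) => //;
    apply: measurable_funX.
apply/funext => x; rewrite powR_inv1 ?sqr_ge0 //.
have [->|x0] := eqVneq x 0; first by rewrite invr0 mul0r.
by field.
Qed.

Lemma measurable_funV d (T : measurableType d) (D : set T) (f : T -> R) :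
  measurable_fun D f -> measurable_fun D (fun t => (f t)^-1).
Proof. by move=> mf; apply: measurableT_comp measurable_invr mf. Qed.

Lemma powR_inv a x : 0 <= x -> x^-1 `^ a = x `^ (- a).
Proof. by move=> x0; rewrite -powR_inv1 // -powRrM mulN1r. Qed.

(* The function [x ^ a exp (- c x)] is maximal at [a / c]. *)
Lemma powR_expR_le a c x : 0 <= a -> 0 < c -> 0 < x ->
  x `^ a * expR (- (c * x)) <= (a / c) `^ a.
Proof.
move=> a0 c0 x0; have [->|aN0] := eqVneq a 0.
  by rewrite !powRr0 mul1r -expR0 ler_expR oppr_le0 mulr_ge0 // ltW.
have {aN0}a0 : 0 < a by rewrite lt_neqAle eq_sym aN0.
(* [u <= exp u] at [u = c x / a], to be raised to the power [a]. The true maximum carries a further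
   factor [exp (- a)], which is given away. *)
have h : x * (c / a) <= expR (x * (c / a)).
  by apply: le_trans (expR_ge1Dx _); rewrite lerDr.
have h2 : (x * (c / a)) `^ a <= expR (c * x).
  apply: (le_trans (ge0_ler_powR (ltW a0) _ _ h)).
  - by rewrite nnegrE mulr_ge0 ?divr_ge0 ?ltW.
  - by rewrite nnegrE expR_ge0.
  rewrite -expRM (_ : x * (c / a) * a = c * x) //.
  by field; rewrite gt_eqF.
rewrite expRN ler_pdivrMr ?expR_gt0 //.
have xE : x * (c / a) * (a / c) = x by field; rewrite !gt_eqF.
have -> : x `^ a = (x * (c / a)) `^ a * (a / c) `^ a.
  rewrite -powRM ?xE //; first by rewrite mulr_ge0 ?divr_ge0 ?ltW.
  by rewrite divr_ge0 ?ltW.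
by rewrite mulrC; apply: ler_wpM2l => //; exact: powR_ge0.
Qed.

End PowExp.

(** * Inverse-gamma integrals *)

Section InverseGammaIntegral.
Context {R : realType}.
Notation mu := (@lebesgue_measure R).
Implicit Types N S a s : R.

(** For positive arguments this is [Gamma(N) / S^N]. It stays an integral: only scaling, finiteness
    and comparisons between different [N] are used. *)
Definition invgamma_int N S : \bar R :=
  (\int[mu]_(s in `]0%R, +oo[) (s `^ (- (N + 1)) * expR (- S / s))%:E)%E.

Lemma measurable_invgamma N S (D : set R) :
  measurable_fun D (fun s : R => s `^ (- (N + 1)) * expR (- S / s)).
Proof.
apply: measurable_funTS; apply: measurable_funM => //.
apply: measurableT_comp => //; apply: measurable_funM => //.
exact: measurable_invr.
Qed.

Lemma invgamma_int_ge0 N S : (0 <= invgamma_int N S)%E.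
Proof.
by apply: integral_ge0 => s _; rewrite lee_fin mulr_ge0 ?powR_ge0 ?expR_ge0.
Qed.

Lemma integral_powR_1y N : 0 < N ->
  (\int[mu]_(s in `[1%R, +oo[) (s `^ (- (N + 1)))%:E = (N^-1)%:E)%E.
Proof.
move=> N0.
have dF (x : R) : 0 < x ->
    is_derive x (1 : R) (fun s : R => - N^-1 * s `^ (- N)) (x `^ (- (N + 1))).
  move=> x0.
  have dp : is_derive x (1 : R) (@powR R ^~ (- N) : R -> R) (- N * x `^ (- N - 1)).
    apply: DeriveDef; first by apply: derivable_powR; rewrite in_itv /= x0.
    by rewrite -derive1E powR_derive1 ?in_itv /= ?x0.
  have := is_deriveZ (- N^-1) dp.
  rewrite /GRing.scale /= mulrA mulNr mulrN opprK mulVf ?gt_eqF // mul1r.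
  by rewrite opprD.
rewrite (@ge0_continuous_FTC2y _ _ (fun s : R => - N^-1 * s `^ (- N)) 1 0).
- by rewrite powR1 mulr1 -EFinB sub0r opprK.
- by move=> x _; apply: powR_ge0.
- apply: continuous_in_subspaceT => x; rewrite inE /= in_itv /= andbT => x1.
  apply/differentiable_continuous/derivable1_diffP.
  by apply: derivable_powR; rewrite in_itv /= (lt_le_trans ltr01).
- rewrite -[X in _ --> X](mulr0 (- N^-1)); apply: cvgM; first exact: cvg_cst.
  apply/cvgr0Pnorm_lt => e e0; near=> x.
  have x0 : 0 < x by near: x; apply: nbhs_pinfty_gt.
  have xe : (e^-1) `^ N^-1 < x by near: x; apply: nbhs_pinfty_gt.
  rewrite ger0_norm ?powR_ge0 // powRN invf_plt ?posrE ?powR_gt0 //.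
  have := gt0_ltr_powR N0 _ _ xe; rewrite !nnegrE powR_ge0 ltW // => /(_ isT isT).
  by rewrite -powRrM mulVf ?gt_eqF // powRr1 // invr_ge0 ltW.
- by move=> x x1; have [] := dF x (lt_trans ltr01 x1).
- apply: cvg_at_right_filter.
  by have [/derivable1_diffP/differentiable_continuous h _] := dF 1 ltr01.
- move=> x; rewrite in_itv /= andbT => x1.
  by rewrite derive1E; have [_ ->] := dF x (lt_trans ltr01 x1).
Unshelve. all: by end_near.
Qed.

Lemma invgamma_int_scale N S c : 0 < c ->
  invgamma_int N (c * S) = ((c `^ (- N))%:E * invgamma_int N S)%E.
Proof.
move=> c0; rewrite /invgamma_int (@integral_affine _ c 0); last 4 first.
- exact: c0.
- exact: measurable_itv.
- by apply/measurable_EFinP; exact: measurable_invgamma.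
- by move=> x; rewrite lee_fin mulr_ge0 ?powR_ge0 ?expR_ge0.
rewrite (_ : (fun x => c * x + 0) @^-1` `]0, +oo[ = `]0, +oo[%classic); last first.
  by apply/seteqP; split => x; rewrite /= !in_itv /= !andbT addr0 pmulr_rgt0.
have mf : measurable_fun [set: R] (fun s : R =>
    (c * s + 0) `^ (- (N + 1)) * expR (- (c * S) / (c * s + 0))).
  apply: measurable_funM => //.
    apply: (@measurableT_comp _ _ _ _ _ _ (@powR R ^~ (- (N + 1)))) => //.
    by apply: measurable_funD => //; apply: measurable_funM.
  apply: measurableT_comp => //; apply: measurable_funM => //.
  by apply: measurable_funV; apply: measurable_funD => //; apply: measurable_funM.
rewrite -(integralZl_EFin_nonneg mu (powR_ge0 c (- N))); last 3 first.
- exact: measurable_itv.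
- exact: measurable_invgamma.
- by move=> s _; rewrite mulr_ge0 ?powR_ge0 ?expR_ge0.
rewrite -(integralZl_EFin_nonneg mu (ltW c0)); last 3 first.
- exact: measurable_itv.
- exact: measurable_funTS.
- by move=> s _; rewrite mulr_ge0 ?powR_ge0 ?expR_ge0.
apply: eq_integral => s; rewrite inE /= in_itv /= andbT => s0.
congr EFin; rewrite addr0 powRM ?ltW //.
rewrite (_ : - (c * S) / (c * s) = - S / s); last by field; rewrite !gt_eqF.
rewrite !mulrA; congr (_ * _ * _).
rewrite -[X in X * _](powRr1 (ltW c0)) -powRD ?(gt_eqF c0) ?implybT //.
by congr powR; ring.
Qed.

(** Below 1 the integrand is bounded, by [powR_expR_le] in the variable [1 / s]; above 1 the
    exponential is at most 1 and the power is integrable. *)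
Lemma invgamma_int_lty N S : 0 < N -> 0 < S -> (invgamma_int N S < +oo)%E.
Proof.
move=> N0 S0; rewrite /invgamma_int.
have N10 : 0 < N + 1 by rewrite addr_gt0.
rewrite (@itv_bndbnd_setU _ _ _ (BLeft 1)) ?bnd_simp //.
set f := fun s : R => (s `^ (- (N + 1)) * expR (- S / s))%:E.
have f0 s : (0 <= f s)%E by rewrite lee_fin mulr_ge0 ?powR_ge0 ?expR_ge0.
rewrite ge0_integral_setU; [|exact: measurable_itv|exact: measurable_itv| | |].
- apply: lte_add_pinfty.
    apply: (@le_lt_trans _ _
        (\int[mu]_(s in `]0%R, 1%R[) (((N + 1) / S) `^ (N + 1))%:E)%E).
      apply: le_integral_nonneg; [by []|by move=> s _; exact: f0| |move=> s].
        by move=> s _; rewrite lee_fin powR_ge0.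
      rewrite /= in_itv /= => /andP[s0 _]; rewrite /f lee_fin.
      have := powR_expR_le (ltW N10) S0 (_ : 0 < s^-1); rewrite invr_gt0 => /(_ s0).
      by rewrite /f (powR_inv _ (ltW s0)) mulNr.
    rewrite integral_cst /=; last exact: measurable_itv.
    by rewrite lebesgue_measure_itv /= lte_fin ltr01 -EFinB -EFinM ltry.
  apply: (@le_lt_trans _ _ (\int[mu]_(s in `[1%R, +oo[) (s `^ (- (N + 1)))%:E)%E).
    apply: le_integral_nonneg; [by []|by move=> s _; exact: f0| |move=> s].
      by move=> s _; rewrite lee_fin powR_ge0.
    rewrite /= in_itv /= andbT => s1; rewrite /f lee_fin.
    rewrite -[leRHS]mulr1; apply: ler_wpM2l; first exact: powR_ge0.
    rewrite -expR0 ler_expR mulNr oppr_le0 divr_ge0 ?ltW //.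
    exact: lt_le_trans s1.
  by rewrite integral_powR_1y // ltry.
- by apply/measurable_EFinP; exact: measurable_invgamma.
- by move=> s _; exact: f0.
- apply/disj_setPS => s; rewrite /= !in_itv /= andbT => -[/andP[_ s1]].
  by rewrite leNgt s1.
Qed.

(** Half of the exponential pays for [s^(-a)] through [powR_expR_le]. The outcome [(2 a / S)^a]
    plays the role of a Stirling bound for [Gamma(a + 1/2)]. *)
Lemma invgamma_int_bound a S : 0 <= a -> 0 < S ->
  (invgamma_int (a + 2^-1) S <=
   ((2 * a / S) `^ a)%:E * invgamma_int 2^-1 (S / 2))%E.
Proof.
move=> a0 S0; rewrite /invgamma_int -integralZl_EFin_nonneg; last 4 first.
- exact: powR_ge0.
- exact: measurable_itv.
- exact: measurable_invgamma.
- by move=> s _; rewrite mulr_ge0 ?powR_ge0 ?expR_ge0.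
apply: le_integral_nonneg; [by []|move=> s _|move=> s _|move=> s].
- by rewrite lee_fin mulr_ge0 ?powR_ge0 ?expR_ge0.
- by rewrite lee_fin !mulr_ge0 ?powR_ge0 ?expR_ge0.
rewrite /= in_itv /= andbT => s0; rewrite lee_fin.
have S20 : 0 < S / 2 by rewrite divr_gt0.
have := powR_expR_le a0 S20 (_ : 0 < s^-1); rewrite invr_gt0 => /(_ s0).
have -> : a / (S / 2) = 2 * a / S by field; rewrite gt_eqF.
move=> /(ler_wpM2r (_ : 0 <= s `^ (- (2^-1 + 1)) * expR (- (S / 2) / s))).
rewrite mulr_ge0 ?powR_ge0 ?expR_ge0 // => /(_ isT).
congr (_ <= _); rewrite mulrACA -expRD (powR_inv _ (ltW s0)) -powRD ?(gt_eqF s0) ?implybT //.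
by congr (_ `^ _ * expR _); [ring|field; rewrite gt_eqF].
Qed.

(* Beyond [2 S / N] the integrand is negligible (compare [s] with [2 s]), and on
   the rest [s ^ a] is at most [(2 S / N) ^ a]. *)
Lemma invgamma_int_shift N S a : 6 <= N -> 0 < S -> 0 <= a ->
  (invgamma_int N S <= (2 * (2 * S / N) `^ a)%:E * invgamma_int (N + a) S)%E.
Proof.
move=> N6 S0 a0; have N0 : 0 < N by apply: lt_le_trans N6.
pose f := fun s : R => s `^ (- (N + 1)) * expR (- S / s).
have f0 s : 0 <= f s by rewrite mulr_ge0 ?powR_ge0 ?expR_ge0.
have mf D : measurable_fun D f by exact: measurable_invgamma.
pose s1 := 2 * S / N.
have s10 : 0 < s1 by rewrite divr_gt0 ?mulr_gt0.
pose J : \bar R := invgamma_int N S.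
pose A := (\int[mu]_(s in `]0%R, s1]) (f s)%:E)%E.
pose B := (\int[mu]_(s in `]s1, +oo[) (f s)%:E)%E.
have JE : (J = A + B)%E.
  rewrite /A /B /J /invgamma_int (@itv_bndbnd_setU _ _ _ (BRight s1)) ?bnd_simp ?ltW //.
  rewrite ge0_integral_setU //.
  - by apply/measurable_EFinP; exact: mf.
  - by move=> s _; rewrite lee_fin f0.
  - apply/disj_setPS => s; rewrite /= !in_itv /= andbT => -[/andP[_ h]].
    by rewrite ltNge h.
(* After the substitution the integrand is [2^(-N) exp(S / (2 s))] times the old one, and
   [s > S / N] makes the factor at most [(exp(1/2) / 2)^N <= (8/9)^6 < 1/2]. This is the origin of
   [6 <= N]. *)
have tail : (B <= (2^-1)%:E * J)%E.
  rewrite /B (@integral_affine _ 2 0); last 4 first.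
  - by [].
  - exact: measurable_itv.
  - by apply/measurable_EFinP; exact: mf.
  - by move=> s; rewrite lee_fin f0.
  rewrite -integralZl_EFin_nonneg; last 4 first.
  - by [].
  - rewrite (_ : _ @^-1` _ = `](s1 / 2), +oo[%classic); first exact: measurable_itv.
    by apply/seteqP; split=> s; rewrite /= !in_itv /= !andbT addr0 => h; lra.
  - apply: measurable_funTS; apply: measurableT_comp; first exact: mf.
    by apply: measurable_funD => //; apply: measurable_funM.
  - by move=> s _; exact: f0.
  rewrite /J /invgamma_int -integralZl_EFin_nonneg; last 4 first.
  - by rewrite invr_ge0.
  - exact: measurable_itv.
  - exact: mf.
  - by move=> s _; exact: f0.
  apply: le_integral_nonneg.
  - move=> s; rewrite /= !in_itv /= !andbT addr0 => h.
    by have := lt_trans s10 h; rewrite pmulr_rgt0.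
  - by move=> s _; rewrite lee_fin mulr_ge0 ?f0.
  - by move=> s _; rewrite lee_fin mulr_ge0 ?f0 // invr_ge0.
  move=> s; rewrite /= in_itv /= andbT addr0 => h.
  have s0 : 0 < s by have := lt_trans s10 h; rewrite pmulr_rgt0.
  rewrite lee_fin /f powRM // ?(ltW s0) //.
  have -> : expR (- S / (2 * s)) = expR (S / (2 * s)) * expR (- S / s).
    by rewrite -expRD; congr expR; field; rewrite gt_eqF.
  rewrite (_ : 2 * _ = (2 * 2 `^ (- (N + 1)) * expR (S / (2 * s))) * f s); last first.
    by rewrite /f; ring.
  rewrite -/(f s); apply: ler_wpM2r; first exact: f0.
  have -> : 2 * 2 `^ (- (N + 1)) = (2^-1) `^ N :> R.
    rewrite powR_inv // -[X in X * _](powRr1 (ler0n R 2)) -powRD; last first.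
      by rewrite pnatr_eq0 implybT.
    by congr (_ `^ _); ring.
  have sN : S / (2 * s) <= 2^-1 * N.
    rewrite ler_pdivrMr ?mulr_gt0 // (_ : 2^-1 * N * (2 * s) = N * s); last by field.
    by move: h; rewrite /s1 ltr_pdivrMr // => h; lra.
  apply: (@le_trans _ _ ((2^-1) `^ N * (expR 2^-1) `^ N)).
    apply: ler_wpM2l; first exact: powR_ge0.
    by rewrite -expRM ler_expR.
  rewrite -powRM ?expR_ge0 ?invr_ge0 //.
  (* From [exp(-1/4) >= 1 - 1/4]; squaring gives [exp(1/2) <= 16/9]. *)
  have e4 : expR (4^-1) <= 4 / 3 :> R.
    have := expR_ge1Dx (- (4^-1) : R); rewrite expRN => h4.
    have e0 := expR_gt0 (4^-1 : R).
    have : 3 / 4 * expR (4^-1) <= 1 :> R.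
      rewrite -ler_pdivlMr // div1r; apply: le_trans h4; lra.
    by lra.
  have e2 : 2^-1 * expR (2^-1) <= 8 / 9 :> R.
    have -> : expR 2^-1 = expR (4^-1) * expR (4^-1) :> R by rewrite -expRD; congr expR; lra.
    by have e0 := expR_gt0 (4^-1 : R); nra.
  apply: (@le_trans _ _ ((8 / 9) `^ N)).
    by apply: ge0_ler_powR => //; rewrite ?nnegrE ?mulr_ge0 ?expR_ge0 ?invr_ge0 ?ltW.
  apply: (@le_trans _ _ ((8 / 9) `^ 6)).
    by apply: ger_powR => //; apply/andP; split; lra.
  by rewrite powR_mulrn; lra.
have A_le : (A <= (s1 `^ a)%:E * invgamma_int (N + a) S)%E.
  rewrite /A /invgamma_int -integralZl_EFin_nonneg; last 4 first.
  - exact: powR_ge0.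
  - exact: measurable_itv.
  - exact: measurable_invgamma.
  - by move=> s _; rewrite mulr_ge0 ?powR_ge0 ?expR_ge0.
  apply: le_integral_nonneg.
  - by move=> s; rewrite /= !in_itv /= andbT => /andP[].
  - by move=> s _; rewrite lee_fin f0.
  - by move=> s _; rewrite lee_fin !mulr_ge0 ?powR_ge0 ?expR_ge0.
  move=> s; rewrite /= in_itv /= => /andP[s0 ss1]; rewrite lee_fin /f mulrA.
  apply: ler_wpM2r; first exact: expR_ge0.
  rewrite (_ : - (N + 1) = a + - (N + a + 1)); last by ring.
  rewrite powRD ?(gt_eqF s0) ?implybT //; apply: ler_wpM2r; first exact: powR_ge0.
  by apply: ge0_ler_powR => //; rewrite nnegrE ltW.
(* Finiteness allows [J / 2] to be subtracted from [J <= A + J / 2], giving [J <= 2 A]. *)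
have Jfin : J \is a fin_num.
  by rewrite ge0_fin_numE ?invgamma_int_lty ?invgamma_int_ge0.
rewrite -/J EFinM -muleA; apply: (@le_trans _ _ (2%:E * A)%E); last first.
  by apply: lee_wpmul2l A_le; rewrite lee_fin.
have JA : (J <= A + (2^-1)%:E * J)%E by rewrite {1}JE leeD2l.
have [v Jv] : exists v, J = v%:E by exists (fine J); rewrite fineK.
move: JA; rewrite Jv -EFinM.
have A0 : (0 <= A)%E by apply: integral_ge0 => s _; rewrite lee_fin f0.
move: A0; clear; case: A => [x| |] // _; last by rewrite gt0_muley ?leey // lte_fin.
by rewrite -EFinD -EFinM !lee_fin; lra.
Qed.

End InverseGammaIntegral.

(** * One-dimensional Gaussian moments *)

Section GaussianMoment.
Context {R : realType}.
Notation mu := (@lebesgue_measure R).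
Implicit Types c m x : R.

Lemma integral_gaussian c m : 0 < c ->
  (\int[mu]_x (expR (- (c * (x - m) ^+ 2) / 2))%:E =
   (Num.sqrt (2 * pi) * c `^ (- 2^-1))%:E)%E.
Proof.
move=> c0; pose s := c `^ (- 2^-1).
have s0 : 0 < s by exact: powR_gt0.
have s2 : s ^+ 2 = c^-1.
  by rewrite /s -powR_mulrn ?powR_ge0 // -powRrM mulNr mulVf // powR_inv1 // ltW.
have sN0 : s != 0 by rewrite gt_eqF.
have pk0 := normal_peak_gt0 sN0.
have E x : expR (- (c * (x - m) ^+ 2) / 2) = (normal_peak s)^-1 * normal_pdf m s x.
  rewrite normal_pdfE // mulrA mulVf ?gt_eqF // mul1r /normal_fun.
  by congr expR; rewrite s2; field; rewrite gt_eqF.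
under eq_integral do rewrite E.
rewrite integralZl_EFin_nonneg; last 4 first.
- by rewrite invr_ge0 ltW.
- exact: measurableT.
- exact: measurable_normal_pdf.
- by move=> x _; exact: normal_pdf_ge0.
rewrite integral_normal_pdf mule1; congr EFin.
rewrite /normal_peak invrK -mulr_natr sqrtrM ?mulr_ge0 ?sqr_ge0 ?pi_ge0 //.
rewrite sqrtrM ?sqr_ge0 // sqrtr_sqr gtr0_norm // [in RHS]sqrtrM //.
by rewrite -/s; ring.
all: exact: ltW.
Qed.

(** [4^r] comes from splitting [x = m + (x - m)], [(2 r)^r] from the maximum of
    [y^(2 r) exp(- c y^2 / 2)], and [sqrt(2 pi)] from the Gaussian integral that is left. *)
Definition moment_cst (r : nat) : R :=
  Num.sqrt (2 * pi) * 4 ^+ r * (1 + (2 * r%:R) ^+ r).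

Lemma moment_cst_gt0 r : 0 < moment_cst r.
Proof.
by rewrite !mulr_gt0 ?exprn_gt0 ?sqrtr_gt0 ?mulr_gt0 ?pi_gt0.
Qed.

Lemma even_power_le r x m : (x ^+ (2 * r)) <= 4 ^+ r * (m ^+ (2 * r) + (x - m) ^+ (2 * r)).
Proof.
have key (y z : R) : y ^+ 2 <= 4 * z ^+ 2 -> y ^+ (2 * r) <= 4 ^+ r * z ^+ (2 * r).
  move=> h; rewrite !exprM -exprMn; apply: lerXn2r; rewrite ?nnegrE ?sqr_ge0 //.
  by have := sqr_ge0 z; lra.
have p0 (y : R) : 0 <= y ^+ (2 * r) by rewrite exprM exprn_ge0 // sqr_ge0.
rewrite mulrDr; have [h|h] := lerP (m ^+ 2) ((x - m) ^+ 2).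
  rewrite -[leLHS]add0r; apply: lerD; last by apply: key; nra.
  by apply: mulr_ge0; [exact: exprn_ge0|exact: p0].
rewrite -[leLHS]addr0; apply: lerD; first by apply: key; nra.
by apply: mulr_ge0; [exact: exprn_ge0|exact: p0].
Qed.

Lemma gaussian_moment_le (r : nat) c m : (0 < r)%N -> 0 < c ->
  (\int[mu]_x (x ^+ (2 * r) * expR (- (c * (x - m) ^+ 2)))%:E <=
   (moment_cst r * (m ^+ (2 * r) * c `^ (- 2^-1) + c `^ (- (r%:R + 2^-1))))%:E)%E.
Proof.
move=> r0 c0; have p0 y : 0 <= y ^+ (2 * r) :> R by rewrite exprM exprn_ge0 // sqr_ge0.
pose K := 4 ^+ r * (m ^+ (2 * r) + (2 * r%:R / c) ^+ r).
have K0 : 0 <= K.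
  by rewrite mulr_ge0 ?exprn_ge0 // addr_ge0 ?p0 // exprn_ge0 // divr_ge0 ?mulr_ge0 // ltW.
apply: (@le_trans _ _ (\int[mu]_x (K * expR (- (c * (x - m) ^+ 2) / 2))%:E)%E).
  apply: le_integral_nonneg => // x _.
  - by rewrite lee_fin mulr_ge0 ?p0 ?expR_ge0.
  - by rewrite lee_fin mulr_ge0 ?expR_ge0.
  rewrite lee_fin; set y := x - m.
  have -> : expR (- (c * y ^+ 2)) = expR (- (c * y ^+ 2) / 2) * expR (- (c / 2 * y ^+ 2)).
    by rewrite -expRD; congr expR; lra.
  rewrite mulrA mulrAC; apply: ler_wpM2r; first exact: expR_ge0.
  apply: (@le_trans _ _ (4 ^+ r * (m ^+ (2 * r) + y ^+ (2 * r)) * expR (- (c / 2 * y ^+ 2)))).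
    by apply: ler_wpM2r; [exact: expR_ge0|exact: even_power_le].
  rewrite -mulrA /K; apply: ler_wpM2l; first by rewrite exprn_ge0.
  rewrite mulrDl lerD //.
    rewrite -[leRHS]mulr1; apply: ler_wpM2l; rewrite ?p0 //.
    by rewrite -expR0 ler_expR oppr_le0 mulr_ge0 ?sqr_ge0 ?divr_ge0 // ltW.
  have [->|y0] := eqVneq y 0.
    rewrite expr0n muln_eq0 /= (gtn_eqF r0) mul0r exprn_ge0 //.
    by rewrite divr_ge0 ?mulr_ge0 // ltW.
  have y20 : 0 < y ^+ 2 by rewrite exprn_even_gt0.
  have rR : (0 : R) < r%:R by rewrite ltr0n.
  have := powR_expR_le (ltW rR) (divr_gt0 c0 (ltr0n R 2)) y20.
  rewrite (powR_mulrn _ (ltW y20)) -exprM powR_mulrn; last first.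
    by rewrite divr_ge0 // ltW // divr_gt0.
  by rewrite (_ : r%:R / (c / 2) = 2 * r%:R / c) //; field; rewrite gt_eqF.
rewrite integralZl_EFin_nonneg; last 4 first.
- exact: K0.
- exact: measurableT.
- apply: measurableT_comp => //; apply: measurable_funM => //.
  apply: measurableT_comp => //; apply: measurable_funM => //.
  by apply: measurable_funX; apply: measurable_funB.
- by move=> x _; exact: expR_ge0.
rewrite integral_gaussian // -EFinM lee_fin /K /moment_cst.
have cr : (c^-1) ^+ r * c `^ (- 2^-1) = c `^ (- (r%:R + 2^-1)).
  rewrite -powR_mulrn ?invr_ge0 ?(ltW c0) // powR_inv ?(ltW c0) // -powRD; last first.
    by rewrite (gt_eqF c0) implybT.
  by congr (_ `^ _); ring.
have -> : (2 * r%:R / c) ^+ r = (2 * r%:R) ^+ r * (c^-1) ^+ r by rewrite exprMn.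
rewrite -cr; set A := m ^+ _; set B := c `^ _; set D := c^-1 ^+ r.
set Q := (2 * r%:R) ^+ r; set S := Num.sqrt _.
have A0 : 0 <= A by exact: p0.
have B0 : 0 <= B by exact: powR_ge0.
have D0 : 0 <= D by rewrite exprn_ge0 // invr_ge0 ltW.
have Q0 : 0 <= Q by rewrite exprn_ge0 // mulr_ge0.
have S0 : 0 <= S by exact: sqrtr_ge0.
have F0 : 0 <= 4 ^+ r :> R by rewrite exprn_ge0.
have -> : 4 ^+ r * (A + Q * D) * (S * B) = S * 4 ^+ r * ((A + Q * D) * B) by ring.
rewrite -[leRHS]mulrA; apply: ler_wpM2l; first by rewrite mulr_ge0.
have -> : (1 + Q) * (A * B + D * B) = (A + Q * D) * B + (D * B + Q * (A * B)) by ring.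
by rewrite lerDl addr_ge0 ?mulr_ge0.
Qed.

End GaussianMoment.

(** * Iterated integrals of products *)

Section IteratedIntegral.
Context {R : realType}.
Notation mu := (@lebesgue_measure R).

Lemma integral_cV_ge0 k (f : 'cV[R]_k -> \bar R) :
  (forall b, 0 <= f b)%E -> (0 <= integral_cV f)%E.
Proof.
elim: k f => [|k IH] f f0 /=; first exact: f0.
by apply: integral_ge0 => x _; apply: IH => b.
Qed.

Lemma le_integral_cV k (f g : 'cV[R]_k -> \bar R) :
  (forall b, 0 <= f b)%E -> (forall b, f b <= g b)%E ->
  (integral_cV f <= integral_cV g)%E.
Proof.
elim: k f g => [|k IH] f g f0 fg /=; first exact: fg.
apply: le_integral_nonneg => // x _.
- by apply: integral_cV_ge0 => b.
- by apply: integral_cV_ge0 => b; apply: le_trans (fg _).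
- by apply: IH => b.
Qed.

Lemma prod_col_mx k (F : 'I_k.+1 -> R -> R) (x : R) (b : 'cV[R]_k) :
  \prod_(i < k.+1) F i ((col_mx (x%:M : 'cV_1) b : 'cV_(1 + k)) i 0) =
  F ord0 x * \prod_(i < k) F (lift ord0 i) (b i 0).
Proof.
rewrite big_ord_recl; congr (_ * _).
  have -> : ord0 = lshift k (ord0 : 'I_1) by apply: val_inj.
  by rewrite (col_mxEu (x%:M : 'cV_1) b) mxE eqxx.
apply: eq_bigr => i _.
have -> : lift ord0 i = rshift 1 i by apply: val_inj.
by rewrite (col_mxEd (x%:M : 'cV_1) b).
Qed.

(** The constant [C] is part of the statement because the first coordinate, fixed during the inner
    integration, is absorbed into it in the induction. *)
Lemma integral_cV_prod_le k (F : 'I_k -> R -> R) (M : 'I_k -> R) (C : R) :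
  0 <= C -> (forall i, measurable_fun setT (F i)) -> (forall i x, 0 <= F i x) ->
  (forall i, \int[mu]_x (F i x)%:E <= (M i)%:E)%E ->
  (integral_cV (fun b : 'cV[R]_k => (C * \prod_i F i (b i 0))%:E) <=
   (C * \prod_i M i)%:E)%E.
Proof.
elim: k F M C => [|k IH] F M C C0 mF F0 FM; first by rewrite /= !big_ord0.
have M0 i : 0 <= M i.
  by rewrite -lee_fin; apply: le_trans (FM i); apply: integral_ge0 => x _; rewrite lee_fin.
set K := \prod_(i < k) M (lift ord0 i).
have K0 : 0 <= K by apply: prodr_ge0.
apply: (@le_trans _ _ (\int[mu]_x (C * K * F ord0 x)%:E)%E).
  rewrite /=; apply: le_integral_nonneg => // x _.
  - by apply: integral_cV_ge0 => b; rewrite lee_fin mulr_ge0 // prodr_ge0.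
  - by rewrite lee_fin !mulr_ge0.
  rewrite (_ : C * K * F ord0 x = C * F ord0 x * K); last by ring.
  apply: le_trans (IH (fun i => F (lift ord0 i)) (fun i => M (lift ord0 i)) _ _ _ _ _) => //.
    apply: le_integral_cV => b; first by rewrite lee_fin mulr_ge0 // prodr_ge0.
    by rewrite prod_col_mx mulrA.
  by rewrite mulr_ge0.
rewrite integralZl_EFin_nonneg; [|by rewrite mulr_ge0|exact: measurableT|exact: mF|by move=> x _].
rewrite big_ord_recl -/K (_ : C * (M ord0 * K) = C * K * M ord0); last by ring.
by rewrite EFinM; apply: lee_wpmul2l (FM _); rewrite lee_fin mulr_ge0.
Qed.

Lemma integral_cV_prod_ge k (F : 'I_k -> R -> R) (M : 'I_k -> R) (C : R) :
  0 <= C -> (forall i, measurable_fun setT (F i)) -> (forall i x, 0 <= F i x) ->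
  (forall i, 0 <= M i) ->
  (forall i, (M i)%:E <= \int[mu]_x (F i x)%:E)%E ->
  ((C * \prod_i M i)%:E <=
   integral_cV (fun b : 'cV[R]_k => (C * \prod_i F i (b i 0))%:E))%E.
Proof.
elim: k F M C => [|k IH] F M C C0 mF F0 M0 FM; first by rewrite /= !big_ord0.
set K := \prod_(i < k) M (lift ord0 i).
have K0 : 0 <= K by apply: prodr_ge0.
apply: (@le_trans _ _ (\int[mu]_x (C * K * F ord0 x)%:E)%E).
  rewrite integralZl_EFin_nonneg; [|by rewrite mulr_ge0|exact: measurableT|exact: mF|by move=> x _].
  rewrite big_ord_recl -/K (_ : C * (M ord0 * K) = C * K * M ord0); last by ring.
  by rewrite EFinM; apply: lee_wpmul2l (FM _); rewrite lee_fin mulr_ge0.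
rewrite /=; apply: le_integral_nonneg => // x _.
- by rewrite lee_fin !mulr_ge0.
- by apply: integral_cV_ge0 => b; rewrite lee_fin mulr_ge0 // prodr_ge0.
rewrite (_ : C * K * F ord0 x = C * F ord0 x * K); last by ring.
apply: (le_trans (IH (fun i => F (lift ord0 i)) (fun i => M (lift ord0 i)) _ _ _ _ _ _)) => //.
  by rewrite mulr_ge0.
apply: le_integral_cV => b; first by rewrite lee_fin !mulr_ge0 // prodr_ge0.
by rewrite prod_col_mx mulrA.
Qed.

End IteratedIntegral.

(** * Bounds on the marginal density *)

Section Marginal.
Context {R : realType}.
Notation mu := (@lebesgue_measure R).

Lemma Gamma_ge0 (a : R) : 0 <= Gamma a.
Proof.
by apply: Rintegral_ge0 => x _; rewrite mulr_ge0 ?powR_ge0 ?expR_ge0.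
Qed.

Lemma even_power_ge0 r (x : R) : 0 <= x ^+ (2 * r).
Proof. by rewrite exprM exprn_ge0 // sqr_ge0. Qed.

Lemma pmom_shape_ge0 r k (A : 'M[R]_k) (s : R) b : 0 <= pmom_shape r A s b.
Proof.
rewrite !mulr_ge0 ?powR_ge0 ?sqrtr_ge0 ?expR_ge0 //.
by apply: prodr_ge0 => i _; exact: even_power_ge0.
Qed.

Lemma pmom_cst_ge0 r k (A : 'M[R]_k) : 0 <= pmom_cst r A.
Proof.
rewrite invr_ge0; apply: fine_ge0; apply: integral_cV_ge0 => b.
by rewrite lee_fin pmom_shape_ge0.
Qed.

(** The part of the prior free of tau, sigma^2 and b. The factor [(2 pi)^(-k/2) sqrt(det A)] also
    occurs in the normalizing integral and cancels, so that bounds exponential in [k] depending only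
    on [a1] and [a2] are possible. *)
Definition prior_weight r k (A : 'M[R]_k) : R :=
  pmom_cst r A * ((2 * pi) `^ (- (k%:R / 2)) * Num.sqrt (\det A)).

Lemma prior_weight_ge0 r k (A : 'M[R]_k) : 0 <= prior_weight r A.
Proof. by rewrite !mulr_ge0 ?pmom_cst_ge0 ?powR_ge0 ?sqrtr_ge0. Qed.

Lemma pmom_pdfE r k (A : 'M[R]_k) (tau s : R) b :
  pmom_pdf r A tau s b = prior_weight r A *
    (tau * s) `^ (- (r * k)%:R - k%:R / 2) *
    expR (- (b^T *m A *m b) 0 0 / (2 * (tau * s))) * \prod_i b i 0 ^+ (2 * r).
Proof. by rewrite /pmom_pdf /pmom_shape /prior_weight; ring. Qed.

Lemma measurable_box (l h : R) :
  measurable_fun setT (\1_(`[l, l + h]%classic) : R -> R).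
Proof. exact: measurable_indic. Qed.

Lemma integral_box (l h : R) : 0 <= h ->
  (\int[mu]_x (\1_(`[l, l + h]%classic) x)%:E = h%:E)%E.
Proof.
move=> h0; rewrite integral_indic //= setIT lebesgue_measure_itv /= lte_fin.
case: ifPn => [_|]; first by rewrite -EFinB addrAC subrr add0r.
by rewrite -leNgt gerDl => h0'; congr EFin; apply/eqP; rewrite eq_le h0 h0'.
Qed.

(** On the box [[1, 2]^k] the monomials are at least 1 and the quadratic form is at most [4 a2 k],
    half of which enters the exponential. *)
Lemma pmom_integral_ge r k (A : 'M[R]_k) (a2 : R) : 0 <= a2 ->
  (forall b : 'cV[R]_k, (b^T *m A *m b) 0 0 <= a2 * sqnorm b) ->
  (((2 * pi) `^ (- (k%:R / 2)) * Num.sqrt (\det A) * expR (- (2 * a2)) ^+ k)%:E <=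
   integral_cV (fun b => (pmom_shape r A 1 b)%:E))%E.
Proof.
move=> a20 Aub; set C := (_ `^ _) * _.
have C0 : 0 <= C by rewrite mulr_ge0 ?powR_ge0 ?sqrtr_ge0.
pose F (i : 'I_k) (x : R) := expR (- (2 * a2)) * \1_(`[1, 1 + 1]%classic) x.
apply: (@le_trans _ _ (integral_cV (fun b : 'cV[R]_k => (C * \prod_i F i (b i 0))%:E))).
  have -> : expR (- (2 * a2)) ^+ k = \prod_(i < k) expR (- (2 * a2)).
    by rewrite prodr_const card_ord.
  apply: (integral_cV_prod_ge (M := fun=> expR (- (2 * a2)))) => //.
  - by move=> i; apply: measurable_funM => //; exact: measurable_box.
  - by move=> i x; rewrite mulr_ge0 ?expR_ge0.
  move=> i; rewrite integralZl_EFin_nonneg; last 4 first.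
  - exact: expR_ge0.
  - exact: measurableT.
  - exact: measurable_box.
  - by move=> x _.
  by rewrite integral_box // mule1.
apply: le_integral_cV => b.
  by rewrite lee_fin mulr_ge0 // prodr_ge0 // => i _; rewrite mulr_ge0 ?expR_ge0.
rewrite lee_fin /pmom_shape -/C mulr1 powR1 mulr1 -/C.
rewrite -[leRHS]mulrA; apply: ler_wpM2l => //.
have [/forallP hb|] := boolP [forall i, (1 <= b i 0 <= 2)]; last first.
  rewrite negb_forall => /existsP[i hi].
  rewrite (bigD1 i) //= {1}/F indicE memNset; last first.
    by rewrite /= in_itv /= (_ : 1 + 1 = 2) //; apply/negP.
  rewrite mulr0 mul0r mulr_ge0 ?expR_ge0 //.
  by apply: prodr_ge0 => j _; exact: even_power_ge0.
apply: (@le_trans _ _ (expR (- (2 * a2)) ^+ k)).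
  rewrite -[X in _ <= _ ^+ X]card_ord -prodr_const; apply: ler_prod => i _.
  rewrite mulr_ge0 ?expR_ge0 //= -[leRHS]mulr1; apply: ler_wpM2l; first exact: expR_ge0.
  by rewrite indicE; case: (_ \in _).
rewrite -[leLHS]mulr1; apply: ler_pM => //.
- rewrite -expRM_natl ler_expR mulrN mulNr lerN2 ler_pdivrMr //.
  apply: (le_trans (Aub b)); rewrite (_ : _ * 2 = a2 * (4 * k%:R)); last by ring.
  apply: ler_wpM2l => //; rewrite /sqnorm mulr_natr -[X in _ *+ X]card_ord -sumr_const.
  by apply: ler_sum => i _; have := hb i; nra.
- have {1}-> : 1 = \prod_(i < k) (1 : R) by rewrite big1.
  apply: ler_prod => i _.
  rewrite ler01 /=; apply: exprn_ege1; by have /andP[] := hb i.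
Qed.

(** The lower bound on the form decouples the coordinates into moments with center 0 and
    [c = a1 / 2]. *)
Lemma pmom_integral_le r k (A : 'M[R]_k) (a1 : R) : (0 < r)%N -> 0 < a1 ->
  (forall b : 'cV[R]_k, a1 * sqnorm b <= (b^T *m A *m b) 0 0) ->
  (integral_cV (fun b => (pmom_shape r A 1 b)%:E) <=
   ((2 * pi) `^ (- (k%:R / 2)) * Num.sqrt (\det A) *
     (moment_cst r * (a1 / 2) `^ (- (r%:R + 2^-1))) ^+ k)%:E)%E.
Proof.
move=> r0 a10 Alb; set C := (_ `^ _) * _.
have C0 : 0 <= C by rewrite mulr_ge0 ?powR_ge0 ?sqrtr_ge0.
pose F (i : 'I_k) (x : R) := x ^+ (2 * r) * expR (- (a1 / 2 * (x - 0) ^+ 2)).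
have F0 i x : 0 <= F i x by rewrite mulr_ge0 ?even_power_ge0 ?expR_ge0.
apply: (@le_trans _ _ (integral_cV (fun b : 'cV[R]_k => (C * \prod_i F i (b i 0))%:E))).
  apply: le_integral_cV => b; first by rewrite lee_fin pmom_shape_ge0.
  rewrite lee_fin /pmom_shape powR1 !mulr1 -/C -[leLHS]mulrA; apply: ler_wpM2l => //.
  rewrite big_split /= mulrC; apply: ler_wpM2l.
    by apply: prodr_ge0 => i _; exact: even_power_ge0.
  rewrite -expR_sum ler_expR sumrN mulNr lerN2 ler_pdivlMr // -mulr_sumr.
  apply: le_trans (Alb b); rewrite mulrAC divfK //.
  by apply: ler_wpM2l; [exact: ltW|apply: ler_sum => i _; rewrite subr0].
have -> : (moment_cst r * (a1 / 2) `^ (- (r%:R + 2^-1))) ^+ k =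
    \prod_(i < k) (moment_cst r * (a1 / 2) `^ (- (r%:R + 2^-1))).
  by rewrite prodr_const card_ord.
apply: integral_cV_prod_le => //.
- move=> i; apply: measurable_funM; first exact: measurable_funX.
  apply: measurableT_comp => //; apply: measurableT_comp => //.
  by apply: measurable_funM => //; apply: measurable_funX; apply: measurable_funB.
move=> i; apply: (le_trans (gaussian_moment_le 0 r0 (divr_gt0 a10 (ltr0n R 2)))).
by rewrite expr0n muln_eq0 /= (gtn_eqF r0) mul0r add0r.
Qed.

Lemma prior_weight_le r k (A : 'M[R]_k) (a2 : R) : 0 <= a2 ->
  (forall b : 'cV[R]_k, (b^T *m A *m b) 0 0 <= a2 * sqnorm b) ->
  prior_weight r A <= expR (2 * a2) ^+ k.
Proof.
move=> a20 Aub; have := pmom_integral_ge r a20 Aub.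
rewrite /prior_weight /pmom_cst; set C := (_ `^ _) * _; set J := integral_cV _.
have C0 : 0 <= C by rewrite mulr_ge0 ?powR_ge0 ?sqrtr_ge0.
have J0 : (0 <= J)%E by apply: integral_cV_ge0 => b; rewrite lee_fin pmom_shape_ge0.
(* For an infinite normalizing integral, [fine] and then the inverse give 0, and the weight
   vanishes. *)
case: J J0 => [v| |] //= v0 h; last by rewrite invr0 mul0r exprn_ge0 // expR_ge0.
rewrite lee_fin expRN exprVn in h; rewrite lee_fin in v0.
have e0 : 0 < expR (2 * a2) ^+ k by rewrite exprn_gt0 // expR_gt0.
rewrite ler_pdivrMr // in h.
have [->|vN] := eqVneq v 0; first by rewrite invr0 mul0r ltW.
by rewrite mulrC ler_pdivrMr ?lt_neqAle ?(eq_sym 0) ?vN // mulrC.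
Qed.

(** The normalizing integral must be finite, by [pmom_integral_le], and positive, by
    [pmom_integral_ge] together with [det_gt0]. *)
Lemma prior_weight_ge r k (A : 'M[R]_k) (a1 a2 : R) : (0 < r)%N -> 0 < a1 -> 0 <= a2 ->
  (forall b : 'cV[R]_k, a1 * sqnorm b <= (b^T *m A *m b) 0 0 <= a2 * sqnorm b) ->
  (moment_cst r * (a1 / 2) `^ (- (r%:R + 2^-1))) ^- k <= prior_weight r A.
Proof.
move=> r0 a10 a20 Ab.
have Alb b : a1 * sqnorm b <= (b^T *m A *m b) 0 0 by case/andP: (Ab b).
have Aub b : (b^T *m A *m b) 0 0 <= a2 * sqnorm b by case/andP: (Ab b).
have detA : 0 < \det A.
  apply: det_gt0 => b b0; apply: lt_le_trans (Alb b).
  rewrite mulr_gt0 // lt_neqAle sqnorm_ge0 andbT.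
  by apply: contraNneq b0 => /esym/sqnorm_eq0 ->.
have := pmom_integral_ge r a20 Aub; have := pmom_integral_le r0 a10 Alb.
rewrite /prior_weight /pmom_cst; set C := (_ `^ _) * _; set J := integral_cV _.
have C0 : 0 < C by rewrite mulr_gt0 ?powR_gt0 ?sqrtr_gt0 ?mulr_gt0 ?pi_gt0.
set Q := _ ^+ k.
have Q0 : 0 < Q by rewrite exprn_gt0 // mulr_gt0 ?moment_cst_gt0 ?powR_gt0 ?divr_gt0.
case: J => [v| |] //=; rewrite !lee_fin => vQ vC.
have v0 : 0 < v.
  by apply: lt_le_trans vC; rewrite mulr_gt0 // exprn_gt0 // expR_gt0.
by rewrite mulrC ler_pdivlMr // ler_pdivrMl // mulrC.
Qed.

End Marginal.

Section MarginalUpper.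
Context {R : realType}.
Notation mu := (@lebesgue_measure R).

Lemma expr1D_le (u : R) T : 0 <= u -> (1 + u) ^+ T <= 2 ^+ T * (1 + u ^+ T).
Proof.
move=> u0; have [u1|u1] := lerP u 1.
  apply: (@le_trans _ _ (2 ^+ T)); first by apply: lerXn2r; rewrite ?nnegrE; lra.
  by rewrite -[leLHS]mulr1; apply: ler_wpM2l; rewrite ?exprn_ge0 // lerDl exprn_ge0.
apply: (@le_trans _ _ ((2 * u) ^+ T)); first by apply: lerXn2r; rewrite ?nnegrE; lra.
by rewrite exprMn; apply: ler_wpM2l; rewrite ?exprn_ge0 // lerDr.
Qed.

(** Here [s] is the variance. Outside [J] the powers of [s] from the prior and from the moment
    cancel; inside [J] a factor [s^(-r)] survives. Since [(1 + s^(-r))^T <= 2^T (1 + s^(-r T))],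
    only two exponents of [s] remain to be integrated. *)
Lemma coord_prod_le r k (s c Bm : R) (beta : 'I_k -> R) (J : {set 'I_k}) T :
  0 < s -> 1 <= c -> 1 <= Bm -> (0 < r)%N ->
  (forall i, i \notin J -> beta i = 0) ->
  (forall i, i \in J -> beta i ^+ (2 * r) <= Bm) -> (#|J| <= T)%N ->
  s `^ (- (r * k)%:R - k%:R / 2) *
  \prod_i (moment_cst r *
    (beta i ^+ (2 * r) * (c / s) `^ (- 2^-1) + (c / s) `^ (- (r%:R + 2^-1)))) <=
  moment_cst r ^+ k * (2 * Bm) ^+ T *
    c `^ (- (#|J|%:R / 2) - (r%:R + 2^-1) * #|~: J|%SET%:R) *
    (1 + s `^ (- (r * T)%:R)).
Proof.
move=> s0 c1 Bm1 r0 bJ0 bJ JT; have c0 : 0 < c by apply: lt_le_trans c1.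
have M0 : 0 < moment_cst r :> R by exact: moment_cst_gt0.
set M := moment_cst r in M0 *.
pose h : R := r%:R + 2^-1; pose u := s `^ (- r%:R).
have u0 : 0 <= u by exact: powR_ge0.
have -> : s `^ (- (r * k)%:R - k%:R / 2) = \prod_(i < k) s `^ (- h).
  rewrite prodr_const card_ord -powR_mulrn ?powR_ge0 // -powRrM natrM /h.
  by congr (_ `^ _); ring.
rewrite -big_split /=.
have cs a : (c / s) `^ (- a) = c `^ (- a) * s `^ a.
  rewrite powRM ?ltW ?invr_gt0 // powR_inv ?(ltW s0) // opprK //.
have coord i : s `^ (- h) * (M * (beta i ^+ (2 * r) * (c / s) `^ (- 2^-1) +
      (c / s) `^ (- h))) =
    M * (beta i ^+ (2 * r) * c `^ (- 2^-1) * u + c `^ (- h)).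
  have e1 : s `^ (- h) * s `^ h = 1.
    by rewrite -powRD ?addNr ?powRr0 // (gt_eqF s0) implybT.
  have e2 : s `^ (- h) * s `^ 2^-1 = u.
    rewrite -powRD ?(gt_eqF s0) ?implybT //; congr (_ `^ _); rewrite /h; ring.
  rewrite !cs -e2.
  transitivity (M * (beta i ^+ (2 * r) * c `^ (- 2^-1) * (s `^ (- h) * s `^ 2^-1) +
     c `^ (- h) * (s `^ (- h) * s `^ h))); first by ring.
  by rewrite e1; ring.
under eq_bigr do rewrite coord.
have ch : c `^ (- h) <= c `^ (- 2^-1).
  by apply: ler_powR => //; rewrite lerN2 /h lerDr.
apply: (@le_trans _ _ ((M * (Bm * c `^ (- 2^-1) * (1 + u))) ^+ #|J| *
                       (M * c `^ (- h)) ^+ #|~: J|%SET)).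
  rewrite (bigID (mem J)) /=; apply: ler_pM.
  - by apply: prodr_ge0 => i _; rewrite mulr_ge0 ?(ltW M0) // addr_ge0 ?mulr_ge0 ?even_power_ge0 ?powR_ge0.
  - by apply: prodr_ge0 => i _; rewrite mulr_ge0 ?(ltW M0) // addr_ge0 ?mulr_ge0 ?even_power_ge0 ?powR_ge0.
  - rewrite -prodr_const; apply: ler_prod => i iJ; apply/andP; split.
      by rewrite mulr_ge0 ?(ltW M0) // addr_ge0 ?mulr_ge0 ?even_power_ge0 ?powR_ge0.
    apply: ler_wpM2l; first exact: ltW.
    rewrite mulrDr mulr1 addrC; apply: lerD.
      apply: (le_trans ch); rewrite -[leLHS]mul1r; apply: ler_wpM2r => //.
      exact: powR_ge0.
    by apply: ler_wpM2r => //; apply: ler_wpM2r; [exact: powR_ge0|exact: bJ].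
  - rewrite -prodr_const; under [leRHS]eq_bigl do rewrite inE.
    apply: ler_prod => i iJ; apply/andP; split.
      by rewrite mulr_ge0 ?(ltW M0) // addr_ge0 ?mulr_ge0 ?even_power_ge0 ?powR_ge0.
    by rewrite bJ0 // expr0n muln_eq0 /= (gtn_eqF r0) !mul0r add0r.
have Mk : M ^+ k = M ^+ #|J| * M ^+ #|~: J|%SET by rewrite -exprD cardsC card_ord.
have -> : (M * (Bm * c `^ (- 2^-1) * (1 + u))) ^+ #|J| * (M * c `^ (- h)) ^+ #|~: J|%SET
   = M ^+ k * (Bm * (1 + u)) ^+ #|J| * c `^ (- (#|J|%:R / 2) - h * #|~: J|%SET%:R).
  rewrite Mk !exprMn powRD ?(gt_eqF c0) ?implybT //.
  rewrite -[c `^ (- 2^-1) ^+ _]powR_mulrn ?powR_ge0 //.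
  rewrite -[c `^ (- h) ^+ _]powR_mulrn ?powR_ge0 // -!powRrM.
  rewrite (_ : - 2^-1 * #|J|%:R = - (#|J|%:R / 2)); last by ring.
  rewrite (_ : - h * #|~: J|%SET%:R = - (h * #|~: J|%SET%:R)); last by ring.
  ring.
rewrite -!mulrA; apply: ler_wpM2l; first by rewrite exprn_ge0 // ltW.
rewrite (mulrC (c `^ _)) !mulrA; apply: ler_wpM2r; first exact: powR_ge0.
apply: (@le_trans _ _ ((Bm * (1 + u)) ^+ T)).
  apply: ler_weXn2l => //; rewrite -[leLHS]mulr1; apply: ler_pM => //.
  by rewrite lerDl.
rewrite !exprMn (mulrC (2 ^+ _)) -mulrA; apply: ler_wpM2l.
  by rewrite exprn_ge0 // (le_trans _ Bm1).
rewrite (_ : s `^ (- (r * T)%:R) = u ^+ T); first exact: expr1D_le.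
by rewrite -powR_mulrn // /u -powRrM natrM mulNr.
Qed.

Definition tau_cst (n : nat) : R := (n%:R / 2) `^ (1 / 2) / Gamma (1 / 2).
Definition sig_cst (alpha1 alpha2 : R) : R := alpha2 `^ alpha1 / Gamma alpha1.

Lemma tau_cst_ge0 n : 0 <= tau_cst n.
Proof. by rewrite divr_ge0 ?powR_ge0 ?Gamma_ge0. Qed.

Lemma sig_cst_ge0 a b : 0 <= sig_cst a b.
Proof. by rewrite divr_ge0 ?powR_ge0 ?Gamma_ge0. Qed.

Lemma tau_pdf_ge0 n (tau : R) : 0 <= tau_pdf n tau.
Proof.
rewrite /tau_pdf -/(tau_cst n); apply: mulr_ge0 (expR_ge0 _).
by apply: mulr_ge0 (powR_ge0 _ _); exact: tau_cst_ge0.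
Qed.

Lemma invgamma_pdf_ge0 (alpha1 alpha2 s : R) : 0 <= invgamma_pdf alpha1 alpha2 s.
Proof.
rewrite /invgamma_pdf -/(sig_cst alpha1 alpha2); apply: mulr_ge0 (expR_ge0 _).
by apply: mulr_ge0 (powR_ge0 _ _); exact: sig_cst_ge0.
Qed.

Lemma marginal_integrand_ge0 r (alpha1 alpha2 : R) n k (X : 'M[R]_(n, k))
    (A : 'M[R]_k) y tau s2 b :
  0 <= gaussian_pdf (X *m b) s2 y * pmom_pdf r A tau s2 b * tau_pdf n tau *
       invgamma_pdf alpha1 alpha2 s2.
Proof.
apply: mulr_ge0 (invgamma_pdf_ge0 _ _ _); apply: mulr_ge0 (tau_pdf_ge0 _ _).
apply: mulr_ge0; first by apply: mulr_ge0 (expR_ge0 _); exact: powR_ge0.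
by apply: mulr_ge0; [exact: pmom_cst_ge0|exact: pmom_shape_ge0].
Qed.

(** [J] contains every position with a nonzero center. Once [b] is integrated out, tau and sigma^2
    stand in separate factors; the two integrals over sigma^2 belong to the two exponents left by
    [coord_prod_le]. *)
Lemma marginal_le r (alpha1 alpha2 : R) n k (X : 'M[R]_(n, k)) (A : 'M[R]_k)
    (y : 'cV[R]_n)
    (E c Bm : R) (beta : 'I_k -> R) (J : {set 'I_k}) T :
  (0 < r)%N -> 1 <= c -> 1 <= Bm ->
  (forall b : 'cV[R]_k, 0 <= (b^T *m A *m b) 0 0) ->
  (forall b : 'cV[R]_k, E + 2 * c * (\sum_i (b i 0 - beta i) ^+ 2) <=
     \sum_i (y i 0 - (X *m b) i 0) ^+ 2) ->
  (forall i, i \notin J -> beta i = 0) ->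
  (forall i, i \in J -> beta i ^+ (2 * r) <= Bm) -> (#|J| <= T)%N ->
  (marginal r alpha1 alpha2 X A y <=
   ((2 * pi) `^ (- (n%:R / 2)) * tau_cst n * sig_cst alpha1 alpha2 *
     (prior_weight r A * (moment_cst r ^+ k * (2 * Bm) ^+ T *
      c `^ (- (#|J|%:R / 2) - (r%:R + 2^-1) * #|~: J|%SET%:R))))%:E *
   invgamma_int ((r * k)%:R + k%:R / 2 + 2^-1) (n%:R / 2) *
   (invgamma_int (n%:R / 2 + alpha1) (E / 2 + alpha2) +
    invgamma_int (n%:R / 2 + alpha1 + (r * T)%:R) (E / 2 + alpha2)))%E.
Proof.
move=> r0 c1 Bm1 Age0 HE bJ0 bJ JT; have c0 : 0 < c by apply: lt_le_trans c1.
set D := moment_cst r ^+ k * _ * _; set Kc := (2 * pi) `^ _ * _ * _ * (_ * D).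
have D0 : 0 <= D.
  by rewrite !mulr_ge0 ?exprn_ge0 ?powR_ge0 ?mulr_ge0 ?(ltW (moment_cst_gt0 _)) // (le_trans _ Bm1).
have Kc0 : 0 <= Kc.
  by rewrite !(tau_cst_ge0, sig_cst_ge0, prior_weight_ge0, powR_ge0, D0, mulr_ge0).
pose N1 := (r * k)%:R + k%:R / 2 + 2^-1 : R.
pose h1 (tau : R) := tau `^ (- (N1 + 1)) * expR (- (n%:R / 2) / tau).
pose N2 := n%:R / 2 + alpha1; pose N3 := N2 + (r * T)%:R; pose S := E / 2 + alpha2.
pose h2 (N s : R) := s `^ (- (N + 1)) * expR (- S / s).
have h10 tau : 0 <= h1 tau by rewrite mulr_ge0 ?powR_ge0 ?expR_ge0.
have h20 N s : 0 <= h2 N s by rewrite mulr_ge0 ?powR_ge0 ?expR_ge0.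
have mh2 N Dm : measurable_fun Dm (h2 N) by exact: measurable_invgamma.
have mh1 Dm : measurable_fun Dm h1 by exact: measurable_invgamma.
have key tau s : 0 < tau -> 0 < s ->
  (integral_cV (fun b : 'cV[R]_k =>
     (gaussian_pdf (X *m b) s y * pmom_pdf r A tau s b * tau_pdf n tau *
      invgamma_pdf alpha1 alpha2 s)%:E) <=
   (Kc * h1 tau * (h2 N2 s + h2 N3 s))%:E)%E.
  move=> tau0 s0.
  pose F (i : 'I_k) (x : R) := x ^+ (2 * r) * expR (- (c / s * (x - beta i) ^+ 2)).
  pose Cst := (2 * pi * s) `^ (- (n%:R / 2)) * expR (- E / (2 * s)) *
    (prior_weight r A * (tau * s) `^ (- (r * k)%:R - k%:R / 2)) *
    tau_pdf n tau * invgamma_pdf alpha1 alpha2 s.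
  have Cst0 : 0 <= Cst.
    apply: mulr_ge0 (invgamma_pdf_ge0 _ _ _); apply: mulr_ge0 (tau_pdf_ge0 _ _).
    by rewrite !(prior_weight_ge0, powR_ge0, expR_ge0, mulr_ge0).
  have cs0 : 0 < c / s by rewrite divr_gt0.
  pose M i := moment_cst r * (beta i ^+ (2 * r) * (c / s) `^ (- 2^-1) +
                  (c / s) `^ (- (r%:R + 2^-1))).
  apply: (@le_trans _ _ (Cst * \prod_i M i)%:E).
    apply: (le_trans (le_integral_cV (g := fun b => (Cst * \prod_i F i (b i 0))%:E) _ _)).
    - by move=> b; rewrite lee_fin marginal_integrand_ge0.
    - move=> b; rewrite lee_fin pmom_pdfE /gaussian_pdf /Cst.
      set w := prior_weight r A; set p1 := (2 * pi * s) `^ _.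
      set p2 := (tau * s) `^ _; set t1 := tau_pdf n tau; set t2 := invgamma_pdf _ _ _.
      have t10 : 0 <= t1 by exact: tau_pdf_ge0.
      have t20 : 0 <= t2 by exact: invgamma_pdf_ge0.
      rewrite big_split /=; set pr := \prod_i b i 0 ^+ (2 * r).
      set e1 := expR (- (\sum_i _) / _); set e2 := expR (- _ / (2 * (tau * s))).
      set e3 := expR (- E / _); set e4 := \prod_i expR _.
      rewrite (_ : _ * _ * _ * _ = (p1 * w * p2 * t1 * t2 * pr) * (e1 * e2)); last by ring.
      rewrite (_ : _ * (pr * e4) = (p1 * w * p2 * t1 * t2 * pr) * (e3 * e4)); last by ring.
      apply: ler_wpM2l.
        apply: mulr_ge0; first by rewrite !(prior_weight_ge0, powR_ge0, t10, t20, mulr_ge0).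
        by apply: prodr_ge0 => i _; exact: even_power_ge0.
      rewrite -[leRHS]mulr1; apply: ler_pM; rewrite ?expR_ge0 //; last first.
        rewrite -expR0 ler_expR mulNr oppr_le0 divr_ge0 //.
        by rewrite !mulr_ge0 // ltW.
      rewrite /e1 /e3 /e4 -expR_sum -expRD ler_expR sumrN -mulr_sumr.
      have := HE b; set SS := \sum_i (b i 0 - _) ^+ 2; set SY := \sum_i (y i 0 - _) ^+ 2.
      move=> h; rewrite (_ : - E / (2 * s) - c / s * SS = - (E + 2 * c * SS) / (2 * s)).
        by rewrite !mulNr lerN2 ler_pM2r // invr_gt0 mulr_gt0.
      by field; rewrite gt_eqF.
    apply: integral_cV_prod_le => //.
    - move=> i; apply: measurable_funM; first exact: measurable_funX.
      apply: measurableT_comp => //; apply: measurableT_comp => //.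
      by apply: measurable_funM => //; apply: measurable_funX; apply: measurable_funB.
    - by move=> i x; rewrite mulr_ge0 ?even_power_ge0 ?expR_ge0.
    - by move=> i; exact: gaussian_moment_le.
  rewrite lee_fin.
  have cp := coord_prod_le s0 c1 Bm1 r0 bJ0 bJ JT.
  have CstE : Cst = (2 * pi) `^ (- (n%:R / 2)) * tau_cst n * sig_cst alpha1 alpha2 *
     prior_weight r A * h1 tau * h2 N2 s * s `^ (- (r * k)%:R - k%:R / 2).
    rewrite /Cst /tau_pdf /invgamma_pdf -/(tau_cst n) -/(sig_cst alpha1 alpha2).
    rewrite !powRM ?(ltW s0) ?(ltW tau0) ?mulr_ge0 ?pi_ge0 //.
    rewrite /h1 /h2 /N2 /S.
    have -> : expR (- n%:R / (2 * tau)) = expR (- (n%:R / 2) / tau).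
      by congr expR; field; rewrite gt_eqF.
    have -> : expR (- (E / 2 + alpha2) / s) = expR (- E / (2 * s)) * expR (- alpha2 / s).
      by rewrite -expRD; congr expR; field; rewrite gt_eqF.
    have -> : tau `^ (- (N1 + 1)) = tau `^ (- (r * k)%:R - k%:R / 2) * tau `^ (- (3 / 2)).
      rewrite -powRD ?(gt_eqF tau0) ?implybT //; congr (_ `^ _).
      by rewrite /N1; lra.
    have -> : s `^ (- (n%:R / 2 + alpha1 + 1)) = s `^ (- (n%:R / 2)) * s `^ (- (alpha1 + 1)).
      rewrite -powRD ?(gt_eqF s0) ?implybT //; congr (_ `^ _); ring.
    ring.
  have Q0 : 0 <= (2 * pi) `^ (- (n%:R / 2)) * tau_cst n * sig_cst alpha1 alpha2 *
     prior_weight r A * h1 tau * h2 N2 s.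
    apply: mulr_ge0 (h20 _ _); apply: mulr_ge0 (h10 _).
    apply: mulr_ge0 (prior_weight_ge0 _ _); apply: mulr_ge0 (sig_cst_ge0 _ _).
    by apply: mulr_ge0 (tau_cst_ge0 _); exact: powR_ge0.
  rewrite CstE -mulrA; apply: (le_trans (ler_wpM2l Q0 cp)).
  have h23 : h2 N3 s = h2 N2 s * s `^ (- (r * T)%:R).
    rewrite /h2 /N3 (_ : - (N2 + _ + 1) = - (N2 + 1) + - (r * T)%:R); last by ring.
    rewrite powRD ?(gt_eqF s0) ?implybT //; ring.
  rewrite h23 -/D /Kc le_eqVlt; apply/orP; left; apply/eqP; ring.
rewrite /marginal.
set I1 := invgamma_int N1 _; set I2 := invgamma_int N2 S; set I3 := invgamma_int N3 S.
have I230 : (0 <= I2 + I3)%E by rewrite adde_ge0 ?invgamma_int_ge0.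
apply: (@le_trans _ _ (\int[mu]_(tau in `]0%R, +oo[) ((Kc * h1 tau)%:E * (I2 + I3)))%E).
  apply: le_integral_nonneg; [by []|move=> tau _|move=> tau _|move=> tau].
  - apply: integral_ge0 => s _; apply: integral_cV_ge0 => b.
    by rewrite lee_fin marginal_integrand_ge0.
  - by apply: mule_ge0 => //; rewrite lee_fin; apply: mulr_ge0 (h10 _).
  rewrite /= in_itv /= andbT => tau0.
  apply: (@le_trans _ _ (\int[mu]_(s in `]0%R, +oo[)
       (Kc * h1 tau * (h2 N2 s + h2 N3 s))%:E)%E).
    apply: le_integral_nonneg; [by []|move=> s _|move=> s _|move=> s].
    - apply: integral_cV_ge0 => b.
      by rewrite lee_fin marginal_integrand_ge0.
    - rewrite lee_fin; apply: mulr_ge0; last by apply: addr_ge0; exact: h20.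
      by apply: mulr_ge0 (h10 _).
    by rewrite /= in_itv /= andbT; exact: key.
  rewrite integralZl_EFin_nonneg; last 4 first.
  - exact: mulr_ge0 Kc0 (h10 _).
  - exact: measurable_itv.
  - by apply: measurable_funD; exact: mh2.
  - by move=> s _; apply: addr_ge0; exact: h20.
  apply: lee_wpmul2l; first by rewrite lee_fin; exact: mulr_ge0 Kc0 (h10 _).
  under eq_integral do rewrite EFinD.
  rewrite ge0_integralD; first by [].
  - exact: measurable_itv.
  - by move=> s _; rewrite lee_fin.
  - by apply/measurable_EFinP; exact: mh2.
  - by move=> s _; rewrite lee_fin.
  - by apply/measurable_EFinP; exact: mh2.
rewrite ge0_integralZr; last 4 first.
- exact: measurable_itv.
- by apply/measurable_EFinP; apply: measurable_funM => //; exact: mh1.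
- by move=> tau _; rewrite lee_fin; exact: mulr_ge0 Kc0 (h10 _).
- exact: I230.
rewrite integralZl_EFin_nonneg; last 4 first.
- exact: Kc0.
- exact: measurable_itv.
- exact: mh1.
- by move=> tau _; exact: h10.
exact: lexx.
Qed.

End MarginalUpper.

Section MarginalLower.
Context {R : realType}.
Notation mu := (@lebesgue_measure R).

(** [E], [B] and [m0] control the residual, the prior form and the monomials on the box. For tau in
    [[n, 2n]] one has [exp(- n / (2 tau)) >= exp(-1/2)], the prior form adds at most [B / (2 n)] to
    the inverse-gamma scale, and the interval contributes its length n. *)
Lemma marginal_ge r (alpha1 alpha2 : R) n k (X : 'M[R]_(n, k)) (A : 'M[R]_k)
    (y : 'cV[R]_n) (E B m0 h : R) (l : 'I_k -> R) :
  (0 < n)%N -> 0 <= B -> 0 <= m0 -> 0 <= h ->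
  (forall b : 'cV[R]_k, (forall i, l i <= b i 0 <= l i + h) ->
     [/\ \sum_i (y i 0 - (X *m b) i 0) ^+ 2 <= E,
         (b^T *m A *m b) 0 0 <= B & forall i, m0 <= b i 0 ^+ (2 * r)]) ->
  (((2 * pi) `^ (- (n%:R / 2)) * tau_cst n * sig_cst alpha1 alpha2 *
     (prior_weight r A * (m0 * h) ^+ k *
      ((2 * n%:R) `^ (- ((r * k)%:R + k%:R / 2 + 3 / 2)) * expR (- 2^-1)) * n%:R))%:E *
   invgamma_int (n%:R / 2 + alpha1 + ((r * k)%:R + k%:R / 2))
     (E / 2 + B / (2 * n%:R) + alpha2) <= marginal r alpha1 alpha2 X A y)%E.
Proof.
move=> n0 B0 m00 h0 HB.
have nR : (0 : R) < n%:R by rewrite ltr0n.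
set x : R := (r * k)%:R + k%:R / 2; set tl := (2 * n%:R) `^ _ * _.
have tl0 : 0 <= tl by rewrite mulr_ge0 ?powR_ge0 ?expR_ge0.
set W := prior_weight r A; have W0 : 0 <= W by exact: prior_weight_ge0.
set g := (2 * pi) `^ _ * _ * _.
have g0 : 0 <= g.
  by apply: mulr_ge0 (sig_cst_ge0 _ _); apply: mulr_ge0 (tau_cst_ge0 _); exact: powR_ge0.
set mh := (m0 * h) ^+ k; have mh0 : 0 <= mh by rewrite exprn_ge0 // mulr_ge0.
set N := _ + x; set S := E / 2 + _ + _.
pose h2 (s : R) := s `^ (- (N + 1)) * expR (- S / s).
have h20 s : 0 <= h2 s by rewrite mulr_ge0 ?powR_ge0 ?expR_ge0.
have mh2 Dm : measurable_fun Dm h2 by exact: measurable_invgamma.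
pose Kc := g * (W * mh * tl).
have Kc0 : 0 <= Kc.
  by apply: mulr_ge0 g0 _; apply: mulr_ge0 tl0; apply: mulr_ge0 W0 mh0.
have key tau s : n%:R <= tau <= 2 * n%:R -> 0 < s ->
  ((Kc * h2 s)%:E <= integral_cV (fun b : 'cV[R]_k =>
     (gaussian_pdf (X *m b) s y * pmom_pdf r A tau s b * tau_pdf n tau *
      invgamma_pdf alpha1 alpha2 s)%:E))%E.
  move=> /andP[ntau tau2n] s0; have tau0 : 0 < tau by apply: lt_le_trans ntau.
  pose F (i : 'I_k) : R -> R := \1_(`[l i, l i + h]%classic).
  pose p1 := (2 * pi * s) `^ (- (n%:R / 2)).
  pose p2 := (tau * s) `^ (- (r * k)%:R - k%:R / 2).
  pose Cst := p1 * expR (- E / (2 * s)) *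
    (W * p2 * expR (- B / (2 * (tau * s))) * m0 ^+ k) *
    tau_pdf n tau * invgamma_pdf alpha1 alpha2 s.
  have Cst0 : 0 <= Cst.
    apply: mulr_ge0 (invgamma_pdf_ge0 _ _ _); apply: mulr_ge0 (tau_pdf_ge0 _ _).
    apply: mulr_ge0; first by apply: mulr_ge0 (expR_ge0 _); exact: powR_ge0.
    apply: mulr_ge0 (exprn_ge0 _ m00); apply: mulr_ge0 (expR_ge0 _).
    by apply: mulr_ge0 W0 (powR_ge0 _ _).
  apply: (@le_trans _ _ (Cst * \prod_(i < k) h)%:E); last first.
    apply: (le_trans (integral_cV_prod_ge (F := F) Cst0 _ _ _ _)).
    - by move=> i; exact: measurable_indic.
    - by move=> i z.
    - by move=> i.
    - by move=> i; rewrite integral_box.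
    apply: le_integral_cV => b.
      by rewrite lee_fin mulr_ge0 // prodr_ge0.
    rewrite lee_fin.
    have [/forallP hb|] := boolP [forall i, (l i <= b i 0 <= l i + h)]; last first.
      rewrite negb_forall => /existsP[i hi].
      rewrite (bigD1 i) //= {1}/F indicE memNset; last first.
        by rewrite /= in_itv /=; apply/negP.
      by rewrite mul0r mulr0 marginal_integrand_ge0.
    rewrite big1 ?mulr1; last first.
      by move=> i _; rewrite /F indicE mem_set // /= in_itv /=; exact: hb.
    have [EX BA mb] := HB b hb.
    rewrite /Cst; apply: ler_wpM2r; first exact: invgamma_pdf_ge0.
    apply: ler_wpM2r; first exact: tau_pdf_ge0.
    apply: ler_pM.
    - by apply: mulr_ge0 (expR_ge0 _); exact: powR_ge0.
    - apply: mulr_ge0 (exprn_ge0 _ m00); apply: mulr_ge0 (expR_ge0 _).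
      by apply: mulr_ge0 W0 (powR_ge0 _ _).
    - apply: ler_wpM2l; first exact: powR_ge0.
      by rewrite ler_expR !mulNr lerN2 ler_pM2r // invr_gt0 mulr_gt0.
    rewrite pmom_pdfE -/W -/p2; apply: ler_pM.
    - by apply: mulr_ge0 (expR_ge0 _); apply: mulr_ge0 W0 (powR_ge0 _ _).
    - exact: exprn_ge0.
    - apply: ler_wpM2l; first by apply: mulr_ge0 W0 (powR_ge0 _ _).
      by rewrite ler_expR !mulNr lerN2 ler_pM2r // invr_gt0 !mulr_gt0.
    rewrite -[X in _ ^+ X]card_ord -prodr_const; apply: ler_prod => i _.
    by rewrite m00 mb.
  rewrite lee_fin prodr_const card_ord.
  have -> : Kc * h2 s = (g * W * mh * s `^ (- (N + 1)) * expR (- (E / 2 + alpha2) / s)) *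
       (tl * expR (- (B / (2 * n%:R)) / s)).
    rewrite /Kc /h2 /S.
    have -> : expR (- (E / 2 + B / (2 * n%:R) + alpha2) / s) =
       expR (- (E / 2 + alpha2) / s) * expR (- (B / (2 * n%:R)) / s).
      by rewrite -expRD; congr expR; field; rewrite !gt_eqF.
    ring.
  have -> : Cst * h ^+ k = (g * W * mh * s `^ (- (N + 1)) * expR (- (E / 2 + alpha2) / s)) *
     ((tau `^ (- (x + 3 / 2)) * expR (- (n%:R / 2) / tau)) * expR (- B / (2 * (tau * s)))).
    rewrite /Cst /p1 /p2 /tau_pdf /invgamma_pdf -/(tau_cst n) -/(sig_cst alpha1 alpha2).
    rewrite !powRM ?(ltW s0) ?(ltW tau0) ?mulr_ge0 ?pi_ge0 // /mh exprMn.
    have -> : expR (- n%:R / (2 * tau)) = expR (- (n%:R / 2) / tau).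
      by congr expR; field; rewrite gt_eqF.
    have -> : expR (- (E / 2 + alpha2) / s) = expR (- E / (2 * s)) * expR (- alpha2 / s).
      by rewrite -expRD; congr expR; field; rewrite gt_eqF.
    have -> : tau `^ (- (x + 3 / 2)) = tau `^ (- (r * k)%:R - k%:R / 2) * tau `^ (- (3 / 2)).
      rewrite -powRD ?(gt_eqF tau0) ?implybT //; congr (_ `^ _).
      by rewrite /x; lra.
    have -> : s `^ (- (N + 1)) = s `^ (- (n%:R / 2)) * s `^ (- (alpha1 + 1)) *
        s `^ (- (r * k)%:R - k%:R / 2).
      rewrite -!powRD ?(gt_eqF s0) ?implybT //; congr (_ `^ _); rewrite /N /x; lra.
    by rewrite /g powRM ?mulr_ge0 ?pi_ge0 //; ring.
  apply: ler_wpM2l.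
    apply: mulr_ge0 (expR_ge0 _); apply: mulr_ge0 (powR_ge0 _ _).
    by apply: mulr_ge0 mh0; apply: mulr_ge0 g0 W0.
  apply: ler_pM; [exact: tl0|exact: expR_ge0| |].
    apply: ler_pM; [exact: powR_ge0|exact: expR_ge0| |].
      rewrite !powRN lef_pV2 ?posrE ?powR_gt0 ?mulr_gt0 //.
      apply: ge0_ler_powR => //; rewrite ?nnegrE ?(ltW tau0) ?mulr_ge0 //.
      by rewrite addr_ge0 // /x addr_ge0 // divr_ge0.
    rewrite ler_expR mulNr lerN2 -[leRHS]mul1r -mulrA mulrC.
    by rewrite -mulrA [leRHS]mulrC ler_pM2l ?invr_gt0 // mulrC ler_pdivrMr // mul1r.
  rewrite ler_expR !mulNr lerN2.
  rewrite (_ : B / (2 * n%:R) / s = B / (2 * (n%:R * s))); last by field; rewrite !gt_eqF.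
  apply: ler_wpM2l => //; rewrite lef_pV2 ?posrE ?mulr_gt0 //.
  by apply: ler_wpM2l => //; apply: ler_wpM2r => //; exact: ltW.
rewrite /marginal; set I := invgamma_int N S.
have I0 : (0 <= I)%E by exact: invgamma_int_ge0.
apply: (@le_trans _ _ (\int[mu]_(tau in `[n%:R, (2 * n%:R)%R]) (Kc%:E * I))%E).
  rewrite integral_cst /=; last exact: measurable_itv.
  rewrite lebesgue_measure_itv /= lte_fin ifT; last by rewrite ltr_pMl // ltr1n.
  rewrite -EFinB (_ : 2 * n%:R - n%:R = n%:R); last by ring.
  by rewrite muleAC -EFinM /Kc !mulrA.
apply: le_integral_nonneg.
- move=> tau; rewrite /= !in_itv /= andbT => /andP[h1 _].
  exact: lt_le_trans h1.
- by move=> tau _; apply: mule_ge0; rewrite ?lee_fin.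
- move=> tau _; apply: integral_ge0 => s _; apply: integral_cV_ge0 => b.
  by rewrite lee_fin marginal_integrand_ge0.
move=> tau; rewrite /= in_itv /= => taun.
rewrite /I /invgamma_int -integralZl_EFin_nonneg; last 4 first.
- exact: Kc0.
- exact: measurable_itv.
- exact: mh2.
- by move=> s _; exact: h20.
apply: le_integral_nonneg; [by []|move=> s _|move=> s _|move=> s].
- by rewrite lee_fin; exact: mulr_ge0 Kc0 (h20 s).
- by apply: integral_cV_ge0 => b; rewrite lee_fin marginal_integrand_ge0.
by rewrite /= in_itv /= andbT; exact: key.
Qed.

End MarginalLower.

(** * Measurability of the posterior *)

Section MeasurableMarginal.
Context {R : realType}.
Notation mu := (@lebesgue_measure R).

Lemma measurable_integral_param d (S : measurableType d) (D : set R)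
    (f : S * measurableTypeR R -> \bar R) : measurable D ->
  measurable_fun setT f -> (forall z, 0 <= f z)%E ->
  measurable_fun setT (fun s => \int[mu]_(x in D) f (s, x))%E.
Proof.
move=> mD mf f0.
pose g (z : S * measurableTypeR R) := (f z * (\1_D z.2)%:E)%E.
have g0 z : (0 <= g z)%E by rewrite mule_ge0 // lee_fin.
have mg : measurable_fun setT g.
  apply: emeasurable_funM => //; apply/measurable_EFinP.
  have m1 : measurable_fun setT (\1_D : measurableTypeR R -> R).
    exact: measurable_indic.
  exact: (measurableT_comp m1 measurable_snd).
rewrite (_ : (fun s => _) = fubini_F mu g).
  exact: (@measurable_fun_fubini_tonelli_F _ _ _ _ _ mu g mg g0).
apply/funext => s; rewrite /fubini_F [LHS]integral_mkcond; congr (integral _ _ _); apply/funext => x.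
by rewrite /g patchE indicE /=; case: ifPn => _; rewrite ?mule1 ?mule0.
Qed.

(* Joint measurability is tested along all measurable families of points; this
   avoids putting a measurable structure on the space of column vectors. *)
Definition jointly_measurable k d (S : measurableType d)
    (F : S -> 'cV[R]_k -> \bar R) :=
  forall d' (S' : measurableType d') (g : S' -> S) (b : S' -> 'cV[R]_k),
    measurable_fun setT g ->
    (forall i, measurable_fun setT (fun s => b s i 0)) ->
    measurable_fun setT (fun s => F (g s) (b s)).

(** The first coordinate is moved into the parameter space, so the induction is over all parameter
    spaces at once; Tonelli then integrates it out. *)
Lemma measurable_integral_cV k d (S : measurableType d)
    (F : S -> 'cV[R]_k -> \bar R) :
  (forall s b, 0 <= F s b)%E -> jointly_measurable F ->
  measurable_fun setT (fun s => integral_cV (F s)).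
Proof.
elim: k d S F => [|k IH] d S F F0 mF.
  by apply: (mF _ _ id (fun=> 0)) => // -[].
pose F' (z : S * measurableTypeR R) (b : 'cV[R]_k) :=
  F z.1 (col_mx (z.2%:M : 'cV_1) b).
apply: (@measurable_integral_param _ _ setT (fun z => integral_cV (F' z))) => //.
  apply: IH => [z b|d' S' g b mg mb]; first exact: F0.
  apply: (mF _ _ (fun s => (g s).1) (fun s => col_mx ((g s).2%:M : 'cV_1) (b s))).
    exact: measurableT_comp measurable_fst mg.
  move=> i; case: (split_ordP (i : 'I_(1 + k))) => j ->.
    rewrite (_ : (fun s => _) = (fun s => (g s).2)).
      exact: measurableT_comp measurable_snd mg.
    apply/funext => s; rewrite (col_mxEu ((g s).2%:M : 'cV_1) (b s)).
    by rewrite mxE ord1 eqxx mulr1n.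
  rewrite (_ : (fun s => _) = (fun s => b s j 0)) //.
  by apply/funext => s; rewrite (col_mxEd ((g s).2%:M : 'cV_1) (b s)).
by move=> z; apply: integral_cV_ge0 => b; exact: F0.
Qed.

Lemma measurable_marginal_integrand r (alpha1 alpha2 : R) n k (X : 'M[R]_(n, k))
    (A : 'M[R]_k) d (S : measurableType d) (y : S -> 'cV[R]_n)
    (tau s2 : S -> R) (b : S -> 'cV[R]_k) :
  (forall i, measurable_fun setT (fun s => y s i 0)) ->
  measurable_fun setT tau -> measurable_fun setT s2 ->
  (forall i, measurable_fun setT (fun s => b s i 0)) ->
  measurable_fun setT (fun s => gaussian_pdf (X *m b s) (s2 s) (y s) *
    pmom_pdf r A (tau s) (s2 s) (b s) * tau_pdf n (tau s) *
    invgamma_pdf alpha1 alpha2 (s2 s)).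
Proof.
move=> my mtau ms2 mb.
have mP (f : S -> R) a : measurable_fun setT f -> measurable_fun setT (fun s => f s `^ a).
  by move=> mf; apply: (measurableT_comp (measurable_powR a)).
have mE (f : S -> R) : measurable_fun setT f -> measurable_fun setT (fun s => expR (f s)).
  by move=> mf; apply: (measurableT_comp (@measurable_expR R)).
have mD (f g : S -> R) : measurable_fun setT f -> measurable_fun setT g ->
    measurable_fun setT (fun s => f s / g s).
  by move=> mf mg; apply: measurable_funM => //; exact: measurable_funV.
apply: measurable_funM; last first.
  apply: measurable_funM; first by apply: measurable_funM => //; exact: mP.
  by apply: mE; apply: mD.
apply: measurable_funM; last first.
  apply: measurable_funM; first by apply: measurable_funM => //; exact: mP.
  by apply: mE; apply: mD => //; apply: measurable_funM.
have mXb i : measurable_fun setT (fun s => (X *m b s) i 0).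
  under eq_fun do rewrite mxE.
  by apply: measurable_sum => j; apply: measurable_funM.
apply: measurable_funM.
  apply: measurable_funM; first by apply: mP; apply: measurable_funM.
  apply: mE; apply: mD; last exact: measurable_funM.
  apply: measurableT_comp => //; apply: measurable_sum => i.
  by apply: measurable_funX; apply: measurable_funB.
apply: measurable_funM => //; apply: measurable_funM.
  apply: measurable_funM.
    apply: measurable_funM => //; apply: measurable_funM => //.
    by apply: mP; apply: measurable_funM.
  apply: mE; apply: mD; last by apply: measurable_funM => //; apply: measurable_funM.
  apply: measurableT_comp => //.
  rewrite (_ : (fun s => _) = (fun s =>
      \sum_j (\sum_i b s i 0 * A i j) * b s j 0)); last first.
    apply/funext => s; rewrite mxE; apply: eq_bigr => j _; congr (_ * _).
    by rewrite mxE; apply: eq_bigr => i _; rewrite mxE.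
  apply: measurable_sum => i; apply: measurable_funM => //.
  by apply: measurable_sum => j; apply: measurable_funM.
by apply: measurable_prod => i _; apply: measurable_funX.
Qed.

Lemma measurable_marginal r (alpha1 alpha2 : R) n k (X : 'M[R]_(n, k))
    (A : 'M[R]_k) d (S : measurableType d) (y : S -> 'cV[R]_n) :
  (forall i, measurable_fun setT (fun s => y s i 0)) ->
  measurable_fun setT (fun s => marginal r alpha1 alpha2 X A (y s)).
Proof.
move=> my.
pose G (z : S * measurableTypeR R * measurableTypeR R) (b : 'cV[R]_k) :=
  (gaussian_pdf (X *m b) z.2 (y z.1.1) * pmom_pdf r A z.1.2 z.2 b *
   tau_pdf n z.1.2 * invgamma_pdf alpha1 alpha2 z.2)%:E.
have G0 z b : (0 <= G z b)%E by rewrite lee_fin marginal_integrand_ge0.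
have mG : measurable_fun setT (fun z => integral_cV (G z)).
  apply: measurable_integral_cV => // d' S' g b mg mb.
  apply/measurable_EFinP.
  apply: (@measurable_marginal_integrand r alpha1 alpha2 n k X A _ S'
    (fun s => y (g s).1.1) (fun s => (g s).1.2) (fun s => (g s).2) b) => //.
  - move=> i; apply: (measurableT_comp (my i)).
    by apply: (measurableT_comp measurable_fst); apply: (measurableT_comp measurable_fst).
  - by apply: (measurableT_comp measurable_snd); apply: (measurableT_comp measurable_fst).
  - by apply: (measurableT_comp measurable_snd).
have I0 z : (0 <= integral_cV (G z))%E by exact: integral_cV_ge0.
have m1 := @measurable_integral_param _ _ `]0, +oo[%classic _ (measurable_itv _) mG I0.
apply: (@measurable_integral_param _ _ `]0, +oo[%classic _ (measurable_itv _) m1).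
by move=> z; apply: integral_ge0.
Qed.

End MeasurableMarginal.

Section MeasurablePosterior.
Context {R : realType}.

Lemma measurable_bigmaxr d (S : measurableType d) (I : Type) (s : seq I)
    (Q : pred I) (h : I -> S -> R) :
  (forall i, measurable_fun setT (h i)) ->
  measurable_fun setT (fun x => \big[Num.max/0]_(i <- s | Q i) h i x).
Proof.
move=> mh; elim: s => [|i s IH].
  by under eq_fun do rewrite big_nil; exact: measurable_cst.
under eq_fun do rewrite big_cons; case: (Q i) => //.
exact: measurable_maxr.
Qed.

Lemma measurable_max_posterior_ratio r (alpha1 alpha2 c1 c2 : R) q n p
    (X : 'M[R]_(n, p)) (A : 'M[R]_p) (t : {set 'I_p}) d (S : measurableType d)
    (y : S -> 'cV[R]_n) :
  (forall i, measurable_fun setT (fun s => y s i 0)) ->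
  measurable_fun setT (fun s =>
    max_posterior_ratio r alpha1 alpha2 c1 c2 q X A t (y s)).
Proof.
move=> my.
have mj k : measurable_fun setT (fun s => joint_mass r alpha1 alpha2 c1 c2 q X A (y s) k).
  apply: measurable_funM => //.
  apply: (measurableT_comp (fine_measurable measurableT)).
  exact: measurable_marginal.
have mp k : measurable_fun setT (fun s => posterior r alpha1 alpha2 c1 c2 q X A (y s) k).
  apply: measurable_funM => //; apply: measurable_funV.
  exact: measurable_sum.
apply: measurable_bigmaxr => k.
by apply: measurable_funM => //; exact: measurable_funV.
Qed.

End MeasurablePosterior.

(** * Gaussian noise *)

Section Independence.
Context {R : realType}.
Notation mu := (@lebesgue_measure R).

Lemma integral_indic_itvoo (c : R) : 0 <= c ->
  (\int[mu]_t (\1_(`]0, c[%classic) t)%:E = c%:E)%E.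
Proof.
move=> c0; rewrite integral_indic //= setIT lebesgue_measure_itv /= lte_fin.
case: ifPn => [_|]; first by rewrite oppr0 adde0.
by rewrite -leNgt => h; congr EFin; apply/eqP; rewrite eq_le h c0.
Qed.

(* Layer-cake formula: it suffices to test on indicator functions. *)
Lemma integral_factor d (S : measurableType d)
    (P : {sigma_finite_measure set S -> \bar R})
    (N : {sigma_finite_measure set (measurableTypeR R) -> \bar R})
    (X : S -> R) (g : S -> R) (K : R) (f : R -> R) :
  measurable_fun setT X -> measurable_fun setT g -> (forall w, 0 <= g w) -> 0 <= K ->
  (forall B, measurable B ->
     (\int[P]_w (\1_B (X w) * g w)%:E = K%:E * N B)%E) ->
  measurable_fun setT f -> (forall x, 0 <= f x) ->
  (\int[P]_w (f (X w) * g w)%:E = K%:E * \int[N]_x (f x)%:E)%E.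
Proof.
move=> mX mg g0 K0 ind mf f0.
(* With [0 < t] built into the superlevel sets, the integral over the level [t] may run over the
   whole line. *)
pose B (t : R) := [set x : R | 0 < t < f x].
have mB t : measurable (B t).
  have [t0|t0] := ltP 0 t; last first.
    rewrite (_ : B t = set0); first exact: measurable0.
    by apply/seteqP; split => // x; rewrite /B /= ltNge t0.
  rewrite (_ : B t = f @^-1` `]t, +oo[).
    by rewrite -[X in measurable X]setTI; apply: mf => //; exact: measurable_itv.
  by apply/seteqP; split => x; rewrite /B /= in_itv /= andbT t0.
have E1 (c t : R) : (\1_(`]0, c[%classic) t : R) = (0 < t < c)%R%:R.
  by rewrite indicE; congr (nat_of_bool _)%:R; apply/idP/idP; rewrite ?inE /= in_itv.
have mlt d' (S' : measurableType d') (F G : S' -> R) : measurable_fun setT F ->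
    measurable_fun setT G -> measurable_fun setT (fun z => (0 < G z < F z)%R%:R : R).
  move=> mF mG.
  rewrite (_ : (fun z => _) = (fun z => \1_[set true] (0 < G z < F z))).
    apply: (measurableT_comp (@measurable_indic _ _ R setT [set true] _)) => //.
    by apply: measurable_and => //; exact: measurable_fun_ltr.
  apply/funext => z; rewrite indicE; congr (nat_of_bool _)%:R.
  by case: (0 < G z < F z); [rewrite mem_set|rewrite memNset].
(* Used on both sides of the claim: with [X] and [g] under [P], and with the identity and the
   constant [K] under [N]. *)
have slice d' (S' : measurableType d') (Q : {sigma_finite_measure set S' -> \bar R})
    (Y : S' -> R) (h : S' -> R) : measurable_fun setT Y -> measurable_fun setT h ->
    (forall w, 0 <= h w) ->
    (\int[Q]_w (f (Y w) * h w)%:E =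
     \int[mu]_t \int[Q]_w (\1_(B t) (Y w) * h w)%:E)%E.
  move=> mY mh h0.
  pose F (z : S' * measurableTypeR R) : \bar R := ((0 < z.2 < f (Y z.1))%R%:R * h z.1)%:E.
  have mF : measurable_fun setT F.
    apply/measurable_EFinP; apply: measurable_funM; last first.
      exact: measurableT_comp mh measurable_fst.
    apply: mlt; last exact: measurable_snd.
    apply: (measurableT_comp mf); exact: measurableT_comp mY measurable_fst.
  have F0 z : (0 <= F z)%E by rewrite lee_fin mulr_ge0.
  have := @fubini_tonelli _ _ _ _ _ Q mu F mF F0.
  rewrite /F /= => FT.
  transitivity (\int[Q]_x \int[mu]_y (((0 < y < f (Y x))%R%:R * h x)%:E))%E.
    apply: eq_integral => w _.
    transitivity (\int[mu]_t ((h w) * \1_(`]0, f (Y w)[%classic) t)%:E)%E.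
      rewrite integralZl_EFin_nonneg.
      - by rewrite integral_indic_itvoo // -EFinM mulrC.
      - exact: h0.
      - exact: measurableT.
      - exact: measurable_indic.
      - by [].
    by apply: eq_integral => t _; rewrite E1 mulrC.
  rewrite FT; apply: eq_integral => t _; apply: eq_integral => w _.
  congr ((_ * _)%:E); rewrite indicE; congr (nat_of_bool _)%:R.
  by apply/idP/idP; rewrite ?inE.
rewrite (slice _ _ P X g) //.
transitivity (\int[N]_x (f x * K)%:E)%E; last first.
  under eq_integral do rewrite mulrC.
  by rewrite integralZl_EFin_nonneg.
rewrite (slice _ _ N (fun x => x) (fun=> K)) //.
apply: eq_integral => t _; rewrite ind //.
under eq_integral do rewrite mulrC.
rewrite integralZl_EFin_nonneg.
- by rewrite integral_indic; [rewrite setIT|exact: measurableT|exact: mB].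
- exact: K0.
- exact: measurableT.
- by apply: measurable_indic; exact: mB.
- by [].
Qed.

Lemma integral_normal_prob (m s : R) (f : R -> R) :
  measurable_fun setT f -> (forall x, 0 <= f x) ->
  (\int[normal_prob m s]_x (f x)%:E = \int[mu]_x (f x * normal_pdf m s x)%:E)%E.
Proof.
move=> mf f0.
rewrite (@integral_factor _ _ mu (normal_prob m s) id (normal_pdf m s) 1) ?mul1e //.
- exact: measurable_normal_pdf.
- by move=> x; exact: normal_pdf_ge0.
move=> B mB; rewrite mul1e /normal_prob [RHS]integral_mkcond.
apply: eq_integral => x _; rewrite patchE indicE.
by case: ifPn => _; rewrite ?mul1r ?mul0r.
Qed.

Lemma EFin_prod (I : Type) (r : seq I) (Q : pred I) (F : I -> R) :
  (\prod_(i <- r | Q i) (F i)%:E = (\prod_(i <- r | Q i) F i)%:E)%E.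
Proof. by rewrite (big_morph EFin (id1 := 1%E) (op1 := *%E)). Qed.

Lemma prod_indic (I : finType) (S : Type) (X : I -> S -> R) (B : I -> set R) w :
  \prod_i (\1_(B i) (X i w) : R) =
  \1_(\bigcap_(i in [set` [set: I]%SET]) (X i @^-1` B i)) w.
Proof.
rewrite [RHS]indicE; case: (boolP (w \in _)) => h.
  rewrite big1 // => i _; rewrite indicE mem_set //.
  by rewrite inE in h; apply: h; rewrite /= inE.
have [i Bi] : exists i, ~ B i (X i w).
  apply: contrapT => /forallNP nB; case/negP: h; rewrite inE => i _.
  exact: contrapT (nB i).
by rewrite (bigD1 i) //= indicE memNset // mul0r.
Qed.

(** Independence is given for events only, which is the case of indicator functions. The induction
    lets the first [m] functions be arbitrary and the others indicators; [integral_factor] frees one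
    more function at each step. *)
Lemma expectation_prod d (S : measurableType d) (P : probability S R) n
    (e : 'I_n -> {RV P >-> R}) (s : R) (f : 'I_n -> R -> R) (M : 'I_n -> R) :
  iid_centered_normal e s ->
  (forall i, measurable_fun setT (f i)) -> (forall i x, 0 <= f i x) ->
  (forall i, \int[normal_prob 0 s]_x (f i x)%:E = (M i)%:E)%E ->
  (\int[P]_w (\prod_i f i (e i w))%:E = (\prod_i M i)%:E)%E.
Proof.
move=> [law indep].
suff main m : forall (f : 'I_n -> R -> R) (M : 'I_n -> R),
    (forall i, measurable_fun setT (f i)) -> (forall i x, 0 <= f i x) ->
    (forall i, \int[normal_prob 0 s]_x (f i x)%:E = (M i)%:E)%E ->
    (forall i : 'I_n, (m <= i)%N -> exists2 B, measurable B & f i = \1_B) ->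
    (\int[P]_w (\prod_i f i (e i w))%:E = (\prod_i M i)%:E)%E.
  move=> mf f0 fM; apply: (main n) => // i; rewrite leqNgt ltn_ord //.
elim: m => [|m IH] {}f {}M mf f0 fM fB.
  pose B i := s2val (cid2 (fB i isT)).
  have mB i : measurable (B i) by exact: (s2valP (cid2 (fB i isT))).
  have fE i : f i = \1_(B i) by exact: (s2valP' (cid2 (fB i isT))).
  have MB i : (M i)%:E = normal_prob 0 s (B i).
    by rewrite -fM fE integral_indic; [rewrite setIT|exact: measurableT|exact: mB].
  under eq_integral => w _.
    under eq_bigr do rewrite fE.
    rewrite (prod_indic (fun i => e i : S -> R) B w); over.
  rewrite integral_indic //; last first.
    apply: fin_bigcap_measurable => // i _.
    by rewrite -[X in measurable X]setTI; exact: measurable_funP.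
  rewrite setIT; have /= -> := indep [set: 'I_n]%SET B (fun i _ => mB i).
  rewrite -EFin_prod; apply: eq_big => [i|i _]; first by rewrite inE.
  by rewrite MB -(law i).
have [mn|nm] := ltnP m n; last first.
  by apply: IH => // i mi; have := leq_trans nm mi; rewrite leqNgt ltn_ord.
pose i0 := Ordinal mn.
pose g w := \prod_(i | i != i0) f i (e i w).
pose K := \prod_(i | i != i0) M i.
have M0 i : 0 <= M i.
  by rewrite -lee_fin -fM; apply: integral_ge0 => x _; rewrite lee_fin.
have mfe i : measurable_fun setT (fun w => f i (e i w)).
  exact: (measurableT_comp (mf i)).
have mg : measurable_fun setT g.
  rewrite /g; under eq_fun do rewrite big_mkcond.
  apply: measurable_prod => i _; case: (i != i0) => //.
have g0 w : 0 <= g w by apply: prodr_ge0.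
under eq_integral do rewrite (bigD1 i0) //= -/(g _).
rewrite (@integral_factor _ _ P (normal_prob 0 s) (e i0) g K) //.
- by rewrite fM -EFinM [in RHS](bigD1 i0) //= mulrC.
- exact: prodr_ge0.
move=> B mB.
have NB : normal_prob 0 s B = (fine (normal_prob 0 s B))%:E.
  by rewrite fineK // fin_num_measure.
pose f' i := if i == i0 then \1_B else f i.
pose M' i := if i == i0 then fine (normal_prob 0 s B) else M i.
have := IH f' M' _ _ _ _; rewrite [in RHS](bigD1 i0) //= {2}/M' eqxx.
rewrite (eq_bigr M); last by move=> i /negbTE; rewrite /M' => ->.
rewrite -/K mulrC EFinM -NB => <- //.
- apply: eq_integral => w _; congr EFin; rewrite (bigD1 i0) //= {1}/f' eqxx.
  by congr (_ * _); apply: eq_bigr => i /negbTE; rewrite /f' => ->.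
- by move=> i; rewrite /f'; case: eqP => // _; exact: measurable_indic.
- by move=> i x; rewrite /f'; case: eqP.
- move=> i; rewrite /f' /M'; case: eqP => // _; rewrite -NB.
  by rewrite integral_indic; [rewrite setIT|exact: measurableT|exact: mB].
- move=> i mi; rewrite /f'; case: eqP => [_|/eqP ii0]; first by exists B.
  apply: fB; rewrite ltn_neqAle mi andbT; apply: contra ii0 => /eqP im.
  by apply/eqP/val_inj.
Qed.

End Independence.

(** * Gaussian generating functions and chi-square tails *)

Section ChiSquare.
Context {R : realType}.
Notation mu := (@lebesgue_measure R).

Lemma normal_peakE (s : R) : 0 < s -> normal_peak s = (Num.sqrt (2 * pi) * s)^-1.
Proof.
move=> s0; rewrite /normal_peak; congr (_^-1).
rewrite -mulr_natr -mulrA sqrtrM ?sqr_ge0 // sqrtr_sqr gtr0_norm // mulrC.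
by rewrite (mulrC pi).
Qed.

(** Common core of the two generating functions: the last hypothesis is the completed square. *)
Lemma integral_normal_quad (s : R) (f : R -> R) (c m K : R) : 0 < s -> 0 < c ->
  measurable_fun setT f -> (forall x, 0 <= f x) -> 0 <= K ->
  (forall x, f x * expR (- (x ^+ 2 / (2 * s ^+ 2))) =
             K * expR (- (c * (x - m) ^+ 2) / 2)) ->
  (\int[normal_prob 0 s]_x (f x)%:E = (K * (c * s ^+ 2) `^ (- 2^-1))%:E)%E.
Proof.
move=> s0 c0 mf f0 K0 fE; rewrite integral_normal_prob //.
have sN0 : s != 0 by rewrite gt_eqF.
have pk := normal_peakE s0; have pk0 := normal_peak_gt0 sN0.
under eq_integral => x _.
  rewrite normal_pdfE // /normal_fun subr0 -mulr_natl mulNr mulrCA fE mulrA.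
  over.
rewrite integralZl_EFin_nonneg.
- rewrite integral_gaussian // -EFinM; congr EFin; rewrite pk.
  have q0 : 0 < Num.sqrt (2 * pi) :> R by rewrite sqrtr_gt0 mulr_gt0 ?pi_gt0.
  have -> : (c * s ^+ 2) `^ (- 2^-1) = c `^ (- 2^-1) / s.
    rewrite powRM ?sqr_ge0 ?(ltW c0) //; congr (_ * _).
    by rewrite powRN powR12_sqrt ?sqr_ge0 // sqrtr_sqr gtr0_norm.
  by field; rewrite !gt_eqF.
- by rewrite mulr_ge0 // ltW.
- exact: measurableT.
- apply: measurableT_comp => //; apply: measurable_funM => //.
  apply: measurableT_comp => //; apply: measurable_funM => //.
  by apply: measurable_funX; apply: measurable_funB.
- by move=> x _; exact: expR_ge0.
Qed.

Lemma normal_mgf (s w : R) : 0 < s ->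
  (\int[normal_prob 0 s]_x (expR (w * x))%:E = (expR (s ^+ 2 * w ^+ 2 / 2))%:E)%E.
Proof.
move=> s0; have s20 : 0 < s ^+ 2 by rewrite exprn_gt0.
rewrite (@integral_normal_quad s _ (s ^- 2) (s ^+ 2 * w) (expR (s ^+ 2 * w ^+ 2 / 2))) //.
- by rewrite mulVf ?gt_eqF // powR1 mulr1.
- by rewrite invr_gt0.
- by apply: measurableT_comp => //; exact: measurable_funM.
by move=> x; rewrite -!expRD; congr expR; field; rewrite gt_eqF.
Qed.

Lemma normal_sqr_mgf (s a : R) : 0 < s -> a * s ^+ 2 < 1 ->
  (\int[normal_prob 0 s]_x (expR (a / 2 * x ^+ 2))%:E =
   ((1 - a * s ^+ 2) `^ (- 2^-1))%:E)%E.
Proof.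
move=> s0 a1; have s20 : 0 < s ^+ 2 by rewrite exprn_gt0.
rewrite (@integral_normal_quad s _ (s ^- 2 - a) 0 1) //.
- by rewrite mul1r mulrBl mulVf ?gt_eqF.
- by rewrite subr_gt0 -[ltRHS]mul1r ltr_pdivlMr.
- by apply: measurableT_comp => //; apply: measurable_funM => //; exact: measurable_funX.
by move=> x; rewrite mul1r -!expRD; congr expR; field; rewrite gt_eqF.
Qed.

Section Noise.
Context d (S : measurableType d) (P : probability S R) (n : nat)
  (e : 'I_n -> {RV P >-> R}) (s : R).
Hypothesis s0 : 0 < s.
Hypothesis e_iid : iid_centered_normal e s.

Definition noise_vec (w : S) : 'cV[R]_n := \col_i e i w.

Lemma measurable_dotv_noise (u : 'cV[R]_n) :
  measurable_fun setT (fun w => dotv (noise_vec w) u).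
Proof.
rewrite /dotv; under eq_fun do under eq_bigr do rewrite mxE.
by apply: measurable_sum => i; apply: measurable_funM.
Qed.

Lemma expectation_linear_exp (u : 'cV[R]_n) :
  (\int[P]_w (expR (dotv (noise_vec w) u))%:E = (expR (s ^+ 2 * sqnorm u / 2))%:E)%E.
Proof.
rewrite (_ : expR _ = \prod_i expR (s ^+ 2 * u i 0 ^+ 2 / 2)); last first.
  by rewrite -expR_sum mulr_sumr mulr_suml.
rewrite -(@expectation_prod R _ S P n e s (fun i x => expR (u i 0 * x))) //.
- apply: eq_integral => w _; congr EFin; rewrite -expR_sum; congr expR.
  by apply: eq_bigr => i _; rewrite mxE mulrC.
- by move=> i; apply: measurableT_comp => //; exact: measurable_funM.
- by move=> i; exact: normal_mgf.
Qed.

Lemma expectation_energy_exp (a : R) : a * s ^+ 2 < 1 ->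
  (\int[P]_w (expR (a / 2 * sqnorm (noise_vec w)))%:E =
   ((1 - a * s ^+ 2) `^ (- 2^-1) ^+ n)%:E)%E.
Proof.
move=> a1.
rewrite (_ : _ ^+ n = \prod_(i < n) (1 - a * s ^+ 2) `^ (- 2^-1)); last first.
  by rewrite prodr_const card_ord.
rewrite -(@expectation_prod R _ S P n e s (fun i x => expR (a / 2 * x ^+ 2))) //.
- apply: eq_integral => w _; congr EFin; rewrite -expR_sum mulr_sumr; congr expR.
  by apply: eq_bigr => i _; rewrite mxE.
- by move=> i; apply: measurableT_comp => //; apply: measurable_funM => //; exact: measurable_funX.
- by move=> i; exact: normal_sqr_mgf.
Qed.

(* Induction on the orthonormal family, writing [exp (a z ^ 2 / 2)] as a Gaussian
   mixture of the functions [exp (v z)]. *)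
Lemma chi_square_mgf (a : R) (bs : seq 'cV[R]_n) (u : 'cV[R]_n) :
  0 < a -> a * s ^+ 2 < 1 -> orthonormal bs ->
  (forall b, b \in bs -> dotv u b = 0) ->
  (\int[P]_w (expR (dotv (noise_vec w) u +
      a / 2 * \sum_(b <- bs) dotv (noise_vec w) b ^+ 2))%:E =
   (expR (s ^+ 2 * sqnorm u / 2) * (1 - a * s ^+ 2) `^ (- 2^-1) ^+ size bs)%:E)%E.
Proof.
move=> a0 a1; have s20 : 0 < s ^+ 2 by rewrite exprn_gt0.
have a20 : 0 < a^-1 by rewrite invr_gt0.
pose q := Num.sqrt (2 * pi) : R.
have q0 : 0 < q by rewrite sqrtr_gt0 mulr_gt0 ?pi_gt0.
set r := (1 - a * s ^+ 2) `^ (- 2^-1).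
pose c := a^-1 - s ^+ 2.
have c0 : 0 < c by rewrite subr_gt0 -[ltRHS]mul1r ltr_pdivlMr // mulrC.
elim: bs u => [|b bs IH] u.
  move=> _ _; rewrite expr0 mulr1 -(expectation_linear_exp u).
  by apply: eq_integral => w _; rewrite big_nil mulr0 addr0.
move=> /= [b1 bbs bso] ub.
pose rest w := a / 2 * \sum_(b <- bs) dotv (noise_vec w) b ^+ 2.
pose z w := dotv (noise_vec w) b.
(* [C] normalizes the density of N(0, a), the law of the mixing variable. *)
pose C := (q * a^-1 `^ (- 2^-1))^-1.
have ap : 0 < a^-1 `^ (- 2^-1) by exact: powR_gt0.
have C0 : 0 < C by rewrite invr_gt0 mulr_gt0.
pose F (t : S * measurableTypeR R) : \bar R := (C * expR (- t.2 ^+ 2 / (2 * a) +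
   (dotv (noise_vec t.1) u + t.2 * z t.1 + rest t.1)))%:E.
have mrest : measurable_fun setT rest.
  apply: measurable_funM => //; apply: measurable_sum => b'.
  by apply: measurable_funX; exact: measurable_dotv_noise.
have m1 (f : S -> R) : measurable_fun setT f ->
   measurable_fun setT (fun t : S * measurableTypeR R => f t.1).
  by move=> mf; exact: (measurableT_comp mf measurable_fst).
have m2 : measurable_fun setT (fun t : S * measurableTypeR R => t.2 : R).
  exact: measurable_snd.
have mF : measurable_fun setT F.
  apply/measurable_EFinP; apply: measurable_funM => //; apply: measurableT_comp => //.
  apply: measurable_funD.
    apply: measurable_funM => //; apply: measurableT_comp => //.
    exact: measurable_funX.
  apply: measurable_funD; last exact: m1.
  apply: measurable_funD; first exact: m1 (measurable_dotv_noise _).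
  by apply: measurable_funM => //; exact: m1 (measurable_dotv_noise _).
have F0 t : (0 <= F t)%E by rewrite lee_fin mulr_ge0 ?expR_ge0 // ltW.
have FT := @fubini_tonelli _ _ _ _ _ P mu F mF F0.
transitivity (\int[P]_w \int[mu]_v F (w, v))%E.
  apply: eq_integral => w _; rewrite /F /=.
  pose K := C * expR (dotv (noise_vec w) u + rest w + a / 2 * z w ^+ 2).
  transitivity (\int[mu]_v (K * expR (- (a^-1 * (v - a * z w) ^+ 2) / 2))%:E)%E.
    rewrite integralZl_EFin_nonneg.
    - rewrite integral_gaussian // -EFinM; congr EFin; rewrite /K /C big_cons -/(z w).
      rewrite mulrDr -/(rest w).
      set X := expR _; set Y := expR _; have -> : X = Y by congr expR; ring.
      by rewrite -/q; field; rewrite !gt_eqF.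
    - by rewrite mulr_ge0 ?expR_ge0 // ltW.
    - exact: measurableT.
    - apply: measurableT_comp => //; apply: measurable_funM => //.
      apply: measurableT_comp => //; apply: measurable_funM => //.
      by apply: measurable_funX; apply: measurable_funB.
    - by move=> v _; exact: expR_ge0.
  apply: eq_integral => v _; congr EFin; rewrite /K -mulrA -expRD; congr (_ * expR _).
  by field; rewrite gt_eqF.
rewrite FT.
pose K := C * (expR (s ^+ 2 * sqnorm u / 2) * r ^+ size bs).
have K0 : 0 <= K.
  by rewrite mulr_ge0 ?(ltW C0) // mulr_ge0 ?expR_ge0 // exprn_ge0 // powR_ge0.
transitivity (\int[mu]_v (K * expR (- (c * (v - 0) ^+ 2) / 2))%:E)%E.
  apply: eq_integral => v _.
  (* The reason for carrying [u] in the statement: tilting by [v *: b] preserves orthogonality to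
     the remaining vectors and adds exactly [v^2] to the squared norm. *)
  have ort b' : b' \in bs -> dotv (u + v *: b) b' = 0.
    move=> b'b; rewrite dotvDl dotvZl bbs // ub ?mulr0 ?addr0 //.
    by rewrite inE b'b orbT.
  have := IH (u + v *: b) bso ort.
  have -> : sqnorm (u + v *: b) = sqnorm u + v ^+ 2.
    by rewrite sqnormD sqnormZ dotvZr ub ?mem_head // b1; ring.
  move=> IHv; pose D := C * expR (- v ^+ 2 / (2 * a)).
  transitivity (\int[P]_w (D * expR (dotv (noise_vec w) (u + v *: b) + rest w))%:E)%E.
    apply: eq_integral => w _; congr EFin; rewrite /D -mulrA -expRD.
    by rewrite dotvDr dotvZr.
  rewrite integralZl_EFin_nonneg.
  - rewrite IHv -EFinM; congr EFin; rewrite /D /K /c.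
    set e1 := expR _; set e2 := expR _; set e3 := expR _; set e4 := expR _.
    suff e12 : e1 * e2 = e3 * e4.
      transitivity (C * (e1 * e2) * r ^+ size bs); first by ring.
      by rewrite e12; ring.
    by rewrite -!expRD; congr expR; field; rewrite gt_eqF.
  - by rewrite mulr_ge0 ?expR_ge0 // ltW.
  - exact: measurableT.
  - apply: measurableT_comp => //; apply: measurable_funD => //.
    exact: measurable_dotv_noise.
  - by move=> w _; exact: expR_ge0.
rewrite integralZl_EFin_nonneg.
- rewrite integral_gaussian // -EFinM; congr EFin; rewrite /K /C -/q (exprS r (size bs)).
  set rn := r ^+ size bs; have -> : r = c `^ (- 2^-1) / a^-1 `^ (- 2^-1).
    rewrite /r (_ : 1 - a * s ^+ 2 = c * a); last by rewrite /c mulrBl mulVf ?gt_eqF // mulrC.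
    rewrite powRM ?(ltW a0) ?(ltW c0) //; congr (_ * _).
    by rewrite powR_inv ?(ltW a0) // opprK powRN.
  by field; rewrite !gt_eqF.
- exact: K0.
- exact: measurableT.
- apply: measurableT_comp => //; apply: measurable_funM => //.
  apply: measurableT_comp => //; apply: measurable_funM => //.
  by apply: measurable_funX; apply: measurable_funB.
- by move=> v _; exact: expR_ge0.
Qed.

Lemma exp_markov (f : S -> R) (M : R) : measurable_fun setT f ->
  (\int[P]_w (expR (f w))%:E <= M%:E)%E ->
  (P [set w | (0 <= f w)%R] <= M%:E)%E.
Proof.
move=> mf fM; apply: le_trans fM.
have mB : measurable [set w | 0 <= f w].
  rewrite (_ : [set w | _] = f @^-1` `[0, +oo[).
    by rewrite -[X in measurable X]setTI; apply: mf => //; exact: measurable_itv.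
  by apply/seteqP; split => w; rewrite /= in_itv /= andbT.
rewrite -[X in (P X <= _)%E]setIT -integral_indic //.
apply: le_integral_nonneg; [by []|by []|by move=> w _; rewrite lee_fin expR_ge0|].
move=> w _; rewrite lee_fin indicE; case: (boolP (w \in _)) => [|_]; last exact: expR_ge0.
by rewrite inE /= => h; rewrite -expR0 ler_expR.
Qed.

Lemma chi_square_tail (a Q : R) (bs : seq 'cV[R]_n) :
  0 < a -> a * s ^+ 2 < 1 -> orthonormal bs ->
  (P [set w | (Q <= \sum_(b <- bs) dotv (noise_vec w) b ^+ 2)%R] <=
   (expR (- (a / 2 * Q)) * (1 - a * s ^+ 2) `^ (- 2^-1) ^+ size bs)%:E)%E.
Proof.
move=> a0 a1 bso.
have mS : measurable_fun setT (fun w => \sum_(b <- bs) dotv (noise_vec w) b ^+ 2).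
  apply: measurable_sum => b'.
  by apply: measurable_funX; exact: measurable_dotv_noise.
rewrite (_ : [set w | _] = [set w | 0 <= a / 2 * \sum_(b <- bs) dotv (noise_vec w) b ^+ 2
    - a / 2 * Q]); last first.
  by apply/seteqP; split => w /=; rewrite subr_ge0 ler_pM2l ?divr_gt0.
apply: exp_markov.
  by apply: measurable_funB => //; exact: measurable_funM.
under eq_integral => w _ do rewrite addrC expRD.
rewrite integralZl_EFin_nonneg.
- have := @chi_square_mgf a bs 0 a0 a1 bso _.
  have -> : sqnorm (0 : 'cV[R]_n) = 0 by rewrite /sqnorm big1 // => i _; rewrite mxE expr0n.
  rewrite mulr0 mul0r expR0 mul1r EFinM => <-.
    rewrite le_eqVlt; apply/orP; left; apply/eqP; congr (_ * _)%E.
    apply: eq_integral => w _; rewrite (_ : dotv _ 0 = 0) ?add0r //.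
    by rewrite /dotv big1 // => i _; rewrite !mxE mulr0.
  by move=> b _; rewrite /dotv big1 // => i _; rewrite mxE mul0r.
- exact: expR_ge0.
- exact: measurableT.
- by apply: measurableT_comp => //; exact: measurable_funM.
- by move=> w _; exact: expR_ge0.
Qed.

End Noise.
End ChiSquare.

(** * Comparison of a model with the true one *)

Section ModelBounds.
Context {R : realType}.
Context (r n p : nat) (X : 'M[R]_(n, p)) (A : 'M[R]_p) (t : {set 'I_p})
  (bet : 'cV[R]_p) (e : 'cV[R]_n).
Hypothesis r0 : (0 < r)%N.
Hypothesis n0 : (0 < n)%N.
Hypothesis bet_t : supported t bet.

Lemma sumsq_dotv (u v : 'cV[R]_n) : \sum_i (u i 0 - v i 0) ^+ 2 = sqnorm (u - v).
Proof. by apply: eq_bigr => i _; rewrite !mxE. Qed.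

Lemma cV_subE m (u v : 'cV[R]_m) i : (u - v) i 0 = u i 0 - v i 0.
Proof. by rewrite !mxE. Qed.

Lemma sqnormB (u v : 'cV[R]_n) : sqnorm (u - v) = sqnorm u - 2 * dotv u v + sqnorm v.
Proof.
by rewrite -scaleN1r sqnormD sqnormZ dotvZr; ring.
Qed.

(** Expand [|e - X d|^2] with [d = b - beta0]. The cross term is at most
    [Q / (1 - th) + (1 - th) |X d|^2], which leaves [th |X d|^2]. On [t] minus [k] the coordinates
    of [d] are those of [- beta0], which yields the signal term; [bm] bounds squares here. *)
Lemma residual_lower (k : {set 'I_p}) (eps th Q bm : R) (b : 'cV[R]_#|k|) :
  0 < eps -> 0 < th < 1 -> 0 <= Q ->
  (forall i, i \in t -> bm <= bet i 0 ^+ 2) ->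
  (forall d, supported (t :|: k) d -> n%:R * eps * sqnorm d <= sqnorm (X *m d)) ->
  (forall d, supported (t :|: k) d -> dotv e (X *m d) ^+ 2 <= Q * sqnorm (X *m d)) ->
  sqnorm e - Q / (1 - th) + th * n%:R * eps * bm * #|t :\: k|%:R +
    2 * (th * n%:R * eps / 2) * (\sum_i (b i 0 - bet (enum_val i) 0) ^+ 2) <=
  \sum_i ((X *m bet + e) i 0 - (model_cols X k *m b) i 0) ^+ 2.
Proof.
move=> e0 /andP[th0 th1] Q0 tbm gram dotQ.
pose d := extend b - bet.
have dk : supported (t :|: k) d.
  move=> i; rewrite finset.in_setU negb_or => /andP[it ik].
  by rewrite cV_subE bet_t // subr0 extend_notin.
have -> : \sum_i ((X *m bet + e) i 0 - (model_cols X k *m b) i 0) ^+ 2 =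
    sqnorm (e - X *m d).
  rewrite sumsq_dotv; congr sqnorm.
  by rewrite mulmx_extend /d mulmxBr opprB (addrC (X *m bet)) -addrA.
rewrite sqnormB.
set G := sqnorm (X *m d); set D := dotv e (X *m d).
have DQ : D ^+ 2 <= Q * G by exact: dotQ.
have gd : n%:R * eps * sqnorm d <= G by exact: gram.
have th10 : 0 < 1 - th by rewrite subr_gt0.
have amgm : 2 * D <= Q / (1 - th) + (1 - th) * G.
  have G0 : 0 <= G by exact: sqnorm_ge0.
  have h : (2 * D) ^+ 2 <= (Q / (1 - th) + (1 - th) * G) ^+ 2.
    have E : (Q / (1 - th) + (1 - th) * G) ^+ 2 - 4 * (Q * G) =
        (Q / (1 - th) - (1 - th) * G) ^+ 2 by field; rewrite gt_eqF.
    rewrite exprMn; have := sqr_ge0 (Q / (1 - th) - (1 - th) * G).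
    by rewrite -E; lra.
  have P0 : 0 <= Q / (1 - th) + (1 - th) * G.
    by rewrite addr_ge0 ?divr_ge0 ?mulr_ge0 // ltW.
  rewrite leNgt; apply/negP => h'; have : (Q / (1 - th) + (1 - th) * G) ^+ 2 < (2 * D) ^+ 2.
    by rewrite ltrXn2r // nnegrE (le_trans P0) // ltW.
  by rewrite ltNge h.
have dE : \sum_i (b i 0 - bet (enum_val i) 0) ^+ 2 + bm * #|t :\: k|%:R <= sqnorm d.
  rewrite /sqnorm (bigID (mem k)) /=; apply: lerD.
    rewrite [leRHS]big_enum_val; apply: ler_sum => i _.
    by rewrite cV_subE extend_in.
  rewrite mulr_natr -sumr_const.
  rewrite [leRHS](bigID (mem t)) /= -[leLHS]addr0; apply: lerD; last first.
    by apply: sumr_ge0 => i _; exact: sqr_ge0.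
  rewrite [leLHS](eq_bigl (fun i => (i \notin k) && (i \in t))); last first.
    by move=> i; rewrite !inE.
  apply: ler_sum => i /andP[ik it].
  by rewrite cV_subE extend_notin // sub0r sqrrN tbm.
have ne0 : 0 <= th * (n%:R * eps) by rewrite !mulr_ge0 // ltW.
have := ler_wpM2l ne0 dE; have := ler_wpM2l (ltW th0) gd.
set s1 := \sum_i (b i 0 - _) ^+ 2; set u := #|_|%:R.
move=> h1 h2.
have E3 : th * n%:R * eps * bm * u + 2 * (th * n%:R * eps / 2) * s1 =
    th * (n%:R * eps) * (s1 + bm * u) by field.
rewrite -addrA E3; lra.
Qed.

Lemma marginal_model_le (alpha1 alpha2 : R) (k : {set 'I_p}) (eps th Q bm Bm : R) :
  0 < eps -> 0 < th < 1 -> 0 <= Q ->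
  (forall i, i \in t -> bm <= bet i 0 ^+ 2) ->
  (forall i, i \in t -> bet i 0 ^+ (2 * r) <= Bm) -> 1 <= Bm ->
  (forall d, supported (t :|: k) d -> n%:R * eps * sqnorm d <= sqnorm (X *m d)) ->
  (forall d, supported (t :|: k) d -> dotv e (X *m d) ^+ 2 <= Q * sqnorm (X *m d)) ->
  (forall b : 'cV[R]_#|k|, 0 <= (b^T *m model_principal A k *m b) 0 0) ->
  1 <= th * n%:R * eps / 2 ->
  forall E, E = sqnorm e - Q / (1 - th) + th * n%:R * eps * bm * #|t :\: k|%:R ->
  (marginal r alpha1 alpha2 (model_cols X k) (model_principal A k) (X *m bet + e) <=
   ((2 * pi) `^ (- (n%:R / 2)) * tau_cst n * sig_cst alpha1 alpha2 *
     (prior_weight r (model_principal A k) * (moment_cst r ^+ #|k| * (2 * Bm) ^+ #|t| *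
      (th * n%:R * eps / 2) `^
        (- (#|k :&: t|%:R / 2) - (r%:R + 2^-1) * #|k :\: t|%:R))))%:E *
   invgamma_int ((r * #|k|)%:R + #|k|%:R / 2 + 2^-1) (n%:R / 2) *
   (invgamma_int (n%:R / 2 + alpha1) (E / 2 + alpha2) +
    invgamma_int (n%:R / 2 + alpha1 + (r * #|t|)%:R) (E / 2 + alpha2)))%E.
Proof.
move=> e0 th01 Q0 tbm tBm Bm1 gram dotQ Age0 c1 E EE.
pose J : {set 'I_#|k|} := [set i | enum_val i \in t]%SET.
have cardJ (Y : {set 'I_p}) :
    #|[set i : 'I_#|k| | enum_val i \in Y]%SET| = #|k :&: Y|.
  rewrite -(card_imset _ enum_val_inj); apply: eq_card => i; rewrite !inE.
  apply/imsetP/andP => [[j]|[ik iY]].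
    by rewrite inE => jY ->; split => //; exact: enum_valP.
  by exists (enum_rank_in ik i); rewrite ?inE enum_rankK_in.
have JE : #|J| = #|k :&: t| by exact: cardJ.
have JCE : #|~: J|%SET = #|k :\: t|.
  rewrite finset.setDE -cardJ; apply: eq_card => i; by rewrite !inE.
have := @marginal_le R r alpha1 alpha2 n #|k| (model_cols X k) (model_principal A k)
  (X *m bet + e) E (th * n%:R * eps / 2) Bm (fun i => bet (enum_val i) 0) J #|t|.
rewrite JE JCE; apply => //.
- by move=> b; rewrite EE; exact: residual_lower.
- by move=> i; rewrite inE => it; rewrite bet_t.
- by move=> i; rewrite inE; exact: tBm.
- by apply: subset_leq_card; exact: finset.subsetIr.
Qed.

(** With side [n^(-1/2)] the box only adds [|t| / eps] to the residual, little compared with [ln n].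
    As the side is at most [bm / 2], the coordinates stay above [bm / 2] and below twice the true
    ones in modulus, whence the factor 4 in front of [sqnorm bet]. *)
Lemma marginal_true_ge (alpha1 alpha2 eps bm a2 : R) :
  0 < eps -> 0 < bm -> 0 <= a2 ->
  (forall i, i \in t -> bm <= `|bet i 0|) ->
  (forall d, supported t d -> sqnorm (X *m d) <= n%:R * eps^-1 * sqnorm d) ->
  (forall b : 'cV[R]_#|t|, (b^T *m model_principal A t *m b) 0 0 <= a2 * sqnorm b) ->
  n%:R `^ (- 2^-1) <= bm / 2 ->
  (((2 * pi) `^ (- (n%:R / 2)) * tau_cst n * sig_cst alpha1 alpha2 *
     (prior_weight r (model_principal A t) *
      ((bm / 2) ^+ (2 * r) * n%:R `^ (- 2^-1)) ^+ #|t| *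
      ((2 * n%:R) `^ (- ((r * #|t|)%:R + #|t|%:R / 2 + 3 / 2)) * expR (- 2^-1)) * n%:R))%:E *
   invgamma_int (n%:R / 2 + alpha1 + ((r * #|t|)%:R + #|t|%:R / 2))
     ((sqnorm e + #|t|%:R * eps^-1) / 2 + a2 * (4 * sqnorm bet) / (2 * n%:R) + alpha2) <=
   marginal r alpha1 alpha2 (model_cols X t) (model_principal A t) (X *m bet + e))%E.
Proof.
move=> e0 bm0 a20 tbm gram Aub hbm.
set h := n%:R `^ (- 2^-1) in hbm *; have h0 : 0 <= h by exact: powR_ge0.
have h2 : n%:R * h ^+ 2 = 1.
  rewrite /h -powR_mulrn ?powR_ge0 // -powRrM mulNr mulVf // powR_inv1 //.
  by rewrite mulfV // pnatr_eq0 -lt0n.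
(* The box lies below the true coordinate exactly when the noise has negative inner product with the
   column, so each product in [dotv e (X *m d)] is nonnegative. *)
pose l (i : 'I_#|t|) := bet (enum_val i) 0 - (dotv e (col (enum_val i) X) < 0)%R%:R * h.
have bt (i : 'I_#|t|) : bm <= `|bet (enum_val i) 0| by apply: tbm; exact: enum_valP.
apply: (@marginal_ge R r alpha1 alpha2 n #|t| _ _ _ _ _ _ h l) => //.
- by rewrite !mulr_ge0 // sqnorm_ge0.
- by rewrite exprn_ge0 // divr_ge0 // ltW.
move=> b hb; pose d := extend b - bet.
have dt : supported t d.
  by move=> i it; rewrite cV_subE bet_t // subr0 extend_notin.
have dE (i : 'I_#|t|) : d (enum_val i) 0 = b i 0 - bet (enum_val i) 0.
  by rewrite cV_subE extend_in.
have db (i : 'I_#|t|) : `|d (enum_val i) 0| <= h.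
  rewrite dE; have := hb i; rewrite /l ler_norml.
  by case: (dotv e _ < 0)%R => /=; rewrite ?mul1r ?mul0r => /andP[]; lra.
have dd : 0 <= dotv e (X *m d).
  have -> : X *m d = \sum_i d i 0 *: col i X.
    by apply/colP => i; rewrite mxE summxE; apply: eq_bigr => j _; rewrite !mxE mulrC.
  rewrite dotvC dotv_suml (bigID (mem t)) /= addr_ge0 //; last first.
    by apply: sumr_ge0 => i it; rewrite dt // dotvZl mul0r.
  rewrite big_enum_val; apply: sumr_ge0 => i _; rewrite dotvZl dotvC dE.
  have := hb i; rewrite /l; have [h'|h'] /= := ltP (dotv e (col (enum_val i) X)) 0.
    rewrite mul1r => /andP[_ hu]; rewrite mulr_le0 ?(ltW h') //; lra.
  rewrite mul0r => /andP[hl _]; rewrite mulr_ge0 //; lra.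
have d2 : sqnorm d <= #|t|%:R * h ^+ 2.
  rewrite -(sqnorm_restr dt) /sqnorm mulr_natl -[X in _ *+ X]card_ord -sumr_const.
  apply: ler_sum => i _; rewrite mxE -(real_normK (num_real _)).
  by apply: lerXn2r (db i); rewrite nnegrE.
split.
- have -> : \sum_i ((X *m bet + e) i 0 - (model_cols X t *m b) i 0) ^+ 2 =
      sqnorm (e - X *m d).
    rewrite sumsq_dotv; congr sqnorm.
    by rewrite mulmx_extend /d mulmxBr opprB (addrC (X *m bet)) -addrA.
  rewrite sqnormB.
  have g1 := gram d dt.
  have g2 : n%:R * eps^-1 * sqnorm d <= #|t|%:R * eps^-1.
    have ne : 0 <= n%:R * eps^-1 by rewrite mulr_ge0 // invr_ge0 ltW.
    apply: (le_trans (ler_wpM2l ne d2)).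
    rewrite (_ : _ * _ * _ = #|t|%:R * eps^-1 * (n%:R * h ^+ 2)); last by ring.
    by rewrite h2 mulr1.
  lra.
- apply: (le_trans (Aub b)); apply: ler_wpM2l => //.
  rewrite -sqnorm_extend.
  have -> : extend b = bet + d by rewrite /d addrC subrK.
  rewrite /sqnorm mulr_sumr; apply: ler_sum => i _; rewrite mxE.
  have [it|it] := boolP (i \in t); last first.
    by rewrite dt // addr0 -[leLHS]mul1r; apply: ler_wpM2r; rewrite ?sqr_ge0 // ler1n.
  have := db (enum_rank_in it i); rewrite enum_rankK_in // => di.
  have := tbm i it => bi.
  have : `|bet i 0 + d i 0| <= 2 * `|bet i 0|.
    by apply: (le_trans (ler_normD _ _)); lra.
  rewrite -(real_normK (num_real (_ + _))) -(real_normK (num_real (bet i 0))) => hh.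
  apply: (@le_trans _ _ ((2 * `|bet i 0|) ^+ 2)).
    by apply: lerXn2r => //; rewrite nnegrE // mulr_ge0.
  by rewrite exprMn; lra.
- move=> i.
  have hb2 : bm / 2 <= `|b i 0|.
    have := db i; rewrite dE => hd; have := bt i => hbt.
    have := ler_normB (bet (enum_val i) 0) (bet (enum_val i) 0 - b i 0).
    rewrite (_ : bet _ 0 - (bet _ 0 - b i 0) = b i 0); last by ring.
    have := lerB_dist (bet (enum_val i) 0) (bet (enum_val i) 0 - b i 0).
    rewrite (_ : bet _ 0 - (bet _ 0 - b i 0) = b i 0); last by ring.
    by rewrite distrC; lra.
  rewrite !exprM; apply: lerXn2r; rewrite ?nnegrE ?sqr_ge0 //.
  rewrite -[leRHS](real_normK (num_real _)).
  by apply: lerXn2r => //; rewrite nnegrE // divr_ge0 // ltW.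
Qed.

End ModelBounds.

(** * From marginals to a log ratio *)

Section MarginalRatio.
Context {R : realType}.
Notation mu := (@lebesgue_measure R).

Lemma powR_expRln (x a : R) : 0 < x -> x `^ a = expR (a * ln x).
Proof. by move=> x0; rewrite /powR gt_eqF. Qed.

Lemma exprn_expRln (x : R) k : 0 < x -> x ^+ k = expR (k%:R * ln x).
Proof. by move=> x0; rewrite expRM_natl lnK // posrE. Qed.

(** [J] is the integral shared by the two bounds. Finiteness of [mt] matters because [fine +oo] is
    0. *)
Lemma fine_ratio (mk mt J : \bar R) (g u l : R) :
  (0 <= mk)%E -> (0 <= mt)%E -> (mt < +oo)%E -> 0 <= g -> 0 <= u -> 0 < l ->
  (0 <= J)%E -> (mk <= (g * u)%:E * J)%E -> ((g * l)%:E * J <= mt)%E ->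
  fine mk <= u / l * fine mt.
Proof.
move=> mk0 mt0 mtoo g0 u0 l0 J0 mkJ Jmt.
have ul0 : 0 <= u / l by rewrite divr_ge0 // ltW.
have h : (mk <= (u / l)%:E * mt)%E.
  apply: le_trans mkJ _; have -> : g * u = (u / l) * (g * l) by field; rewrite gt_eqF.
  by rewrite EFinM -muleA; apply: lee_wpmul2l; rewrite ?lee_fin.
case: mt mt0 mtoo Jmt h => [v| |] // _ _ _.
by case: mk mk0 {mkJ} => [w| |] //= _; rewrite -EFinM lee_fin.
Qed.

(** This is [Gamma(1/2)]; only its finiteness and sign are used. *)
Definition invgamma_cst : R := fine (invgamma_int 2^-1 1).

Lemma invgamma_cstE : (invgamma_cst%:E = invgamma_int (2^-1 : R) 1)%E.
Proof.
by rewrite fineK // ge0_fin_numE ?invgamma_int_ge0 // invgamma_int_lty.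
Qed.

Lemma invgamma_cst_ge0 : 0 <= invgamma_cst.
Proof. by apply: fine_ge0; exact: invgamma_int_ge0. Qed.

Lemma tau_integral_le (x : R) n : 0 <= x -> (0 < n)%N ->
  (invgamma_int (x + 2^-1) (n%:R / 2) <=
   ((4 * x / n%:R) `^ x * (2 * n%:R `^ (- 2^-1) * invgamma_cst))%:E)%E.
Proof.
move=> x0 n0; have nR : (0 : R) < n%:R by rewrite ltr0n.
apply: (le_trans (invgamma_int_bound x0 (divr_gt0 nR (ltr0n R 2)))).
have -> : 2 * x / (n%:R / 2) = 4 * x / n%:R by field; rewrite gt_eqF.
have -> : n%:R / 2 / 2 = n%:R / 4 * 1 :> R by field.
rewrite invgamma_int_scale ?divr_gt0 // -invgamma_cstE -!EFinM lee_fin.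
rewrite le_eqVlt; apply/orP; left; apply/eqP; congr (_ * (_ * _)).
rewrite powRM ?(ltW nR) // mulrC; congr (_ * _).
rewrite powR_inv // opprK powR12_sqrt // -[4](_ : 2 ^+ 2 = _); last by ring.
by rewrite sqrtr_sqr ger0_norm.
Qed.

(** Raising the exponent to [N0 + a] costs [2 Z^a] by [invgamma_int_shift]; scaling then exchanges
    [Sk] for [St]. The power of [St / Sk] carries the whole comparison of residuals. *)
Lemma invgamma_int_compare (N0 j a Sk St Z : R) : 6 <= N0 -> 0 <= j <= a ->
  0 < Sk -> 0 < St -> 1 <= Z -> 2 * Sk / N0 <= Z ->
  (invgamma_int (N0 + j) Sk <=
   (2 * Z `^ a * (St / Sk) `^ (N0 + a))%:E * invgamma_int (N0 + a) St)%E.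
Proof.
move=> N6 /andP[j0 ja] Sk0 St0 Z1 SZ.
have N00 : 0 < N0 by apply: lt_le_trans N6.
have N6j : 6 <= N0 + j by lra.
have aj : 0 <= a - j by rewrite subr_ge0.
apply: (le_trans (invgamma_int_shift N6j Sk0 aj)).
rewrite (_ : N0 + j + (a - j) = N0 + a); last by ring.
rewrite {1}(_ : Sk = Sk / St * St); last by rewrite divfK ?gt_eqF.
rewrite [X in (_ * X)%E](_ : _ = invgamma_int (N0 + a) (Sk / St * St)); last first.
  by rewrite divfK ?gt_eqF.
rewrite invgamma_int_scale ?divr_gt0 // muleA -EFinM.
apply: lee_wpmul2r; first exact: invgamma_int_ge0.
rewrite lee_fin; apply: ler_pM; rewrite ?mulr_ge0 ?powR_ge0 //.
  apply: ler_wpM2l => //; rewrite divfK ?gt_eqF //.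
  have q0 : 0 <= 2 * Sk / (N0 + j) by rewrite divr_ge0 ?mulr_ge0 ?ltW //; lra.
  apply: (@le_trans _ _ (Z `^ (a - j))).
    apply: ge0_ler_powR => //; rewrite ?nnegrE //; first by apply: le_trans Z1.
    apply: le_trans SZ; apply: ler_wpM2l; first by rewrite mulr_ge0 // ltW.
    by rewrite lef_pV2 ?posrE; lra.
  by apply: ler_powR => //; rewrite gerBl.
by rewrite -powR_inv ?divr_ge0 ?(ltW Sk0) ?(ltW St0) // invf_div.
Qed.

End MarginalRatio.

Section RatioBound.
Context {R : realType}.
Context (r n p : nat) (X : 'M[R]_(n, p)) (A : 'M[R]_p) (t : {set 'I_p})
  (bet : 'cV[R]_p) (e : 'cV[R]_n) (alpha1 alpha2 a1 a2 eps th bm Bm Z : R).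
Hypothesis r0 : (0 < r)%N.
Hypothesis n0 : (0 < n)%N.
Hypothesis bet_t : supported t bet.
Hypothesis A_sym : A^T = A.
Hypothesis A_eig : forall a, eigenvalue A a -> a1 <= a <= a2.
Hypothesis a1_gt0 : 0 < a1.
Hypothesis a2_ge0 : 0 <= a2.
Hypothesis alpha1_gt0 : 0 < alpha1.
Hypothesis alpha2_gt0 : 0 < alpha2.
Hypothesis eps_gt0 : 0 < eps.
Hypothesis th01 : 0 < th < 1.
Hypothesis bm_gt0 : 0 < bm.
Hypothesis bet_ge : forall i, i \in t -> bm <= `|bet i 0|.
Hypothesis bet_le : forall i, i \in t -> bet i 0 ^+ (2 * r) <= Bm.
Hypothesis Bm1 : 1 <= Bm.
Hypothesis Z1 : 1 <= Z.
Hypothesis n_bm : n%:R `^ (- 2^-1) <= bm / 2.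
Hypothesis c1_ge : 1 <= th * n%:R * eps / 2.
Hypothesis n12 : 6 <= n%:R / 2 :> R.
Hypothesis gram_up : forall d, supported t d ->
  sqnorm (X *m d) <= n%:R * eps^-1 * sqnorm d.

Let T := #|t|.
Let h : R := r%:R + 2^-1.
Let N0 : R := n%:R / 2 + alpha1.
Let a : R := h * T%:R.
Let y := X *m bet + e.
Let marg k := marginal r alpha1 alpha2 (model_cols X k) (model_principal A k) y.

(** The inverse-gamma scale in the lower bound for the true model: half the largest residual on the
    box, then the prior form at [tau >= n], then [alpha2]. [scale_model] is its counterpart in the
    upper bound for a model. *)
Definition scale_true : R :=
  (sqnorm e + T%:R * eps^-1) / 2 + a2 * (4 * sqnorm bet) / (2 * n%:R) + alpha2.

Definition scale_model (Q : R) (k : {set 'I_p}) : R :=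
  (sqnorm e - Q / (1 - th) + th * n%:R * eps * bm ^+ 2 * #|t :\: k|%:R) / 2 + alpha2.

Definition log_cst0 : R :=
  T%:R * ln (2 * Bm) + ln (1 + invgamma_cst) + ln 8 + a * ln Z +
  T%:R * ln (moment_cst r * (a1 / 2) `^ (- h)) - (2 * r)%:R * T%:R * ln (bm / 2) +
  (a + 3 / 2) * ln 2 + 2^-1.

Definition log_cst1 : R := 2 * a2 + ln (moment_cst r).

(** In order: terms free of n, the Gaussian moments, the integral over tau, the powers of n lost in
    the lower bound for the true model, and the two scales. The remaining powers [n^(3/2)], [n^(-1)]
    and [n^(-1/2)] cancel. *)
Definition log_ratio (Q : R) (k : {set 'I_p}) : R :=
  log_cst0 + #|k|%:R * log_cst1
  - (#|k :&: t|%:R / 2 + h * #|k :\: t|%:R) * ln (th * n%:R * eps / 2)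
  + h * #|k|%:R * ln (4 * (h * #|k|%:R) / n%:R)
  + (T%:R / 2 + a) * ln n%:R
  + (N0 + a) * ln (scale_true / scale_model Q k).

Lemma qform_principal_bounds (k : {set 'I_p}) (b : 'cV[R]_#|k|) :
  a1 * sqnorm b <= (b^T *m model_principal A k *m b) 0 0 <= a2 * sqnorm b.
Proof. exact: principal_bounds. Qed.

Lemma scale_true_gt0 : 0 < scale_true.
Proof.
rewrite /scale_true; apply: ltr_wpDl alpha2_gt0; apply: addr_ge0.
  rewrite divr_ge0 // addr_ge0 ?sqnorm_ge0 // mulr_ge0 // invr_ge0; exact: ltW.
by rewrite divr_ge0 // !mulr_ge0 ?sqnorm_ge0.
Qed.

Lemma marginal_le_true (Q : R) (k : {set 'I_p}) : 0 <= Q -> 0 < scale_model Q k ->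
  2 * scale_model Q k / N0 <= Z ->
  (forall d, supported (t :|: k) d -> n%:R * eps * sqnorm d <= sqnorm (X *m d)) ->
  (forall d, supported (t :|: k) d -> dotv e (X *m d) ^+ 2 <= Q * sqnorm (X *m d)) ->
  (marg k <= ((2 * pi) `^ (- (n%:R / 2)) * tau_cst n * sig_cst alpha1 alpha2 *
     (prior_weight r (model_principal A k) * (moment_cst r ^+ #|k| * (2 * Bm) ^+ T *
      (th * n%:R * eps / 2) `^ (- (#|k :&: t|%:R / 2) - h * #|k :\: t|%:R)) *
      ((4 * (h * #|k|%:R) / n%:R) `^ (h * #|k|%:R) *
        (2 * n%:R `^ (- 2^-1) * invgamma_cst)) *
      (4 * Z `^ a * (scale_true / scale_model Q k) `^ (N0 + a))))%:E *
   invgamma_int (N0 + a) scale_true)%E.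
Proof.
move=> Q0 Sk0 SkZ gram dotQ.
have Ab (k' : {set 'I_p}) (b : 'cV[R]_#|k'|) : 0 <= (b^T *m model_principal A k' *m b) 0 0.
  have /andP[+ _] := qform_principal_bounds b.
  by apply: le_trans; rewrite mulr_ge0 ?sqnorm_ge0 // ltW.
have tbm i : i \in t -> bm ^+ 2 <= bet i 0 ^+ 2.
  move=> it; rewrite -(real_normK (num_real (bet i 0))).
  by apply: lerXn2r (bet_ge it); rewrite nnegrE // ltW.
have := @marginal_model_le R r n p X A t bet e r0 bet_t alpha1 alpha2 k eps th Q
  (bm ^+ 2) Bm eps_gt0 th01 Q0 tbm bet_le Bm1 gram dotQ (Ab k) c1_ge _ erefl.
rewrite -/(scale_model Q k) -/N0 -/T => /le_trans; apply.
set g := (2 * pi) `^ _ * tau_cst n * sig_cst alpha1 alpha2; set W := prior_weight _ _ * _.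
have g0 : 0 <= g.
  by apply: mulr_ge0 (sig_cst_ge0 _ _); apply: mulr_ge0 (tau_cst_ge0 _); exact: powR_ge0.
have W0 : 0 <= W.
  apply: mulr_ge0 (prior_weight_ge0 _ _) _; apply: mulr_ge0 (powR_ge0 _ _).
  apply: mulr_ge0; apply: exprn_ge0; first exact: ltW (moment_cst_gt0 _).
  by rewrite mulr_ge0 // (le_trans ler01).
have k_ge0 : 0 <= h * #|k|%:R by rewrite mulr_ge0 // /h addr_ge0.
have hk : (r * #|k|)%:R + #|k|%:R / 2 = h * #|k|%:R by rewrite /h natrM; ring.
have tau_le := tau_integral_le k_ge0 n0.
rewrite hk; set I1 := invgamma_int (h * #|k|%:R + 2^-1) _ in tau_le *.
set tb := _ `^ _ * _ in tau_le *.
have tb0 : 0 <= tb.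
  by rewrite mulr_ge0 ?powR_ge0 // !mulr_ge0 ?powR_ge0 ?invgamma_cst_ge0.
have N06 : 6 <= N0 by rewrite /N0; move: n12 alpha1_gt0; lra.
have T0 : (0 : R) <= T%:R by [].
have r_ge0 : (0 : R) <= r%:R by [].
have a_ge0 : 0 <= a by rewrite mulr_ge0 // addr_ge0.
have h0 : (0 : R) <= 0 <= a by rewrite lexx.
have h1 : (0 : R) <= (r * T)%:R <= a.
  apply/andP; split; first exact: ler0n.
  by rewrite natrM /a /h mulrDl lerDl; apply: mulr_ge0.
have i0 := invgamma_int_compare N06 h0 Sk0 scale_true_gt0 Z1 SkZ.
have i1 := invgamma_int_compare N06 h1 Sk0 scale_true_gt0 Z1 SkZ.
rewrite addr0 in i0; set J := invgamma_int (N0 + a) scale_true in i0 i1 *.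
set z := 2 * Z `^ a * _ in i0 i1.
have z0 : 0 <= z by rewrite !mulr_ge0 ?powR_ge0.
have J0 : (0 <= J)%E by exact: invgamma_int_ge0.
apply: (@le_trans _ _ (((g * W)%:E * tb%:E) * ((2 * z)%:E * J))%E).
  apply: lee_pmul.
  - by rewrite mule_ge0 ?invgamma_int_ge0 // lee_fin mulr_ge0.
  - by rewrite adde_ge0 ?invgamma_int_ge0.
  - by apply: lee_wpmul2l => //; rewrite lee_fin mulr_ge0.
  apply: (le_trans (leeD i0 i1)).
  rewrite -ge0_muleDl ?lee_fin // -EFinD.
  by rewrite (_ : z + z = 2 * z) //; ring.
rewrite muleA -!EFinM.
rewrite (_ : g * W * tb * (2 * z) = g * (W * tb *
   (4 * Z `^ a * (scale_true / scale_model Q k) `^ (N0 + a)))) //.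
by rewrite /z; ring.
Qed.

(** The hypotheses on [Qt] allow [marginal_le_true] to be applied to the true model itself, which
    shows that its marginal is finite. *)
Lemma marginal_ratio_le (Q Qt : R) (k : {set 'I_p}) : 0 <= Q -> 0 <= Qt ->
  0 < scale_model Q k -> 2 * scale_model Q k / N0 <= Z ->
  0 < scale_model Qt t -> 2 * scale_model Qt t / N0 <= Z ->
  (forall d, supported (t :|: k) d -> n%:R * eps * sqnorm d <= sqnorm (X *m d)) ->
  (forall d, supported (t :|: k) d -> dotv e (X *m d) ^+ 2 <= Q * sqnorm (X *m d)) ->
  (forall d, supported t d -> dotv e (X *m d) ^+ 2 <= Qt * sqnorm (X *m d)) ->
  fine (marg k) <= expR (log_ratio Q k) * fine (marg t).
Proof.
move=> Q0 Qt0 Sk0 SkZ St0 StZ gram dotQ dotQt.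
have tt : t :|: t = t by exact: finset.setUid.
have gramt d : supported (t :|: t) d -> n%:R * eps * sqnorm d <= sqnorm (X *m d).
  by rewrite tt => dt; apply: gram => i; rewrite finset.in_setU negb_or => /andP[/dt].
have dotQt' d : supported (t :|: t) d -> dotv e (X *m d) ^+ 2 <= Qt * sqnorm (X *m d).
  by rewrite tt; exact: dotQt.
have marg0 k' : (0 <= marg k')%E.
  apply: integral_ge0 => tau _; apply: integral_ge0 => s _.
  by apply: integral_cV_ge0 => b; rewrite lee_fin marginal_integrand_ge0.
have N0a : 0 < N0 + a.
  rewrite /N0 /a /h; have : (0 : R) <= (r%:R + 2^-1) * T%:R by rewrite mulr_ge0 // addr_ge0.
  by move: n12 alpha1_gt0; lra.
have J_lty := invgamma_int_lty N0a scale_true_gt0.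
set J := invgamma_int _ _ in J_lty.
have J0 : (0 <= J)%E by exact: invgamma_int_ge0.
have Jfin : J \is a fin_num by rewrite ge0_fin_numE.
have margt_lty : (marg t < +oo)%E.
  apply: (le_lt_trans (marginal_le_true Qt0 St0 StZ gramt dotQt')).
  by rewrite -/J -(fineK Jfin) -EFinM ltry.
have up := marginal_le_true Q0 Sk0 SkZ gram dotQ.
have Aub (b : 'cV[R]_#|t|) : (b^T *m model_principal A t *m b) 0 0 <= a2 * sqnorm b.
  by have /andP[_] := qform_principal_bounds b.
have low := @marginal_true_ge R r n p X A t bet e n0 bet_t alpha1 alpha2 eps bm a2
  eps_gt0 bm_gt0 a2_ge0 bet_ge gram_up Aub n_bm.
have aE : (r * #|t|)%:R + #|t|%:R / 2 = a by rewrite /a /h /T natrM; ring.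
rewrite aE -/N0 -/scale_true -/J -/T in low; rewrite -/J in up.
set g := (2 * pi) `^ _ * tau_cst n * sig_cst alpha1 alpha2 in low up.
have g0 : 0 <= g.
  by apply: mulr_ge0 (sig_cst_ge0 _ _); apply: mulr_ge0 (tau_cst_ge0 _); exact: powR_ge0.
have nR : (0 : R) < n%:R by rewrite ltr0n.
have M0 : 0 < moment_cst r :> R by exact: moment_cst_gt0.
have w0 : 0 < moment_cst r * (a1 / 2) `^ (- h).
  by rewrite mulr_gt0 // powR_gt0 // divr_gt0.
have Wt := @prior_weight_ge R r T (model_principal A t) a1 a2 r0 a1_gt0 a2_ge0
   (@qform_principal_bounds t).
have Wk := @prior_weight_le R r #|k| (model_principal A k) a2 a2_ge0
   (fun b => let: conj _ h := andP (qform_principal_bounds b) in h).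
set u := (X in (g * X)%:E) in up; set l := (X in (g * X)%:E) in low.
have Wt0 : 0 < prior_weight r (model_principal A t).
  by apply: lt_le_trans Wt; rewrite invr_gt0 exprn_gt0.
have c0 : 0 < th * n%:R * eps / 2 by apply: lt_le_trans c1_ge.
have Bm0 : 0 < Bm by apply: lt_le_trans Bm1.
have Z0 : 0 < Z by apply: lt_le_trans Z1.
have Bm20 : 0 < 2 * Bm by rewrite mulr_gt0 ?ltr0n.
have sq0 : 0 < scale_true / scale_model Q k by rewrite divr_gt0 // scale_true_gt0.
have two0 : (0 : R) < 2 by rewrite ltr0n.
have four0 : (0 : R) < 4 by rewrite ltr0n.
have bm20 : 0 < bm / 2 by rewrite divr_gt0.
have n20 : (0 : R) < 2 * n%:R by rewrite mulr_gt0.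
have l0 : 0 < l.
  rewrite /l; apply: mulr_gt0 nR; apply: mulr_gt0; last first.
    apply: mulr_gt0 (expR_gt0 _); apply: powR_gt0. by rewrite mulr_gt0 ?ltr0n.
  apply: mulr_gt0 => //; apply: exprn_gt0; apply: mulr_gt0; last by rewrite powR_gt0 ?ltr0n.
  by apply: exprn_gt0; rewrite divr_gt0 ?ltr0n.
have u0 : 0 <= u.
  rewrite /u; apply: mulr_ge0; last by rewrite !mulr_ge0 ?powR_ge0.
  apply: mulr_ge0; last by rewrite !mulr_ge0 ?powR_ge0 ?invgamma_cst_ge0.
  apply: mulr_ge0 (prior_weight_ge0 _ _) _; apply: mulr_ge0 (powR_ge0 _ _).
  by rewrite mulr_ge0 ?exprn_ge0 ?mulr_ge0 ?(ltW M0) ?(ltW Bm0).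
apply: (le_trans (fine_ratio (marg0 k) (marg0 t) margt_lty g0 u0 l0 J0 up low)).
apply: ler_wpM2r; first exact: fine_ge0.
rewrite ler_pdivrMr //.
pose L : R := ln n%:R; pose lsq := ln (scale_true / scale_model Q k).
(* [invgamma_cst] is only known to be nonnegative; adding 1 makes its logarithm usable. *)
pose cI : R := 1 + invgamma_cst; have cI0 : 0 < cI.
  by rewrite /cI ltr_pwDl // invgamma_cst_ge0.
(* [expR U] dominates the factor [u] of the model, [expR V] is below the factor [l] of the true one,
   and [log_ratio] is exactly [U - V]. *)
pose U := #|k|%:R * (2 * a2) + (#|k|%:R * ln (moment_cst r) + T%:R * ln (2 * Bm) +
   (- (#|k :&: t|%:R / 2) - h * #|k :\: t|%:R) * ln (th * n%:R * eps / 2)) +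
   (h * #|k|%:R * ln (4 * (h * #|k|%:R) / n%:R) + (ln 2 + - 2^-1 * L + ln cI)) +
   (ln 4 + a * ln Z + (N0 + a) * lsq).
pose V := - (T%:R * ln (moment_cst r * (a1 / 2) `^ (- h))) +
   T%:R * ((2 * r)%:R * ln (bm / 2) + - 2^-1 * L) +
   (- (a + 3 / 2) * (ln 2 + L) - 2^-1) + L.
have uU : u <= expR U.
  rewrite /u /U !expRD; apply: ler_pM.
  - apply: mulr_ge0; last by rewrite !mulr_ge0 ?powR_ge0 ?invgamma_cst_ge0.
    apply: mulr_ge0 (prior_weight_ge0 _ _) _; apply: mulr_ge0 (powR_ge0 _ _).
    by rewrite mulr_ge0 // exprn_ge0 ?mulr_ge0 ?(ltW M0) ?(ltW Bm0).
  - by rewrite !mulr_ge0 ?powR_ge0.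
  - apply: ler_pM.
    + apply: mulr_ge0 (prior_weight_ge0 _ _) _; apply: mulr_ge0 (powR_ge0 _ _).
      by rewrite mulr_ge0 // exprn_ge0 ?mulr_ge0 ?(ltW M0) ?(ltW Bm0).
    + by rewrite !mulr_ge0 ?powR_ge0 ?invgamma_cst_ge0.
    + apply: ler_pM.
      * exact: prior_weight_ge0.
      * apply: mulr_ge0 (powR_ge0 _ _).
        by rewrite mulr_ge0 // exprn_ge0 ?mulr_ge0 ?(ltW M0) ?(ltW Bm0).
      * by rewrite expRM_natl.
      * by rewrite -(powR_expRln _ c0) -(exprn_expRln _ M0) -(exprn_expRln _ Bm20).
    + apply: ler_pM; rewrite ?powR_ge0 //.
        by rewrite !mulr_ge0 ?powR_ge0 ?invgamma_cst_ge0.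
        have [k0|k0] := posnP #|k|; first by rewrite k0 !mulr0 mul0r powRr0 mul0r expR0.
        rewrite powR_expRln // !mulr_gt0 ?invr_gt0 ?ltr0n // /h.
        by rewrite ltr_pwDr ?invr_gt0.
      apply: ler_pM.
      * by apply: mulr_ge0 => //; exact: powR_ge0.
      * exact: invgamma_cst_ge0.
      * by rewrite (lnK (_ : 2 \in Num.pos)) ?posrE // -(powR_expRln _ nR).
      * by rewrite (lnK (_ : cI \in Num.pos)) ?posrE // /cI lerDr.
  - by rewrite (lnK (_ : 4 \in Num.pos)) ?posrE // -(powR_expRln _ Z0) -(powR_expRln _ sq0).
have lV : expR V <= l.
  rewrite /l /V !expRD; apply: ler_pM.
  - by rewrite !mulr_ge0 ?expR_ge0.
  - exact: expR_ge0.
  - apply: ler_pM.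
    + by rewrite mulr_ge0 ?expR_ge0.
    + by rewrite mulr_ge0 ?expR_ge0.
    + apply: ler_pM; rewrite ?expR_ge0 //.
        by apply: le_trans Wt; rewrite expRN -(exprn_expRln _ w0).
      have q0 : 0 < (bm / 2) ^+ (2 * r) * n%:R `^ (- 2^-1).
        by rewrite mulr_gt0 ?exprn_gt0 ?powR_gt0.
      rewrite (exprn_expRln _ q0) ler_expR; apply: ler_wpM2l => //.
      rewrite (lnM (x := (bm / 2) ^+ (2 * r))) ?posrE ?exprn_gt0 ?powR_gt0 //.
      by rewrite lnXn // ln_powR mulr_natl.
    + by rewrite (powR_expRln _ n20) lnM ?posrE.
  - by rewrite (lnK (_ : n%:R \in Num.pos)) ?posrE.
apply: (le_trans uU); apply: (@le_trans _ _ (expR (log_ratio Q k) * expR V)).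
  rewrite -expRD ler_expR /U /V /log_ratio /log_cst0 /log_cst1 -/lsq -/L -/cI.
  have -> : ln 8 = ln 2 + ln 4 :> R by rewrite -lnM ?posrE //; congr ln; ring.
  rewrite natrM le_eqVlt; apply/orP; left; apply/eqP.
  set lc := ln (th * n%:R * eps / 2); set lk := ln (4 * _ / _).
  set lw := ln (moment_cst r * _); set lM := ln (moment_cst r).
  set l2 := ln 2; set l4 := ln 4; set lZ := ln Z; set lb := ln (bm / 2); set lB := ln (2 * Bm).
  set lI := ln cI.
  by field.
by apply: ler_wpM2l; rewrite ?expR_ge0.
Qed.

End RatioBound.

(** * Elementary estimates of the log ratio *)

Section LogBounds.
Context {R : realType}.
Implicit Types (h T K u m L l : R).

Lemma log_terms_le h T K u m L l (C0 C1 lc c2 lp l4 lk W D : R) :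
  K = T - u + m -> 0 <= u <= T -> 0 <= m -> 0 <= h -> 0 <= c2 -> 0 <= lp ->
  0 <= l -> lk <= K -> lk <= L ->
  `|C0| + (T + 1) * (`|C1| + h * `|l4| + h * T + `|lc|) <= D ->
  C0 + K * C1 - ((K - m) / 2 + h * m) * (L - l) + h * K * (l4 + lk - L) +
    (T / 2 + h * T) * L + W + (T - K) * (lc + c2 * lp) <=
  D * (1 + m) + ((h + 2^-1) * u - h * m) * L + (T / 2 + h * m) * l + u * (c2 * lp) + W.
Proof.
move=> KE /andP[u0 uT] m0 h0 c20 lp0 l0 lkK lkL hD.
have T0 : 0 <= T by apply: le_trans uT.
have K0 : 0 <= K by rewrite KE addr_ge0 ?subr_ge0.
have KT : K <= T + m by rewrite KE; lra.
have e1 : K * C1 <= (T + m) * `|C1|.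
  by apply: (@le_trans _ _ (K * `|C1|)); [apply: ler_wpM2l; rewrite ?ler_norm | apply: ler_wpM2r].
have e2 : h * K * l4 <= (T + m) * (h * `|l4|).
  rewrite [leRHS](_ : _ = h * (T + m) * `|l4|); last by ring.
  apply: (@le_trans _ _ (h * K * `|l4|)).
    by apply: ler_wpM2l; rewrite ?ler_norm // mulr_ge0.
  by apply: ler_wpM2r => //; apply: ler_wpM2l.
have e3 : (u - m) * lc <= (T + m) * `|lc|.
  apply: le_trans (ler_norm _) _; rewrite normrM; apply: ler_wpM2r => //.
  by rewrite ler_norml; lra.
have e4 : (T - u) * lk <= T * (T + m).
  apply: (@le_trans _ _ ((T - u) * K)); first by apply: ler_wpM2l; rewrite ?subr_ge0.
  by apply: ler_pM; rewrite ?subr_ge0 ?gerBl.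
have e5 : m * lk <= m * L by apply: ler_wpM2l.
have e6 : 0 <= m * (c2 * lp) by apply: mulr_ge0 => //; apply: mulr_ge0.
have e7 : 0 <= u * l by apply: mulr_ge0.
have e8 : h * K * lk <= h * (T * (T + m)) + h * m * L.
  have -> : h * K * lk = h * ((T - u) * lk + m * lk) by rewrite KE; ring.
  rewrite -(mulrA h m) -mulrDr; apply: ler_wpM2l => //; lra.
have e9 := ler_norm C0.
set S := `|C1| + h * `|l4| + h * T + `|lc| in hD.
have S0 : 0 <= S by rewrite !addr_ge0 // mulr_ge0.
have e10 : `|C0| + (T + m) * S <= D * (1 + m).
  apply: (@le_trans _ _ ((`|C0| + (T + 1) * S) * (1 + m))); last first.
    by apply: ler_wpM2r => //; rewrite addr_ge0.
  have : 0 <= m * `|C0| + T * m * S + S by rewrite !addr_ge0 ?mulr_ge0.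
  by rewrite -subr_ge0 => H; rewrite -subr_ge0 (le_trans H) // le_eqVlt; apply/orP; left; apply/eqP; ring.
have -> : C0 + K * C1 - ((K - m) / 2 + h * m) * (L - l) + h * K * (l4 + lk - L) +
    (T / 2 + h * T) * L + W + (T - K) * (lc + c2 * lp) =
    C0 + K * C1 + h * K * l4 + h * K * lk + ((h + 2^-1) * u - 2 * h * m) * L +
    ((T - u) / 2 + h * m) * l + (u - m) * lc + u * (c2 * lp) - m * (c2 * lp) + W.
  by rewrite KE; field.
apply: (@le_trans _ _ (`|C0| + (T + m) * S + ((h + 2^-1) * u - h * m) * L +
   (T / 2 + h * m) * l + u * (c2 * lp) + W)); last by lra.
have -> : (T + m) * S = (T + m) * `|C1| + (T + m) * (h * `|l4|) + h * (T * (T + m)) + (T + m) * `|lc|.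
  by rewrite /S; ring.
lra.
Qed.

(* The margin is 33/30 * 17/16 * 32/31 * 17/16 * 65/64 < 1.31 < 3/2 <= h. *)
Lemma overfit_log_le h T m L l (lp D s N St Sk : R) (n : R) :
  3 / 2 <= h -> 0 <= T -> 1 <= m -> 0 < L -> 0 < s -> 0 < n -> 0 <= N <= 33 / 64 * n ->
  15 / 32 * (n * s) <= Sk -> 0 < St ->
  St - Sk <= s / 64 * L + 17 / 16 * s * (m + 1 / 16) * lp * (32 / 31) ->
  0 <= lp <= 65 / 64 * L -> 256 * D <= L -> 0 <= l -> (T / 2 + h) * l <= L / 128 ->
  D * (1 + m) + (- h * m) * L + (T / 2 + h * m) * l + N * ln (St / Sk) <= - (L / 10).
Proof.
move=> h32 T0 m1 L0 s0 n0 /andP[N0 Nn] Skn St0 dS /andP[lp0 lpL] DL l0 lL.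
have m0 : 0 <= m by lra.
have ns0 : 0 < n * s by apply: mulr_gt0.
have Sk0 : 0 < Sk by apply: lt_le_trans Skn; rewrite mulr_gt0.
set d := s / 64 * L + _ in dS.
have d0 : 0 <= d.
  apply: addr_ge0; apply: mulr_ge0 => //; first by rewrite divr_ge0 // ltW.
    exact: ltW.
  by apply: mulr_ge0 => //; apply: mulr_ge0; [apply: mulr_ge0 => //; exact: ltW | lra].
have lnS : ln (St / Sk) <= d / Sk.
  have -> : St / Sk = 1 + (St - Sk) / Sk by field; rewrite gt_eqF.
  apply: (@le_trans _ _ ((St - Sk) / Sk)).
    apply: le_ln1Dx; rewrite mulrBl divff ?gt_eqF //.
    have : 0 < St / Sk by rewrite divr_gt0.
    by lra.
  by apply: ler_wpM2r; rewrite // invr_ge0 ltW.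
(* [33/64] divided by [15/32] is [11/10]. *)
have NS : N * ln (St / Sk) <= 11 / 10 * (d / s).
  apply: (@le_trans _ _ (33 / 64 * n * (d / (15 / 32 * (n * s))))); last first.
    by rewrite le_eqVlt; apply/orP; left; apply/eqP; field; rewrite !gt_eqF.
  apply: (@le_trans _ _ (N * (d / Sk))); first exact: ler_wpM2l.
  apply: ler_pM => //; first by rewrite divr_ge0 // ltW.
  by apply: ler_wpM2l => //; rewrite lef_pV2 ?posrE // mulr_gt0.
have dE : d / s = L / 64 + 17 / 16 * (m + 1 / 16) * lp * (32 / 31).
  by rewrite /d; field; rewrite gt_eqF.
have mlp : (m + 1 / 16) * lp <= 17 / 16 * m * (65 / 64 * L).
  by apply: ler_pM => //; lra.
have mL : L <= m * L by rewrite -{1}[L]mul1r; apply: ler_wpM2r => //; exact: ltW.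
have hm : 3 / 2 * (m * L) <= h * (m * L) by apply: ler_wpM2r => //; apply: mulr_ge0 => //; exact: ltW.
have Tl : (T / 2 + h * m) * l <= m * L / 128.
  apply: (@le_trans _ _ (m * ((T / 2 + h) * l))); last first.
    by rewrite -mulrA; apply: ler_wpM2l.
  have : 0 <= (m - 1) * (T / 2 * l) by apply: mulr_ge0; [lra | apply: mulr_ge0 => //; lra].
  rewrite (_ : m * _ = (m - 1) * (T / 2 * l) + (T / 2 + h * m) * l); last by ring.
  by rewrite lerDr.
have Dm : 256 * (D * (1 + m)) <= L * (1 + m) by rewrite mulrA; apply: ler_wpM2r => //; lra.
rewrite dE in NS.
have -> : - h * m * L = - (h * (m * L)) by ring.
lra.
Qed.

(** Here [G] is the signal of the missing indices, half of it already spent on the noise. As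
    [N >= n / 2] and [Sk <= Z n / 4], the scales contribute at most [- G / Z], which beats the
    multiples of [L] that missing indices cost elsewhere. *)
Lemma underfit_log_le h T u m L l (c2 lp D N St Sk G n Z : R) :
  3 / 2 <= h -> 0 <= u <= T -> 0 <= m -> 0 < L -> 0 < n -> 0 < Z -> n / 2 <= N ->
  0 < Sk -> Sk <= Z * n / 4 -> 0 < St -> 0 <= G -> St - Sk <= - (G / 2) ->
  0 <= lp <= 2 * L -> 0 <= c2 -> 256 * D <= L -> 0 <= l -> (T / 2 + h) * l <= L / 128 ->
  (2 + (h + 2^-1) * T + 2 * T * c2) * L <= G / Z ->
  D * (1 + m) + ((h + 2^-1) * u - h * m) * L + (T / 2 + h * m) * l + u * (c2 * lp) +
    N * ln (St / Sk) <= - (L / 10).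
Proof.
move=> h32 /andP[u0 uT] m0 L0 n0 Z0 Nn Sk0 SkZ St0 G0 dS /andP[lp0 lpL] c20 DL l0 lL GZ.
have T0 : 0 <= T by apply: le_trans uT.
have N0 : 0 <= N by apply: le_trans Nn; rewrite divr_ge0 // ltW.
have lnS : ln (St / Sk) <= - (G / 2) / Sk.
  have -> : St / Sk = 1 + (St - Sk) / Sk by field; rewrite gt_eqF.
  apply: (@le_trans _ _ ((St - Sk) / Sk)).
    apply: le_ln1Dx; rewrite mulrBl divff ?gt_eqF //.
    have : 0 < St / Sk by rewrite divr_gt0.
    by lra.
  by apply: ler_wpM2r; rewrite // invr_ge0 ltW.
have NS : N * ln (St / Sk) <= - (G / Z).
  apply: (@le_trans _ _ (N * (- (G / 2) / Sk))); first exact: ler_wpM2l.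
  rewrite mulNr mulrN lerN2.
  apply: (@le_trans _ _ (n / 2 * (G / 2 / (Z * n / 4)))).
    by rewrite le_eqVlt; apply/orP; left; apply/eqP; field; rewrite !gt_eqF.
  apply: ler_pM => //; [by rewrite divr_ge0 // ltW| |].
    by rewrite !divr_ge0 ?mulr_ge0 ?(ltW Z0) ?(ltW n0).
  apply: ler_wpM2l; first by rewrite divr_ge0.
  by rewrite lef_pV2 ?posrE ?divr_gt0 ?mulr_gt0.
have uL : (h + 2^-1) * u * L <= (h + 2^-1) * T * L.
  apply: ler_wpM2r; first exact: ltW.
  by apply: ler_wpM2l => //; lra.
have ulp : u * (c2 * lp) <= 2 * T * c2 * L.
  rewrite (_ : 2 * T * c2 * L = T * (c2 * (2 * L))); last by ring.
  apply: ler_pM => //; first exact: mulr_ge0.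
  exact: ler_wpM2l.
have Tl0 : 0 <= T / 2 * l by apply: mulr_ge0 => //; lra.
have hm : 3 / 2 * (m * L) <= h * (m * L) by apply: ler_wpM2r => //; apply: mulr_ge0 => //; exact: ltW.
have hl0 : 0 <= h * l by apply: mulr_ge0 => //; lra.
have mhl : m * (h * l) <= m * (L / 128) by apply: ler_wpM2l => //; lra.
have mD : m * (256 * D) <= m * L by apply: ler_wpM2l.
have mL : 0 <= m * L by apply: mulr_ge0 => //; exact: ltW.
have -> : D * (1 + m) + ((h + 2^-1) * u - h * m) * L + (T / 2 + h * m) * l + u * (c2 * lp) +
  N * ln (St / Sk) = D + D * m + (h + 2^-1) * u * L - h * (m * L) + T / 2 * l +
  m * (h * l) + u * (c2 * lp) + N * ln (St / Sk) by ring.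
lra.
Qed.

End LogBounds.

Section PosteriorRatio.
Context {R : realType}.

(** The normalizing sums of prior and posterior cancel. Should a denominator vanish, the quotient is
    0 by convention and the nonnegative bound still holds. *)
Lemma posterior_ratio_le r (alpha1 alpha2 c1 c2 : R) (q n p : nat) (X : 'M[R]_(n, p))
    (A : 'M[R]_p) (y : 'cV[R]_n) (k t : {set 'I_p}) (W : R) :
  0 < c1 -> (0 < p)%N -> (#|t| <= q)%N ->
  (forall j, 0 <= fine (marginal r alpha1 alpha2 (model_cols X j) (model_principal A j) y)) ->
  ((#|k| <= q)%N ->
    fine (marginal r alpha1 alpha2 (model_cols X k) (model_principal A k) y) <=
    expR W * fine (marginal r alpha1 alpha2 (model_cols X t) (model_principal A t) y)) ->
  posterior r alpha1 alpha2 c1 c2 q X A y k / posterior r alpha1 alpha2 c1 c2 q X A y t <=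
    (if (#|k| <= q)%N then expR (W + (#|t|%:R - #|k|%:R) * (ln c1 + c2 * ln p%:R)) else 0).
Proof.
move=> c10 p0 tq; pose mg (j : {set 'I_p}) :=
  fine (marginal r alpha1 alpha2 (model_cols X j) (model_principal A j) y).
move=> mg0; rewrite -/(mg k) -/(mg t) => mkt.
have pR : (0 : R) < p%:R by rewrite ltr0n.
have wE (j : {set 'I_p}) : c1 ^- #|j| * p%:R `^ (- (c2 * #|j|%:R)) =
    expR (- (#|j|%:R * (ln c1 + c2 * ln p%:R))).
  by rewrite (exprn_expRln _ c10) (powR_expRln _ pR) -expRN -expRD; congr expR; ring.
have w0 (j : {set 'I_p}) : 0 <= complexity_weight c1 c2 q j.
  by rewrite /complexity_weight; case: ifP => _; rewrite ?wE ?expR_ge0.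
set rho := if _ then _ else _.
have rho0 : 0 <= rho by rewrite /rho; case: ifP => _; rewrite ?expR_ge0.
have wm : complexity_weight c1 c2 q k * mg k <= rho * (complexity_weight c1 c2 q t * mg t).
  rewrite /rho /complexity_weight tq; case: ifP => kq; last by rewrite !mul0r.
  rewrite !wE mulrA -expRD.
  rewrite [X in expR X * mg t](_ : _ = - (#|k|%:R * (ln c1 + c2 * ln p%:R)) + W); last by ring.
  by rewrite expRD -mulrA; apply: ler_wpM2l; [exact: expR_ge0 | exact: mkt].
set jm := joint_mass r alpha1 alpha2 c1 c2 q X A y.
have jm0 j : 0 <= jm j.
  by apply: mulr_ge0 (mg0 j); apply: mulr_ge0 => //; rewrite invr_ge0 sumr_ge0.
have jkt : jm k <= rho * jm t.
  rewrite /jm /joint_mass -/(mg k) -/(mg t) /complexity_prior.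
  rewrite mulrAC (mulrAC _ _ (mg t)) mulrA; apply: ler_wpM2r => //.
  by rewrite invr_ge0 sumr_ge0.
rewrite /posterior -/jm; set S := \sum_j _.
have [->|St] := eqVneq S 0; first by rewrite invr0 !mulr0 mul0r.
have -> : jm k / S / (jm t / S) = jm k / jm t by rewrite invfM invrK mulrACA mulVf // mulr1.
have [t0|t0] := eqVneq (jm t) 0; first by rewrite t0 invr0 mulr0.
by rewrite ler_pdivrMr // lt0r t0 /=.
Qed.

End PosteriorRatio.

(** * The deterministic bound on the good event *)

Section Deterministic.
Context {R : realType}.
Context (r n p q : nat) (X : 'M[R]_(n, p)) (A : 'M[R]_p) (t : {set 'I_p})
  (bet : 'cV[R]_p) (e : 'cV[R]_n) (alpha1 alpha2 c1 c2 a1 a2 eps bm Bm s B : R).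
Hypothesis r0 : (0 < r)%N.
Hypothesis n0 : (0 < n)%N.
Hypothesis p0 : (0 < p)%N.
Hypothesis tq : (#|t| <= q)%N.
Hypothesis bet_t : supported t bet.
Hypothesis A_sym : A^T = A.
Hypothesis A_eig : forall a, eigenvalue A a -> a1 <= a <= a2.
Hypothesis a1_gt0 : 0 < a1.
Hypothesis a2_ge0 : 0 <= a2.
Hypothesis alpha1_gt0 : 0 < alpha1.
Hypothesis alpha2_gt0 : 0 < alpha2.
Hypothesis c1_gt0 : 0 < c1.
Hypothesis c2_ge0 : 0 <= c2.
Hypothesis eps01 : 0 < eps < 1.
Hypothesis bm_gt0 : 0 < bm.
Hypothesis bet_ge : forall i, i \in t -> bm <= `|bet i 0|.
Hypothesis bet_le : forall i, i \in t -> bet i 0 ^+ (2 * r) <= Bm.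
Hypothesis Bm1 : 1 <= Bm.
Hypothesis s_gt0 : 0 < s.
Hypothesis lam_ge : forall k, k != finset.set0 -> eps <= lambda_min X k.
Hypothesis lam_le : forall k, k != finset.set0 -> lambda_max X k <= eps^-1.

Let L : R := ln n%:R.
Let T : R := #|t|%:R.
Let h : R := r%:R + 2^-1.
(** Chosen so that every scale is at most [Z n / 4] when [|e|^2 <= 2 n s]; then twice the scale over
    [n/2 + alpha1] is at most [Z]. *)
Let Z : R := 1 + 4 * (s + bm ^+ 2 * T + alpha2).

Definition log_cst : R :=
  `|log_cst0 r t a1 bm Bm Z| +
  (T + 1) * (`|log_cst1 r a2| + h * `|ln (4 * h)| + h * T + `|ln c1|).

(* Thresholds for ln n, eps * ln n and n / ((q + 1) * ln n ^ 2). *)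
Definition growth_cst : seq R :=
  [:: 160; 256 * log_cst; 8192 * (T / 2 + h); 64 / s * (T / 2 + 2 * a2 * sqnorm bet);
      64 * (alpha1 + h * T); 256 * s / bm ^+ 2;
      64 * Z * (2 + (h + 2^-1) * T + 2 * T * c2) / bm ^+ 2; 4 / bm ^+ 2].

Definition noise_level (m : nat) : R := 2 * s * (17 / 16) * (m%:R + 1 / 16) * ln p%:R.

Hypothesis B_ge : forall x, x \in growth_cst -> x <= B.
Hypothesis BL : B <= L.
Hypothesis Beps : B * eps^-1 <= L.
Hypothesis Bq : B * (q%:R + 1) * L ^+ 2 <= n%:R.
Hypothesis e_bounds : 31 / 32 * (n%:R * s) <= sqnorm e <= 2 * (n%:R * s).
Hypothesis e_dot : forall (S : {set 'I_p}) d, supported (t :|: S)%SET d ->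
  dotv e (X *m d) ^+ 2 <= noise_level #|S| * sqnorm (X *m d).

Let nR : (0 : R) < n%:R. Proof. by rewrite ltr0n. Qed.
Let eps_gt0 : 0 < eps. Proof. by case/andP: eps01. Qed.
Let B160 : 160 <= B. Proof. by apply: B_ge; rewrite inE eqxx. Qed.
Let L160 : 160 <= L. Proof. exact: le_trans BL. Qed.
Let L_gt0 : 0 < L. Proof. by move: L160; lra. Qed.
Let ieps1 : 1 <= eps^-1. Proof. by rewrite invf_ge1 //; case/andP: eps01 => _ /ltW. Qed.
Let T_ge0 : 0 <= T. Proof. exact: ler0n. Qed.
Let h32 : 3 / 2 <= h.
Proof. have : (1 : R) <= r%:R by rewrite ler1n. by rewrite /h; lra. Qed.
Let bm2 : 0 < bm ^+ 2. Proof. exact: exprn_gt0. Qed.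
Let Z1 : 1 <= Z.
Proof. by rewrite /Z lerDl; have := mulr_ge0 (ltW bm2) T_ge0; move: s_gt0 alpha2_gt0; lra. Qed.

Let qL : 160 * ((q%:R + 1) * L) <= n%:R.
Proof.
have q1 : 0 <= (q%:R + 1 : R) by [].
apply: le_trans Bq; rewrite expr2 -mulrA; apply: ler_pM => //.
  by apply: mulr_ge0 => //; exact: ltW.
rewrite !mulrA ler_peMr // ?mulr_ge0 // ?(ltW L_gt0) //.
by move: L160; lra.
Qed.

Let Bn : B <= n%:R.
Proof. apply: (le_trans BL); apply: ltW; exact: ln_sublinear. Qed.

Let n160 : 160 <= n%:R :> R. Proof. exact: le_trans Bn. Qed.

(** [n * eps] measures the signal of one missing index, [(q + 1) ln n] the noise of the largest
    model. *)
Let neps : B * ((q%:R + 1) * L) <= n%:R * eps.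
Proof.
rewrite -ler_pdivrMr //; apply: le_trans Bq.
rewrite (_ : _ / eps = (q%:R + 1) * L * (B * eps^-1)); last by ring.
apply: (@le_trans _ _ ((q%:R + 1) * L * L)).
  by apply: ler_wpM2l => //; apply: mulr_ge0 => //; exact: ltW.
have -> : B * (q%:R + 1) * L ^+ 2 = B * ((q%:R + 1) * L * L) by ring.
rewrite ler_peMl //; last by move: B160; lra.
by rewrite !mulr_ge0 ?(ltW L_gt0).
Qed.

(** Ensures [#|t :|: k| <= n], so that the eigenvalue bound gives positive definiteness on
    [t :|: k]. *)
Let qn : (#|t| + q <= n)%N.
Proof.
have : (2 * q%:R : R) <= n%:R.
  apply: le_trans qL; have : (q%:R * 1 : R) <= q%:R * L by apply: ler_wpM2l => //; move: L160; lra.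
  by have : (0 : R) <= q%:R by []; move: L160; lra.
by rewrite -natrM ler_nat mul2n -addnn; apply: leq_trans; rewrite leq_add2r.
Qed.

Let lp0 : (0 : R) <= ln p%:R. Proof. by rewrite ln_ge0 // ler1n. Qed.

(** [dim_le] gives [ln p <= L + 2 ln(1 / eps)], and [160 / eps <= L] makes the last term at most
    [L / 80]. *)
Let lpL : ln p%:R <= 65 / 64 * L.
Proof.
have pe := dim_le n0 eps_gt0 lam_ge lam_le.
have pR : (0 : R) < p%:R by rewrite ltr0n.
have : ln (p%:R * eps ^+ 2) <= L by rewrite ler_ln ?posrE // mulr_gt0 // exprn_gt0.
rewrite lnM ?posrE ?exprn_gt0 // lnXn // -[ln eps]opprK -lnV ?posrE // mulNrn.
have : ln eps^-1 < eps^-1 by apply: ln_sublinear; rewrite invr_gt0.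
have : 160 * eps^-1 <= L by apply: le_trans Beps; apply: ler_wpM2r => //; rewrite invr_ge0 ltW.
by rewrite mulr2n; move: L_gt0; move: (ln p%:R) L (ln eps^-1) => u v w; lra.
Qed.

Let noise_ge0 m : 0 <= noise_level m.
Proof.
apply: mulr_ge0 => //; apply: mulr_ge0; first by move: s_gt0; lra.
by rewrite addr_ge0 // divr_ge0.
Qed.

Let noise_le m : (m <= q)%N -> noise_level m <= 3 * s * ((q%:R + 1) * L) * (31 / 32).
Proof.
move=> mq; rewrite /noise_level.
have : (m%:R + 1 / 16) * ln p%:R <= (q%:R + 1) * (65 / 64 * L) :> R.
  apply: ler_pM => //.
  have : (m%:R : R) <= q%:R by rewrite ler_nat.
  by lra.
move=> H; have := ler_wpM2l (ltW s_gt0) H.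
have : 0 <= s * ((q%:R + 1) * L) by rewrite mulr_ge0 // ?mulr_ge0 // ltW.
rewrite [s * (_ * (65 / 64 * L))](_ : _ = 65 / 64 * (s * ((q%:R + 1) * L))); last by ring.
rewrite (_ : 2 * s * _ * _ * _ = 2 * (17 / 16) * (s * ((m%:R + 1 / 16) * ln p%:R))); last by ring.
rewrite (_ : 3 * s * _ * _ = 93 / 32 * (s * ((q%:R + 1) * L))); last by field.
by move: (s * _) (s * ((q%:R + 1) * L)) => u v; lra.
Qed.

Notation St := (scale_true t bet e alpha2 a2 eps).
Notation Sk m := (scale_model t e alpha2 eps 32^-1 bm (noise_level m)).

Let neps_ge0 (k : {set 'I_p}) : 0 <= n%:R * eps * bm ^+ 2 * #|t :\: k|%:R.
Proof. by apply: mulr_ge0 => //; rewrite !mulr_ge0 // ltW. Qed.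

Let scaleE m (k : {set 'I_p}) : Sk m k = (sqnorm e - noise_level m * (32 / 31) +
  n%:R * eps * bm ^+ 2 * #|t :\: k|%:R / 32) / 2 + alpha2.
Proof. by rewrite /scale_model; field. Qed.

(** The energy is at least [31/32 n s] and the noise takes at most [3 n s / 160 < n s / 32]; half of
    the remaining [30/32] is [15/32]. *)
Let scale_ge m (k : {set 'I_p}) : (m <= q)%N -> 15 / 32 * (n%:R * s) <= Sk m k.
Proof.
move=> /noise_le; rewrite scaleE.
have /andP[] := e_bounds; have := neps_ge0 k.
have := ler_wpM2l (ltW s_gt0) qL.
rewrite [_ * s * _](_ : _ = 3 * (s * ((q%:R + 1) * L))); last by ring.
rewrite [s * (160 * _)](_ : _ = 160 * (s * ((q%:R + 1) * L))); last by ring.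
rewrite [s * n%:R]mulrC; move: alpha2_gt0.
move: (s * _) (n%:R * s) (noise_level m) (_ * #|_|%:R) => u v w x.
lra.
Qed.

Let scale_le m (k : {set 'I_p}) : Sk m k <= Z * n%:R / 4.
Proof.
rewrite scaleE; have /andP[_] := e_bounds; have := noise_ge0 m.
have : n%:R * eps * bm ^+ 2 * #|t :\: k|%:R <= n%:R * bm ^+ 2 * T.
  apply: ler_pM.
  - by rewrite !mulr_ge0 // ltW.
  - exact: ler0n.
  - apply: ler_wpM2r; first exact: ltW.
    by rewrite ger_pMr // ltW //; case/andP: eps01.
  - by rewrite ler_nat subset_leq_card // finset.subsetDl.
have : alpha2 * 160 <= alpha2 * n%:R by apply: ler_wpM2l => //; exact: ltW.
have : 0 <= n%:R * bm ^+ 2 * T by rewrite !mulr_ge0 // ltW.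
have -> : Z * n%:R / 4 = n%:R / 4 + n%:R * s + n%:R * bm ^+ 2 * T + alpha2 * n%:R by rewrite /Z; field.
move: alpha2_gt0 n160; move: (_ * #|_|%:R) (_ * T) (_ * s) (alpha2 * n%:R) (noise_level m) => u v w x z.
lra.
Qed.

Notation l := (- ln (32^-1 * eps / 2)).

Let sc0 : 0 < 32^-1 * eps / 2. Proof. by rewrite divr_gt0 // mulr_gt0 // invr_gt0. Qed.

Let l_ge0 : 0 <= l.
Proof.
rewrite oppr_ge0 ln_le0 //; case/andP: eps01 => _ e1; lra.
Qed.

Let l_le : (T / 2 + h) * l <= L / 128.
Proof.
have Th : 0 <= T / 2 + h by move: T_ge0 h32; lra.
have le : l <= 64 * eps^-1.
  rewrite -lnV ?posrE // [leRHS](_ : _ = (32^-1 * eps / 2)^-1); last by field; rewrite gt_eqF.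
  by apply/ltW/ln_sublinear; rewrite invr_gt0.
apply: (@le_trans _ _ ((T / 2 + h) * (64 * eps^-1))); first exact: ler_wpM2l.
have BT : 8192 * (T / 2 + h) <= B by apply: B_ge; rewrite !inE eqxx ?orbT.
have : 8192 * (T / 2 + h) * eps^-1 <= L.
  by apply: le_trans Beps; apply: ler_wpM2r => //; rewrite invr_ge0 ltW.
rewrite (_ : (T / 2 + h) * (64 * eps^-1) = (8192 * (T / 2 + h) * eps^-1) / 128); last by field; rewrite gt_eqF.
by move: (_ * eps^-1) => v; lra.
Qed.

Let DL : 256 * log_cst <= L.
Proof. by apply: le_trans BL; apply: B_ge; rewrite !inE eqxx ?orbT. Qed.

(** The terms [|e|^2 / 2] and [alpha2] cancel. The box and the prior form are of order [1 / eps] and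
    are absorbed into [s / 64 * L]; what remains is noise minus signal. *)
Let scale_sub m (k : {set 'I_p}) : St - Sk m k <=
  s / 64 * L + noise_level m * (16 / 31) - n%:R * eps * bm ^+ 2 * #|t :\: k|%:R / 64.
Proof.
have sb0 : 0 <= sqnorm bet by exact: sqnorm_ge0.
have BT : 64 / s * (T / 2 + 2 * a2 * sqnorm bet) <= B by apply: B_ge; rewrite !inE eqxx ?orbT.
have : (T / 2 + 2 * a2 * sqnorm bet) * eps^-1 <= s / 64 * L.
  rewrite [leLHS](_ : _ = s / 64 * (64 / s * (T / 2 + 2 * a2 * sqnorm bet) * eps^-1)).
    apply: ler_wpM2l; first by rewrite divr_ge0 // ltW.
    by apply: le_trans Beps; apply: ler_wpM2r => //; rewrite invr_ge0 ltW.
  by field; rewrite !gt_eqF.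
have n1 : n%:R^-1 <= eps^-1.
  by apply: le_trans ieps1; rewrite invf_le1 // ler1n.
have : a2 * sqnorm bet * n%:R^-1 <= a2 * sqnorm bet * eps^-1.
  by apply: ler_wpM2l => //; apply: mulr_ge0.
rewrite scaleE /scale_true -/T.
rewrite (_ : a2 * (4 * sqnorm bet) / (2 * n%:R) = 2 * (a2 * sqnorm bet * n%:R^-1)); last by field; rewrite gt_eqF.
rewrite (_ : (T / 2 + _) * eps^-1 = T * eps^-1 / 2 + 2 * (a2 * sqnorm bet * eps^-1)); last by ring.
move: (_ / n%:R) (_ * sqnorm bet / eps) (T / eps) (_ * #|_|%:R) (noise_level m) => u v w x y.
lra.
Qed.

Let fine_marginal_ge0 (k : {set 'I_p}) y :
  0 <= fine (marginal r alpha1 alpha2 (model_cols X k) (model_principal A k) y).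
Proof.
apply: fine_ge0; apply: integral_ge0 => tau _; apply: integral_ge0 => v _.
by apply: integral_cV_ge0 => b; rewrite lee_fin marginal_integrand_ge0.
Qed.

Let marginal_le_model (k : {set 'I_p}) : (#|k| <= q)%N ->
  fine (marginal r alpha1 alpha2 (model_cols X k) (model_principal A k) (X *m bet + e)) <=
  expR (log_ratio r t bet e alpha1 alpha2 a1 a2 eps 32^-1 bm Bm Z (noise_level #|k :\: t|) k) *
  fine (marginal r alpha1 alpha2 (model_cols X t) (model_principal A t) (X *m bet + e)).
Proof.
move=> kq.
have mq : (#|k :\: t| <= q)%N.
  by apply: leq_trans kq; rewrite subset_leq_card // finset.subsetDl.
have Sgt0 m (j : {set 'I_p}) : (m <= q)%N -> 0 < Sk m j.
  move=> mq'; apply: lt_le_trans (scale_ge j mq').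
  by apply: mulr_gt0; [lra | exact: mulr_gt0].
have SZ m (j : {set 'I_p}) : 2 * Sk m j / (n%:R / 2 + alpha1) <= Z.
  rewrite ler_pdivrMr; last by rewrite addr_gt0 // divr_gt0.
  have := scale_le m j; have : 0 <= Z * alpha1 by apply: mulr_ge0; [apply: le_trans Z1 | exact: ltW].
  by rewrite (mulrDr Z); move: (Sk m j) (Z * alpha1) Z => u v w; lra.
have tkE : (t :|: (k :\: t) = t :|: k)%SET.
  by apply/setP => i; rewrite !inE; case: (i \in t).
have tkn : (#|t :|: k| <= n)%N.
  by apply: leq_trans qn; apply: leq_trans (finset.leq_card_setU _ _) _; rewrite leq_add2l.
have bmB : 4 / bm ^+ 2 <= n%:R.
  by apply: le_trans Bn; apply: B_ge; rewrite !inE eqxx ?orbT.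
(* [th = 1/32] inflates the noise by [32/31] only and keeps a fixed fraction of the signal. For the
   true model the level is [noise_level 0]. *)
apply: (@marginal_ratio_le R r n p X A t bet e alpha1 alpha2 a1 a2 eps 32^-1 bm Bm Z
  r0 n0 bet_t A_sym A_eig a1_gt0 a2_ge0 alpha1_gt0 alpha2_gt0 eps_gt0 _ bm_gt0
  bet_ge bet_le Bm1 Z1 _ _ _ _ _ (noise_level 0)) => //.
- by rewrite invr_gt0 ltr0n /= invf_lt1 ?ltr1n.
- rewrite powRN powR12_sqrt ?ler0n // -[leRHS]invf_div lef_pV2 ?posrE ?sqrtr_gt0 ?divr_gt0 //.
  rewrite -[leLHS]ger0_norm ?divr_ge0 ?(ltW bm_gt0) // -sqrtr_sqr ler_wsqrtr //.
  by rewrite expr_div_n -natrX.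
- have : B * 1 <= B * ((q%:R + 1) * L).
    apply: ler_wpM2l; first by move: B160; lra.
    by apply: mulr_ege1; [rewrite lerDr | move: L160; lra].
  move: neps B160; rewrite (_ : 32^-1 * _ * _ / 2 = n%:R * eps / 64); last by field.
  by move: (n%:R * eps) (B * (_ * _)) => u v; lra.
- by move: n160; lra.
- move=> d dt; apply: gram_upper dt => //; first by rewrite invr_ge0 ltW.
  exact: lam_le.
- exact: Sgt0.
- exact: Sgt0.
- by move=> d dtk; apply: gram_lower dtk => //; exact: lam_ge.
- by rewrite -tkE => d; exact: e_dot.
- move=> d dt; have := @e_dot finset.set0 d; rewrite finset.setU0 finset.cards0; exact.
Qed.

Let log_ratio_neg (k : {set 'I_p}) : k != t -> (#|k| <= q)%N ->
  log_ratio r t bet e alpha1 alpha2 a1 a2 eps 32^-1 bm Bm Z (noise_level #|k :\: t|) k +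
  (#|t|%:R - #|k|%:R) * (ln c1 + c2 * ln p%:R) <= - (L / 10).
Proof.
move=> kt kq.
have mq : (#|k :\: t| <= q)%N.
  by apply: leq_trans kq; rewrite subset_leq_card // finset.subsetDl.
pose K : R := #|k|%:R; pose m : R := #|k :\: t|%:R; pose u : R := #|t :\: k|%:R.
have KE : K = T - u + m.
  rewrite /K /T -(finset.cardsID t k) -(finset.cardsID k t) finset.setIC !natrD /u /m; ring.
have iE : #|k :&: t|%:R = K - m :> R.
  by rewrite /K -(finset.cardsID t k) natrD addrK.
have uT : 0 <= u <= T by rewrite ler0n ler_nat subset_leq_card // finset.subsetDl.
have m0 : 0 <= m by exact: ler0n.
have h1 : 0 < h by move: h32; lra.
have h0 := ltW h1.
have kn : (#|k| <= n)%N by apply: leq_trans qn; apply: leq_trans kq _; exact: leq_addl.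
(* The empty model is covered by the convention [ln 0 = 0]. *)
have lkK : ln K <= K.
  have [k0|k0] := posnP #|k|; first by rewrite /K k0 ln0.
  by apply: ltW; apply: ln_sublinear; rewrite ltr0n.
have lkL : ln K <= L.
  have [k0|k0] := posnP #|k|; first by rewrite /K k0 ln0 // ltW.
  by rewrite ler_ln ?posrE ?ltr0n // ler_nat.
set St := St; set Sk := Sk #|k :\: t| k.
have hK : h * K * ln (4 * (h * K) / n%:R) = h * K * (ln (4 * h) + ln K - L).
  have [k0|k0] := posnP #|k|; first by rewrite /K k0 !(mulr0, mul0r).
  have K0 : 0 < K by rewrite ltr0n.
  have h4 : 0 < 4 * h by rewrite mulr_gt0 // (lt_le_trans _ h32).
  congr (_ * _); rewrite (mulrA 4) ln_div ?posrE ?mulr_gt0 //.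
  by rewrite (lnM (x := 4 * h)) ?posrE.
have cE : ln (32^-1 * n%:R * eps / 2) = L - l.
  rewrite opprK /L -lnM ?posrE //; congr ln; ring.
rewrite [leLHS](_ : _ =
  log_cst0 r t a1 bm Bm Z + K * log_cst1 r a2 - ((K - m) / 2 + h * m) * (L - l) +
    h * K * (ln (4 * h) + ln K - L) + (T / 2 + h * T) * L +
    (n%:R / 2 + alpha1 + h * T) * ln (St / Sk) + (T - K) * (ln c1 + c2 * ln p%:R)); last first.
  by rewrite /log_ratio -/h -/K hK cE iE.
apply: (le_trans (log_terms_le _ KE uT m0 h0 c2_ge0 lp0 l_ge0 lkK lkL (lexx log_cst))).
have := scale_sub #|k :\: t| k; rewrite -/St -/Sk -/u => dS.
have St0 : 0 < St by exact: scale_true_gt0.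
have Skn : 15 / 32 * (n%:R * s) <= Sk by exact: scale_ge.
have Sk0 : 0 < Sk by apply: lt_le_trans Skn; rewrite mulr_gt0 // mulr_gt0.
have a0 : 0 <= h * T by apply: mulr_ge0.
have Na : alpha1 + h * T <= n%:R / 64.
  have : 64 * (alpha1 + h * T) <= n%:R.
    by apply: le_trans Bn; apply: B_ge; rewrite !inE eqxx ?orbT.
  by move: (alpha1 + _) => v; lra.
have nlE : noise_level #|k :\: t| * (16 / 31) = 17 / 16 * s * (m + 1 / 16) * ln p%:R * (32 / 31).
  by rewrite /noise_level -/m; field.
have [u0|u0] := posnP #|t :\: k|.
  have u0' : u = 0 by rewrite /u u0.
  have m1 : 1 <= m.
    rewrite ler1n lt0n; apply: contra kt => /eqP/finset.cards0_eq m0'.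
    move/finset.cards0_eq: u0 => u0; rewrite finset.eqEsubset.
    by rewrite -!finset.setD_eq0 u0 m0' eqxx.
  rewrite u0' !mulr0 sub0r mul0r addr0 -mulNr.
  apply: (overfit_log_le (lp := ln p%:R) (n := n%:R) h32 T_ge0 m1 L_gt0 s_gt0 nR _ Skn St0 _ _ DL l_ge0 l_le).
  - by apply/andP; split; move: Na a0 alpha1_gt0 nR; move: (h * T) => v; lra.
  - by rewrite -nlE; apply: (le_trans dS); rewrite u0' mulr0 mul0r subr0.
  - by rewrite lp0 lpL.
have u1 : 1 <= u by rewrite ler1n.
have Z0 : 0 < Z by apply: lt_le_trans Z1.
have G0 : 0 <= n%:R * eps * bm ^+ 2 * u / 64 by rewrite divr_ge0 // neps_ge0.
have n1 : B * ((q%:R + 1) * L) * bm ^+ 2 <= n%:R * eps * bm ^+ 2 * u.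
  rewrite -[leLHS]mulr1; apply: ler_pM => //.
    by rewrite !mulr_ge0 // ltW // (lt_le_trans _ B160).
  by apply: ler_wpM2r => //; exact: ltW.
have q1 : L <= (q%:R + 1) * L by rewrite ler_peMl ?(ltW L_gt0) // lerDr.
apply: (underfit_log_le (n := n%:R) (Z := Z) h32 uT m0 L_gt0 nR Z0 _ Sk0 _ St0 G0 _ _ c2_ge0 DL
  l_ge0 l_le _).
- by move: a0 alpha1_gt0; move: (h * T) => v; lra.
- exact: scale_le.
- apply: (le_trans dS).
  have B1 : 256 * s / bm ^+ 2 <= B by apply: B_ge; rewrite !inE eqxx ?orbT.
  have : 256 * (s * ((q%:R + 1) * L)) <= n%:R * eps * bm ^+ 2 * u.
    apply: le_trans n1.
    rewrite (_ : 256 * _ = 256 * s / bm ^+ 2 * ((q%:R + 1) * L) * bm ^+ 2); last first.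
      by field; rewrite gt_eqF.
    apply: ler_wpM2r; first exact: ltW.
    by apply: ler_wpM2r => //; rewrite mulr_ge0 // ltW.
  have := noise_le mq; have := ler_wpM2l (ltW s_gt0) q1.
  rewrite (_ : 3 * s * _ * _ = 93 / 32 * (s * ((q%:R + 1) * L))); last by field.
  rewrite (_ : s / 64 * L = (s * L) / 64); last by field.
  have : 0 <= s * L by rewrite mulr_ge0 // ltW.
  move: (s * ((q%:R + 1) * L)) (s * L) (noise_level _) (n%:R * eps * bm ^+ 2 * u) => v w x y.
  lra.
- by rewrite lp0 (le_trans lpL) //; move: L_gt0; move: L => v; lra.
have B2 : 64 * Z * (2 + (h + 2^-1) * T + 2 * T * c2) / bm ^+ 2 <= B.
  by apply: B_ge; rewrite !inE eqxx ?orbT.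
rewrite ler_pdivlMr // ler_pdivlMr //; apply: le_trans n1.
set v := 2 + _ + _ in B2 *.
rewrite (_ : v * L * Z * 64 = 64 * Z * v / bm ^+ 2 * L * bm ^+ 2); last by field; rewrite gt_eqF.
apply: ler_wpM2r; first exact: ltW.
apply: ler_pM => //; last exact: ltW.
have c2T : 0 <= T * c2 by rewrite mulr_ge0.
have hT : 0 <= (h + 2^-1) * T by rewrite mulr_ge0 // addr_ge0.
rewrite divr_ge0 ?(ltW bm2) // mulr_ge0 ?mulr_ge0 ?(ltW Z0) // /v.
by move: c2T hT; rewrite -(mulrA 2); move: (T * c2) (_ * T) => x y; lra.
Qed.

Lemma max_posterior_ratio_le :
  max_posterior_ratio r alpha1 alpha2 c1 c2 q X A t (X *m bet + e) <= expR (- (L / 10)).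
Proof.
apply/bigmax_leP; split=> [|k kt]; first exact: expR_ge0.
apply: (le_trans (posterior_ratio_le c2 c1_gt0 p0 tq (fun j => fine_marginal_ge0 j _)
  (@marginal_le_model k))).
by case: ifP => kq; rewrite ?expR_ge0 // ler_expR log_ratio_neg.
Qed.

End Deterministic.

(** * Convergence in probability *)

Section GoodEvent.
Context {R : realType}.
Context d (Om : measurableType d) (P : probability Om R) (n : nat)
  (e : 'I_n -> {RV P >-> R}) (s : R).
Hypothesis s0 : 0 < s.
Hypothesis e_iid : iid_centered_normal e s.

Let s20 : 0 < s ^+ 2. Proof. exact: exprn_gt0. Qed.

(** [ln (1 + v) <= v] applied to [(1 - x)^(-1) = 1 + x / (1 - x)], for either sign of [x]. *)
Lemma powR_half_le (x : R) : x < 1 ->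
  (1 - x) `^ (- 2^-1) <= expR (x / (2 * (1 - x))).
Proof.
move=> x1; have x0 : 0 < 1 - x by rewrite subr_gt0.
rewrite (powR_expRln _ x0) ler_expR mulNr -mulrN -lnV ?posrE //.
have xE : (1 - x)^-1 = 1 + x / (1 - x) by field; rewrite gt_eqF.
rewrite [leRHS](_ : _ = 2^-1 * (x / (1 - x))); last by field; rewrite gt_eqF.
apply: ler_wpM2l => //; rewrite {1}xE; apply: le_ln1Dx.
have : 0 < (1 - x)^-1 by rewrite invr_gt0.
by rewrite {1}xE; move: (x / _) => v; lra.
Qed.

Let measurable_energy : measurable_fun setT (fun w => sqnorm (noise_vec e w)).
Proof.
rewrite /sqnorm; under eq_fun do under eq_bigr do rewrite mxE.
by apply: measurable_sum => i; apply: measurable_funX.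
Qed.

(** Chernoff bound for both tails at once: positive [x] controls large energies, negative [x] small
    ones. *)
Lemma energy_tail (x K : R) : x < 1 ->
  (P [set w | (K <= x / s ^+ 2 / 2 * sqnorm (noise_vec e w))%R] <=
   (expR (n%:R * (x / (2 * (1 - x))) - K))%:E)%E.
Proof.
move=> x1; have xs : x / s ^+ 2 * s ^+ 2 = x by rewrite divfK ?gt_eqF.
set a := x / s ^+ 2 in xs *.
rewrite (_ : [set w | _] = [set w | 0 <= a / 2 * sqnorm (noise_vec e w) - K]); last first.
  by apply/seteqP; split => w /=; rewrite subr_ge0.
apply: exp_markov.
  by apply: measurable_funB => //; exact: measurable_funM.
under eq_integral => w _ do rewrite addrC expRD.
rewrite integralZl_EFin_nonneg.
- rewrite (expectation_energy_exp s0 e_iid) ?xs // -EFinM lee_fin (addrC _ (- K)) expRD.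
  apply: ler_wpM2l; first exact: expR_ge0.
  rewrite expRM_natl; apply: lerXn2r; rewrite ?nnegrE ?powR_ge0 ?expR_ge0 //.
  exact: powR_half_le.
- exact: expR_ge0.
- exact: measurableT.
- by apply: measurableT_comp => //; exact: measurable_funM.
- by move=> w _; exact: expR_ge0.
Qed.

Context (p : nat) (X : 'M[R]_(n, p)) (t : {set 'I_p}).

Lemma measure_bigU_le (I : Type) (r : seq I) (F : I -> set Om) (b : I -> R) :
  (forall i, measurable (F i)) -> (forall i, (P (F i) <= (b i)%:E)%E) ->
  (P (\big[setU/set0]_(i <- r) F i) <= (\sum_(i <- r) b i)%:E)%E.
Proof.
move=> mF Fb; elim: r => [|i r IH]; first by rewrite !big_nil measure0.
rewrite !big_cons EFinD.
have mU : measurable (\big[setU/set0]_(j <- r) F j).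
  by apply: bigsetU_measurable => j _; exact: mF.
by apply: (le_trans (measureU2 P (mF i) mU)); apply: leeD (Fb i) IH.
Qed.

Lemma sum_subset_exp (x : R) : \sum_(S : {set 'I_p}) x ^+ #|S| = (1 + x) ^+ p.
Proof.
rewrite addrC -[in RHS](card_ord p) -prodr_const.
rewrite (@finset.bigA_distr R 0 1 *%R +%R _ (fun=> x) (fun=> 1)).
by apply: eq_big => // S _; rewrite -big_mkcond prodr_const.
Qed.

(* The chi-square tail is taken at exponent 31/32: since 31/32 * 17/16 > 1, the sum
   over all S of the bounds, a multiple of (1 + 6 * p ^ (- 527/512)) ^ p, is bounded,
   and the term 1/16 in noise_level leaves a negative power of p in front. *)
Lemma good_event : (0 < p)%N -> exists Bad : set Om, [/\ measurable Bad,
  (P Bad <= (2 * expR (- (n%:R / 8064)) +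
     6 ^+ #|t| * expR 6 * expR (- (527 / 8192 * ln p%:R)))%:E)%E &
  forall w, ~ Bad w ->
    31 / 32 * (n%:R * s ^+ 2) <= sqnorm (noise_vec e w) <= 2 * (n%:R * s ^+ 2) /\
    forall (S : {set 'I_p}) u, supported (t :|: S)%SET u ->
      dotv (noise_vec e w) (X *m u) ^+ 2 <=
      noise_level p (s ^+ 2) #|S| * sqnorm (X *m u)].
Proof.
move=> p0.
have pR : (0 : R) < p%:R by rewrite ltr0n.
have lp0 : (0 : R) <= ln p%:R by rewrite ln_ge0 // ler1n.
have basis (S : {set 'I_p}) : exists bs : seq 'cV[R]_n, [/\ (size bs <= #|t :|: S|)%N,
    orthonormal bs & forall v u, supported (t :|: S) u ->
      dotv v (X *m u) ^+ 2 <= (\sum_(b <- bs) dotv v b ^+ 2) * sqnorm (X *m u)].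
  exact: model_basis.
have [bs bsP] := choice basis.
pose NL (S : {set 'I_p}) : R := noise_level p (s ^+ 2) #|S|.
(* [x = 1/4] for the upper tail gives exponent [n/6 - n/4]; [x = -1/63] for the lower one gives
   [- n/128 + 31 n/4032 = - n/8064], the slower rate, used for both. *)
pose B1 := [set w | (n%:R / 4 <= 1 / 4 / s ^+ 2 / 2 * sqnorm (noise_vec e w))%R].
pose B2 := [set w | (- (31 / 4032 * n%:R) <= - (1 / 63) / s ^+ 2 / 2 * sqnorm (noise_vec e w))%R].
pose B3 S := [set w | (NL S <= \sum_(b <- bs S) dotv (noise_vec e w) b ^+ 2)%R].
have mge (f : Om -> R) K : measurable_fun setT f -> measurable [set w | K <= f w].
  move=> mf; rewrite (_ : [set w | _] = f @^-1` `[K, +oo[).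
    by rewrite -[X in measurable X]setTI; apply: mf => //; exact: measurable_itv.
  by apply/seteqP; split => w /=; rewrite in_itv /= andbT.
have mB1 : measurable B1 by apply: mge; exact: measurable_funM.
have mB2 : measurable B2 by apply: mge; exact: measurable_funM.
have mB3 S : measurable (B3 S).
  apply: mge; apply: measurable_sum => b.
  by apply: measurable_funX; exact: measurable_dotv_noise.
pose x : R := 6 * expR (- (527 / 512 * ln p%:R)).
have x0 : 0 <= x by rewrite mulr_ge0 ?expR_ge0.
pose c : R := 6 ^+ #|t| * expR (- (527 / 8192 * ln p%:R)).
have c0 : 0 <= c by rewrite mulr_ge0 ?expR_ge0 ?exprn_ge0.
have mU : measurable (\big[setU/set0]_(S : {set 'I_p}) B3 S).
  by apply: bigsetU_measurable => S _; exact: mB3.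
exists (B1 `|` B2 `|` \big[setU/set0]_(S : {set 'I_p}) B3 S); split.
- by apply: measurableU => //; exact: measurableU.
- apply: (le_trans (measureU2 P (measurableU _ _ mB1 mB2) mU)).
  rewrite EFinD; apply: leeD.
    apply: (le_trans (measureU2 P mB1 mB2)).
    rewrite mulr2n mulrDl mul1r EFinD; apply: leeD.
      apply: (le_trans (energy_tail _ _)); first by lra.
      have -> : 1 / 4 / (2 * (1 - 1 / 4)) = 6^-1 :> R by field.
      by rewrite lee_fin ler_expR; have : (0 : R) <= n%:R by []; lra.
    apply: (le_trans (energy_tail _ _)); first by lra.
    have -> : - (1 / 63) / (2 * (1 - - (1 / 63))) = - 128^-1 :> R by field.
    by rewrite lee_fin ler_expR; have : (0 : R) <= n%:R by []; lra.
  apply: (@le_trans _ _ (\sum_(S : {set 'I_p}) c * x ^+ #|S|)%:E).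
    apply: measure_bigU_le => // S.
    have as1 : 31 / 32 / s ^+ 2 * s ^+ 2 = 31 / 32 by rewrite divfK ?gt_eqF.
    have [szS oS _] := bsP S.
    apply: (le_trans (chi_square_tail s0 e_iid (a := 31 / 32 / s ^+ 2) _ _ _ oS)).
    + by rewrite divr_gt0.
    + by rewrite as1; lra.
    rewrite as1 lee_fin.
    (* Each direction costs [sqrt 32], rounded up to 6. *)
    have r6 : (1 - 31 / 32 : R) `^ (- 2^-1) <= 6.
      have -> : (1 - 31 / 32 : R) = 32^-1 by field.
      rewrite powR_inv // opprK powR12_sqrt //.
      rewrite -[leRHS]ger0_norm // -sqrtr_sqr ler_wsqrtr //; lra.
    have sz : (size (bs S) <= #|t| + #|S|)%N.
      by apply: leq_trans szS _; exact: finset.leq_card_setU.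
    set z := _ `^ _ in r6 *; have z0 : 0 <= z by exact: powR_ge0.
    apply: (@le_trans _ _ (expR (- (31 / 32 / s ^+ 2 / 2 * NL S)) * 6 ^+ (#|t| + #|S|))).
      apply: ler_wpM2l; first exact: expR_ge0.
      apply: (@le_trans _ _ (6 ^+ size (bs S))); first by apply: lerXn2r; rewrite ?nnegrE.
      by apply: ler_weXn2l sz; rewrite ler1n.
    rewrite /c /x exprMn -expRM_natl exprD.
    rewrite [leRHS](_ : _ = expR (- (527 / 8192 * ln p%:R) + #|S|%:R * - (527 / 512 * ln p%:R))
      * (6 ^+ #|t| * 6 ^+ #|S|)); last by rewrite expRD; ring.
    apply: ler_wpM2r; first by rewrite mulr_ge0 ?exprn_ge0.
    rewrite ler_expR le_eqVlt; apply/orP; left; apply/eqP.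
    by rewrite /NL /noise_level; field; rewrite gt_eqF.
  rewrite lee_fin -mulr_sumr sum_subset_exp /c mulrAC.
  apply: ler_wpM2r; first exact: expR_ge0.
  apply: ler_wpM2l; first exact: exprn_ge0.
  apply: (@le_trans _ _ (expR x ^+ p)).
    by apply: lerXn2r; rewrite ?nnegrE ?expR_ge0 ?addr_ge0 // expR_ge1Dx.
  have px : p%:R * expR (- (527 / 512 * ln p%:R)) <= 1 :> R.
    have pE : expR (ln p%:R) = p%:R :> R by rewrite lnK // posrE.
    rewrite -[X in X * _]pE -expRD -[leRHS]expR0 ler_expR.
    by move: lp0; move: (ln _) => v; lra.
  rewrite -expRM_natl ler_expR [leLHS](_ : _ = 6 * (p%:R * expR (- (527 / 512 * ln p%:R)))).
    by move: px; move: (_ * expR _) => v; lra.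
  by rewrite /x; ring.
move=> w /not_orP[/not_orP[nB1 nB2] nB3]; split.
  move/negP: nB1; rewrite -ltNge => lt1; move/negP: nB2; rewrite -ltNge => lt2.
  set E := sqnorm _ in lt1 lt2 *.
  apply/andP; split.
    rewrite -subr_ge0 -(@pmulr_lge0 _ (126 * s ^+ 2)^-1) ?invr_gt0 ?mulr_gt0 //.
    rewrite (_ : _ * _ = - (- (1 / 63) / s ^+ 2 / 2 * E) - 31 / 4032 * n%:R); last first.
      by field; rewrite gt_eqF.
    by move: lt2; move: (_ * E) => v; lra.
  rewrite -subr_ge0 -(@pmulr_lge0 _ (8 * s ^+ 2)^-1) ?invr_gt0 ?mulr_gt0 //.
  rewrite (_ : _ * _ = n%:R / 4 - 1 / 4 / s ^+ 2 / 2 * E); last first.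
    by field; rewrite gt_eqF.
  by move: lt1; move: (_ * E) => v; lra.
move=> S u tu; have [_ _ /(_ (noise_vec e w) u tu)] := bsP S.
move/le_trans; apply; apply: ler_wpM2r; first exact: sqnorm_ge0.
rewrite leNgt; apply/negP => lt; apply: nB3.
rewrite (bigD1 S) //=; left; exact: ltW.
Qed.

End GoodEvent.

(** * Growth of the sequences *)

Section Asymptotics.
Context {R : realType}.

Lemma ln_nat_near (M : R) : \forall n \near \oo, M <= ln n%:R.
Proof.
near=> n; have nM : expR M <= n%:R by near: n; exact: nbhs_infty_ger.
rewrite -[M]expRK ler_ln // posrE ?expR_gt0 //.
by apply: lt_le_trans nM; exact: expR_gt0.
Unshelve. all: by end_near.
Qed.

(** [(ln n)^(1/8)] is at most [sqrt (ln n)], and [B K sqrt (ln n) <= ln n] as soon as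
    [ln n >= (B K)^2]. *)
Lemma inv_eps_near (eps : nat -> R) (B : R) :
  (fun n => ((eps n)^-1)%R : R^o) =O_\oo (fun n => (ln n%:R `^ (1 / 8))%R : R^o) ->
  0 <= B -> \forall n \near \oo, B * (eps n)^-1 <= ln n%:R.
Proof.
move=> /eqO_exP[K K0 epsK] B0; near=> n.
have : `|(eps n)^-1| <= K * `|ln n%:R `^ (1 / 8)| by near: n.
have L1 : 1 + (B * K) ^+ 2 <= ln n%:R by near: n; exact: ln_nat_near.
move: (ln n%:R) L1 => y y1; rewrite (ger0_norm (powR_ge0 _ _)) => epsy.
have y0 : 1 <= y by apply: le_trans y1; rewrite lerDl sqr_ge0.
have BK0 : 0 <= B * K by rewrite mulr_ge0 // ltW.
apply: (@le_trans _ _ (B * (K * Num.sqrt y))).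
  apply: ler_wpM2l => //; apply: (le_trans (ler_norm _)); apply: (le_trans epsy).
  by apply: ler_wpM2l; [exact: ltW|rewrite -powR12_sqrt ?(le_trans ler01) // ler_powR //; lra].
have y0' : 0 <= y by apply: le_trans y0.
rewrite mulrA -[leRHS](sqr_sqrtr y0') expr2; apply: ler_wpM2r; first exact: sqrtr_ge0.
rewrite -[leLHS](ger0_norm BK0) -sqrtr_sqr ler_wsqrtr //.
by apply: le_trans y1; rewrite lerDr.
Unshelve. all: by end_near.
Qed.

(** With [y = ln n], [q + 1] is at most a multiple of [n^(1 - 3 z)]; the spare factor
    [n^(3 z) = exp(3 z y)] is at least [(z y)^3], which outgrows [y^2]. *)
Lemma model_size_near (q : nat -> nat) (xi B : R) : xi < 1 ->
  (fun n => ((q n)%:R)%R : R^o) =O_\oo (fun n => (n%:R `^ xi)%R : R^o) ->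
  0 <= B -> \forall n \near \oo, B * ((q n)%:R + 1) * ln n%:R ^+ 2 <= n%:R.
Proof.
move=> xi1 /eqO_exP[K K0 qK] B0.
(* The maximum with 0 lets the [+ 1] be absorbed even for negative [xi]. *)
pose z := (1 - Num.max xi 0) / 3.
have z0 : 0 < z by rewrite divr_gt0 // subr_gt0 gt_max xi1 ltr01.
have c0 : 0 <= B * (K + 1) / z ^+ 3.
  apply: divr_ge0; last by apply: exprn_ge0; exact: ltW.
  by apply: mulr_ge0 => //; apply: addr_ge0 => //; exact: ltW.
near=> n.
have : `|(q n)%:R : R^o| <= K * `|n%:R `^ xi| by near: n.
have L1 : 1 + B * (K + 1) / z ^+ 3 <= ln n%:R by near: n; exact: ln_nat_near.
have nR : (0 : R) < n%:R.
  rewrite lt0r ler0n andbT; apply/negP => /eqP n0.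
  by move: c0 L1; rewrite n0 ln0 //; move: (_ / _) => v; lra.
rewrite (ger0_norm (powR_ge0 _ _)) ger0_norm ?ler0n // => qn.
set y := ln n%:R in L1 *.
have nE : n%:R = expR y :> R by rewrite lnK.
have y0 : 1 <= y by apply: le_trans L1; rewrite lerDl.
have y0' : 0 <= y by apply: le_trans y0.
have q1 : (q n)%:R + 1 <= (K + 1) * expR (y - 3 * (z * y)).
  have zE : y - 3 * (z * y) = Num.max xi 0 * y by rewrite /z; field.
  rewrite zE mulrDl mul1r; apply: lerD.
    apply: (le_trans qn); apply: ler_wpM2l; first exact: ltW.
    by rewrite (powR_expRln _ nR) ler_expR ler_wpM2r // le_max lexx.
  by rewrite -[leLHS]expR0 ler_expR mulr_ge0 // le_max lexx orbT.
have ez : z * y <= expR (z * y) by apply: le_trans (expR_ge1Dx _); rewrite lerDr.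
have zy0 : 0 <= z * y by rewrite mulr_ge0 // ltW.
apply: (@le_trans _ _ (B * ((K + 1) * expR (y - 3 * (z * y))) * y ^+ 2)).
  by apply: ler_wpM2r; [exact: exprn_ge0 | exact: ler_wpM2l].
have -> : B * ((K + 1) * expR (y - 3 * (z * y))) * y ^+ 2 =
  (B * (K + 1) * y ^+ 2) * expR (y - 3 * (z * y)) by ring.
have -> : n%:R = expR (3 * (z * y)) * expR (y - 3 * (z * y)) :> R.
  by rewrite nE -expRD; congr expR; ring.
apply: ler_wpM2r; first exact: expR_ge0.
apply: (@le_trans _ _ ((z * y) ^+ 3)); last first.
  by rewrite (expRM_natl 3); apply: lerXn2r; rewrite ?nnegrE ?expR_ge0.
have -> : (z * y) ^+ 3 = z ^+ 3 * y * y ^+ 2 by ring.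
apply: ler_wpM2r; first exact: exprn_ge0.
rewrite (mulrC _ y) -ler_pdivrMr ?exprn_gt0 //.
by apply: le_trans L1; rewrite lerDr.
Unshelve. all: by end_near.
Qed.

Lemma expR_cvg0 (u : nat -> R) : (forall M, \forall n \near \oo, M <= u n) ->
  (fun n => expR (- u n)) @ \oo --> (0 : R).
Proof.
move=> uoo; apply/cvgrPdist_le => e e0; near=> n.
rewrite sub0r normrN ger0_norm ?expR_ge0 // expRN.
have un : e^-1 <= u n by near: n; exact: uoo.
rewrite -[leRHS]invrK lef_pV2 ?posrE ?invr_gt0 ?expR_gt0 //.
apply: (le_trans un); apply: le_trans (expR_ge1Dx _); by rewrite lerDr.
Unshelve. all: by end_near.
Qed.

End Asymptotics.

(** * Quantities of the true model do not depend on n *)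

Section FixedSupport.
Context {R : realType}.
Variables (beta0 : nat -> R) (p1 p2 : nat).
Hypothesis p12 : (p1 <= p2)%N.
Hypothesis supp : forall j, beta0 j != 0 -> (j < p1)%N.

Lemma card_true_model : #|true_model beta0 p2| = #|true_model beta0 p1|.
Proof.
have cardE m : #|true_model beta0 m| = (\sum_(i < m) (beta0 i != 0)%R)%N.
  by rewrite -sum1_card big_mkcond; apply: eq_bigr => i _; rewrite inE; case: (_ == _).
rewrite !cardE [RHS](big_ord_widen p2 (fun i => (beta0 i != 0) : nat)) // [RHS]big_mkcond /=.
apply: eq_bigr => i _; case: ifPn => // ip.
by have [//|/supp] := eqVneq (beta0 i) 0; rewrite (negbTE ip).
Qed.

Lemma sqnorm_true_coef : sqnorm (true_coef beta0 p2) = sqnorm (true_coef beta0 p1).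
Proof.
rewrite /sqnorm; under eq_bigr do rewrite mxE; under [RHS]eq_bigr do rewrite mxE.
rewrite [RHS](big_ord_widen p2 (fun i => beta0 i ^+ 2)) // [RHS]big_mkcond /=.
apply: eq_bigr => i _; case: ifPn => // ip.
have [->|/supp] := eqVneq (beta0 i) 0; first by rewrite expr0n.
by rewrite (negbTE ip).
Qed.

End FixedSupport.

Theorem theorem5p1 (R : realType)
    (p : nat -> nat)
    (p_incr : {homo p : m n / (m <= n)%N}) (p_oo : p @ \oo --> \oo)
    (X : forall n, 'M[R]_(n, p n)) (A : forall n, 'M[R]_(p n))
    (A_sym : forall n, (0 < n)%N -> (A n)^T = A n)
    (beta0 : nat -> R) (sigma0 : R) (sigma0_gt0 : 0 < sigma0)
    (beta0_supp : forall n, (0 < n)%N -> forall j, beta0 j != 0 -> (j < p n)%N)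
    (d : nat -> measure_display) (T : forall n, measurableType (d n))
    (P : forall n, probability (T n) R)
    (noise : forall n, 'I_n -> {RV (P n) >-> R})
    (noise_iid : forall n, (0 < n)%N ->
       iid_centered_normal (noise n) sigma0)
    (r : nat) (r_gt0 : (0 < r)%N) (alpha1 alpha2 c1 c2 : R)
    (alpha1_gt0 : 0 < alpha1) (alpha2_gt0 : 0 < alpha2)
    (c1_gt0 : 0 < c1) (c2_gt0 : 0 < c2)
    (eps : nat -> R)
    (eps_bounds : forall n, (0 < n)%N -> 0 < eps n < 1)
    (lambda_bounds : forall n, (0 < n)%N -> forall k : {set 'I_(p n)},
       k != finset.set0 ->
       [/\ eps n <= lambda_min (X n) k,
           lambda_min (X n) k <= lambda_max (X n) k &
           lambda_max (X n) k <= (eps n)^-1])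
    (eps_O : (fun n => ((eps n)^-1)%R : R^o) =O_\oo
             (fun n => (ln n%:R `^ (1 / 8))%R : R^o))
    (q : nat -> nat) (xi : R) (xi_lt1 : xi < 1)
    (q_O : (fun n => ((q n)%:R)%R : R^o) =O_\oo (fun n => (n%:R `^ xi)%R : R^o))
    (t_le_q : forall n, (0 < n)%N -> (#|true_model beta0 (p n)| <= q n)%N)
    (a1 a2 : R) (a1_gt0 : 0 < a1) (a1_lt_a2 : a1 < a2)
    (A_eig : forall n, (0 < n)%N -> forall a, eigenvalue (A n) a -> a1 < a < a2)
    (kappa : R) (kappa_bounds : 0 < kappa < 1)
    (p_O : (fun n => (ln (p n)%:R)%R : R^o) =O_\oo (fun n => (n%:R `^ kappa)%R : R^o)) :
  cvg_in_probability P
    (fun n (w : T n) =>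
       max_posterior_ratio r alpha1 alpha2 c1 c2 (q n) (X n) (A n)
         (true_model beta0 (p n))
         (X n *m true_coef beta0 (p n) + \col_i noise n i w))
    0.
Proof.
have mZ n : measurable_fun [set: T n] (fun w : T n =>
    max_posterior_ratio r alpha1 alpha2 c1 c2 (q n) (X n) (A n) (true_model beta0 (p n))
      (X n *m true_coef beta0 (p n) + \col_i noise n i w)).
  apply: measurable_max_posterior_ratio => i.
  under eq_fun do rewrite mxE [X in _ + X]mxE.
  exact: measurable_funD.
split=> [n _|delta delta0]; first exact: mZ.
have supp1 := beta0_supp 1%N isT.
(* The support lies below [p 1], so both extrema run over a fixed index range and [bm], [Bm] are the
   same for all n. *)
pose bm : R := \big[Num.min/1]_(i < p 1%N | beta0 i != 0) `|beta0 i|.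
pose Bm : R := \big[Num.max/1]_(i < p 1%N) beta0 i ^+ (2 * r).
have bm0 : 0 < bm by apply: lt_bigmin => // i; rewrite normr_gt0.
have Bm1 : 1 <= Bm by exact: bigmax_ge_id.
pose gc n := growth_cst r (true_model beta0 (p n)) (true_coef beta0 (p n))
  alpha1 alpha2 c1 c2 a1 a2 bm Bm (sigma0 ^+ 2).
(* The thresholds see the true model only through its cardinality and the norm of its coefficients,
   so a single [B] serves all n. *)
have gcE n : (0 < n)%N -> gc n = gc 1%N.
  move=> n0; have p1n : (p 1%N <= p n)%N by exact: p_incr.
  by rewrite /gc /growth_cst /log_cst /log_cst0 (card_true_model p1n supp1) (sqnorm_true_coef p1n supp1).
pose B : R := \big[Num.max/0]_(x <- gc 1%N) x.
have B0 : 0 <= B by exact: bigmax_ge_id.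
pose bd n : R := 2 * expR (- (n%:R / 8064)) +
  6 ^+ #|true_model beta0 (p 1%N)| * expR 6 * expR (- (527 / 8192 * ln (p n)%:R)).
have bd0 : bd @ \oo --> (0 : R).
  rewrite -[X in _ --> X](_ : 2 * 0 + 6 ^+ #|true_model beta0 (p 1%N)| * expR 6 * 0 = 0 :> R);
    last by rewrite !mulr0 addr0.
  apply: cvgD; apply: cvgMr; apply: expR_cvg0 => M; near=> n.
    by rewrite ler_pdivlMr ?ltr0n //; near: n; exact: nbhs_infty_ger.
  rewrite mulrC -ler_pdivrMr; last by rewrite divr_gt0 ?ltr0n.
  have pn : expR (M / (527 / 8192)) <= (p n)%:R.
    by near: n; exact: p_oo (nbhs_infty_ger (expR (M / (527 / 8192)))).
  by rewrite -[leLHS]expRK ler_ln ?posrE ?expR_gt0 // (lt_le_trans _ pn) ?expR_gt0.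
apply: (@squeeze_cvge _ _ _ _ (cst 0%E) _ (EFin \o bd)).
- near=> n; rewrite measure_ge0 /=.
  have n0 : (0 < n)%N by near: n; exact: nbhs_infty_gt.
  have pn0 : (0 < p n)%N by near: n; exact: p_oo (nbhs_infty_gt 0%N).
  have BL : B <= ln n%:R by near: n; exact: ln_nat_near.
  have Beps : B * (eps n)^-1 <= ln n%:R by near: n; exact: inv_eps_near.
  have Bq : B * ((q n)%:R + 1) * ln n%:R ^+ 2 <= n%:R by near: n; exact: model_size_near q_O B0.
  (* Ensures [exp(- ln n / 10) < delta], through [1 + x <= exp x]. *)
  have Ld : 10 / delta <= ln n%:R by near: n; exact: ln_nat_near.
  have p1n : (p 1%N <= p n)%N by exact: p_incr.
  have [Bad [mBad PBad BadP]] := good_event sigma0_gt0 (noise_iid n n0) (X n)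
    (true_model beta0 (p n)) pn0.
  rewrite /bd -(card_true_model p1n supp1); apply: le_trans PBad.
  apply: le_measure; rewrite ?inE //.
    rewrite (_ : [set w | _] = (fun w => `|max_posterior_ratio r alpha1 alpha2 c1 c2 (q n) (X n)
        (A n) (true_model beta0 (p n)) (X n *m true_coef beta0 (p n) + \col_i noise n i w) - 0|)
        @^-1` `[delta, +oo[).
      rewrite -[X in measurable X]setTI; apply: measurableT_comp => //.
      exact: measurable_funB.
    by apply/seteqP; split => w /=; rewrite in_itv /= andbT.
  (* By contraposition: outside [Bad] the deterministic bound keeps the ratio below [delta]. *)
  move=> w /=; apply: contraPP => /BadP[e_bounds e_dot].
  apply/negP; rewrite -ltNge subr0 ger0_norm; last exact: bigmax_ge_id.
  apply: (@le_lt_trans _ _ (expR (- (ln n%:R / 10)))).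
    apply: (@max_posterior_ratio_le R r n (p n) (q n) (X n) (A n) (true_model beta0 (p n))
      (true_coef beta0 (p n)) (noise_vec (noise n) w) alpha1 alpha2 c1 c2 a1 a2 (eps n) bm Bm
      (sigma0 ^+ 2) B) => //.
    + exact: t_le_q.
    + by move=> i; rewrite inE negbK mxE => /eqP.
    + exact: A_sym.
    + by move=> a /(A_eig n n0)/andP[la lb]; rewrite !ltW.
    + by apply: ltW; apply: lt_trans a1_lt_a2.
    + exact: ltW.
    + exact: eps_bounds.
    + move=> i; rewrite inE mxE => bi.
      exact: (bigmin_le_cond 1 (fun j : 'I_(p 1%N) => `|beta0 j|) (j := Ordinal (supp1 _ bi))).
    + move=> i; rewrite inE mxE => bi.
      exact: (le_bigmax 1 (fun j : 'I_(p 1%N) => beta0 j ^+ (2 * r)) (Ordinal (supp1 _ bi))).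
    + exact: exprn_gt0.
    + by move=> k /(lambda_bounds n n0)[].
    + by move=> k /(lambda_bounds n n0)[].
    + by move=> x; rewrite -/(gc n) gcE // => xg; exact: le_bigmax_seq.
  rewrite expRN invf_plt ?posrE ?expR_gt0 //.
  apply: lt_le_trans (expR_ge1Dx _); rewrite ltr_pwDl //.
  by rewrite ler_pdivlMr // mulrC.
- exact: cvg_cst.
- by apply: cvg_EFin; first exact: nearW.
Unshelve. all: by end_near.
Qed.
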